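(* Let $(C[[\hbar]],1_C,\cdot,\mathbf K)$ be an anomaly-free binary QFT algebra over $\Bbbk$, with classical cohomology $H$ and quantum descendant $(C[[\hbar]],1_C,\underline{\boldsymbol\ell})$. Then there exist a unital $sL_\infty$-quasi-isomorphism $$\underline{\boldsymbol\phi}=\boldsymbol\phi_1,\boldsymbol\phi_2,\ldots:\ (H[[\hbar]],1_H,\underline 0)\to (C[[\hbar]],1_C,\underline{\boldsymbol\ell})$$ and a family $\grave{\boldsymbol\pi}_n: S^nH[[\hbar]]\to H[[\hbar]]$ ($n\ge 1$) of $\Bbbk[[\hbar]]$-linear maps with the following properties. Define, for $n\ge1$ and homogeneous $v_1,\dots,v_n\in H$, $$\boldsymbol\Pi_n(v_1,\dots,v_n)=\sum_{\mathfrak p\in P(n)}(-\hbar)^{n-|\mathfrak p|}\,\varepsilon(\mathfrak p)\,\boldsymbol\phi(v_{B_1})\cdots\boldsymbol\phi(v_{B_{|\mathfrak p|}}).$$ Then: (a) for every quantum expectation $\mathbf c$ there is a $\Bbbk[[\hbar]]$-linear functional $\boldsymbol\iota:H[[\hbar]]\to\Bbbk[[\hbar]]$ such that $\mathbf c\circ\boldsymbol\Pi_n=\boldsymbol\iota\circ\grave{\boldsymbol\pi}_n$ as maps $S^nH[[\hbar]]\to\Bbbk[[\hbar]]$, for all $n\ge1$; (b) $\grave{\boldsymbol\pi}_1$ is the identity map of $H$; (c) for all $n\ge2$, $\grave{\boldsymbol\pi}_n$ depends polynomially on $\hbar$ with degree at most $n-2$: $\grave{\boldsymbol\pi}_n=\grave\pi^{(0)}_n+(-\hbar)\grave\pi^{(1)}_n+\cdots+(-\hbar)^{n-2}\grave\pi^{(n-2)}_n$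 with $\Bbbk$-linear maps $\grave\pi_n^{(j)}:S^nH\to H$; (d) for all $n\ge 2$ and $v_1,\dots,v_{n-1}\in H$, $\grave{\boldsymbol\pi}_n(v_1,\dots,v_{n-1},1_H)=\grave{\boldsymbol\pi}_{n-1}(v_1,\dots,v_{n-1})$.
   Context: Conventions. $\Bbbk$ is a field of characteristic zero, $\hbar$ a formal parameter of degree $0$. Spaces are $\mathbb Z$-graded, $|x|$ is the degree (ghost number), $Jx=(-1)^{|x|}x$. $\mathrm{Hom}(V,W)^j$ is the space of $\Bbbk$-linear maps of degree $j$; $V[[\hbar]]=\bigoplus_jV^j[[\hbar]]$. A series $\mathbf b=b^{(0)}+\hbar b^{(1)}+\cdots\in\mathrm{Hom}(V,W)^j[[\hbar]]$ is identified with the $\Bbbk[[\hbar]]$-linear map $V[[\hbar]]\to W[[\hbar]]$ it determines by $\hbar$-adic continuity; $b^{(0)}$ is its classical limit. $S^nV$ is the $n$-th graded-symmetric power; $\beta_n\in\mathrm{Hom}(S^nV,W)$ is written $\beta_n(v_1,\dots,v_n)$. Partitions. $P(n)$ is the set of partitions $\mathfrak p=B_1\sqcup\cdots\sqcup B_{|\mathfrak p|}$ of $\{1,\dots,n\}$ into nonempty blocks, ordered by increasing maximal elements, each block in increasing order; $|B|$ is the size of a block. For homogeneous $v_1,\dots,v_n$ and $B=\{j_1<\dots<j_r\}$, $v_B=v_{j_1}\otimes\cdots\otimes v_{j_r}$, $Jv_B$ means $J$ applied to every entry, and $\beta(v_B)=\beta_r(v_{j_1},\dots,v_{j_r})$ for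 a family $\underline\beta=\beta_1,\beta_2,\dots$. The Koszul sign $\varepsilon(\mathfrak p)=\pm1$ is defined by $v_1\odot\cdots\odot v_n=\varepsilon(\mathfrak p)\,v_{B_1}\odot\cdots\odot v_{B_{|\mathfrak p|}}$. A sum over ''$\mathfrak p\in P(n)$, $|B_i|=n-|\mathfrak p|+1$'' runs over pairs $(\mathfrak p,i)$ such that $B_i$ has $n-|\mathfrak p|+1$ elements (so all other blocks are singletons). Unital $sL_\infty$-algebras. A unital $sL_\infty$-algebra structure on $V[[\hbar]]$ is a tuple $(V[[\hbar]],1_V,\underline l)$ with $1_V\in V^0$, $l_n\in\mathrm{Hom}(S^nV,V)^1[[\hbar]]$, $l_n(v_1,\dots,v_{n-1},1_V)=0$ and $\sum_{\mathfrak p\in P(n),|B_i|=n-|\mathfrak p|+1}\varepsilon(\mathfrak p)\,l_{|\mathfrak p|}(Jv_{B_1},\dots,Jv_{B_{i-1}},l(v_{B_i}),v_{B_{i+1}},\dots,v_{B_{|\mathfrak p|}})=0$ for all $n\ge1$. A unital $sL_\infty$-morphism $\underline\varphi:(V[[\hbar]],1_V,\underline l)\to(V'[[\hbar]],1_{V'},\underline l')$ is a family $\varphi_n\in\mathrm{Hom}(S^nV,V')^0[[\hbar]]$ with $\varphi_1(1_V)=1_{V'}$, $\varphi_n(v_1,\dots,v_{n-1},1_V)=0$ for $n\ge2$, and $\sum_{\mathfrak p\in P(n)}\varepsilon(\mathfrak p)\,l'_{|\mathfrak p|}(\varphi(v_{B_1}),\dots,\varphi(v_{B_{|\mathfrak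 p|}}))=\sum_{\mathfrak p\in P(n),|B_i|=n-|\mathfrak p|+1}\varepsilon(\mathfrak p)\,\varphi_{|\mathfrak p|}(Jv_{B_1},\dots,Jv_{B_{i-1}},l(v_{B_i}),v_{B_{i+1}},\dots,v_{B_{|\mathfrak p|}})$. It is a quasi-isomorphism if $\varphi_1:(V[[\hbar]],l_1)\to(V'[[\hbar]],l'_1)$ is. $\underline 0$ is the zero $sL_\infty$-structure. Binary QFT algebra. A tuple $(C[[\hbar]],1_C,\cdot,\mathbf K)$ where $(C,1_C,\cdot)$ is a unital graded-commutative associative $\Bbbk$-algebra (product extended $\Bbbk[[\hbar]]$-bilinearly to $C[[\hbar]]$), $\mathbf K=K^{(0)}+\hbar K^{(1)}+\cdots\in\mathrm{Hom}(C,C)^1[[\hbar]]$ with $\mathbf K1_C=0$, $\mathbf K\circ\mathbf K=0$, $1_C\ne K^{(0)}x$ for all $x\in C$, such that the family $\underline{\boldsymbol\ell}=\boldsymbol\ell_1,\boldsymbol\ell_2,\dots$ determined recursively by $$\mathbf K(x_1\cdots x_n)=\sum_{\mathfrak p\in P(n),\,|B_i|=n-|\mathfrak p|+1}(-\hbar)^{n-|\mathfrak p|}\varepsilon(\mathfrak p)\,Jx_{B_1}\cdots Jx_{B_{i-1}}\cdot\boldsymbol\ell(x_{B_i})\cdot x_{B_{i+1}}\cdots x_{B_{|\mathfrak p|}}$$ satisfies $\boldsymbol\ell_n\in\mathrm{Hom}(S^nC,C)^1[[\hbar]]$ for all $n$ (a priori only $(-\hbar)^{n-1}\boldsymbol\ell_n$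 has no negative powers of $\hbar$). $(C[[\hbar]],1_C,\underline{\boldsymbol\ell})$ is its quantum descendant; it is a unital $sL_\infty$-algebra over $\Bbbk[[\hbar]]$. Anomaly-free. Let $K=K^{(0)}$, let $H$ be the cohomology of $(C,K)$ (classical cohomology) and $1_H$ the class of $1_C$. Choose a classical off-to-on-shell retract $(f,h,s)$: $f\in\mathrm{Hom}(H,C)^0$, $h\in\mathrm{Hom}(C,H)^0$, $s\in\mathrm{Hom}(C,C)^{-1}$ with $f(1_H)=1_C$, $K f=0$, $f$ inducing the identity on cohomology, $h(1_C)=1_H$, $hK=0$, $hf=\mathrm{id}_H$, $fh=\mathrm{id}_C-Ks-sK$, $K=KsK$, $s(1_C)=0$, $ss=sf=hs=0$. Put $f^{(0)}=f$ and, for $n\ge1$, $g^{(n)}=\sum_{j=0}^{n-1}K^{(n-j)}f^{(j)}-\sum_{j=1}^{n-1}f^{(n-j)}\kappa^{(j)}$, $\kappa^{(n)}=h g^{(n)}$, $f^{(n)}=-s g^{(n)}$, and $\boldsymbol\kappa=\sum_{n\ge1}\hbar^n\kappa^{(n)}$. The algebra is anomaly-free if $\boldsymbol\kappa=0$ (this does not depend on the choice of retract). A quantum expectation is a pointed cochain map $\mathbf c:(C[[\hbar]],1_C,\mathbf K)\to(\Bbbk[[\hbar]],1,0)$, i.e. $\mathbf c\in\mathrm{Hom}(C,\Bbbk)^0[[\hbar]]$ with $\mathbf c(1_C)=1$ and $\mathbf c\circ\mathbf K=0$. *)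

(* Defs.v *)
(* Conventions.
   - A Z-graded space is an lmodType V with a family GV : int -> V -> Prop of
     subspaces whose internal direct sum is V (is_grading).
   - A formal power series in hbar with coefficients in T is its sequence of
     coefficients, of type nat -> T.
   - A family b_1, b_2, ... of multilinear maps with values in W[[hbar]] is a
     function b : seq V -> nat -> W: b_n is the restriction of b to sequences of
     size n, and b vs m is the coefficient of hbar^m.  The value of b at [::]
     is never used.
   - Indices 1, ..., n are shifted to 0, ..., n-1 ('I_n). *)
From HB Require Import structures.
From mathcomp Require Import all_boot all_algebra.
From mathcomp Require Import boolp functions.

Set Implicit Arguments.
Unset Strict Implicit.
Unset Printing Implicit Defensive.

Import GRing.Theory.
Local Open Scope ring_scope.
Local Open Scope quotient_scope.

Record is_grading (k : fieldType) (V : lmodType k) (GV : int -> V -> Prop) :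
    Prop := IsGrading {
  grading0 : forall j, GV j 0;
  gradingP : forall j a x y, GV j x -> GV j y -> GV j (a *: x + y);
  grading_span : forall v, exists (s : seq int) (w : int -> V),
    [/\ uniq s, forall j, GV j (w j) & v = \sum_(j <- s) w j];
  grading_free : forall (s : seq int) (w : int -> V),
    uniq s -> (forall j, GV j (w j)) -> \sum_(j <- s) w j = 0 ->
    forall j, j \in s -> w j = 0 }.

Definition ground_grading (k : fieldType) (j : int) (x : k^o) : Prop :=
  j = 0 \/ x = 0.

Definition homog_map (V W : Type) (GV : int -> V -> Prop) (GW : int -> W -> Prop)
    (e : int) (f : V -> W) : Prop :=
  forall j x, GV j x -> GW (j + e) (f x).

(* k-linear maps S^n V -> W, as graded-symmetric n-linear maps. *)
Definition sym_multilinear (k : fieldType) (V W : lmodType k)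
    (GV : int -> V -> Prop) (n : nat) (b : seq V -> W) : Prop :=
  (forall (a : k) x y s1 s2, (size s1 + size s2).+1 = n ->
     b (s1 ++ (a *: x + y) :: s2) = a *: b (s1 ++ x :: s2) + b (s1 ++ y :: s2))
  /\
  (forall i j x y s1 s2, (size s1 + size s2).+2 = n -> GV i x -> GV j y ->
     b (s1 ++ x :: y :: s2) = (-1) ^ (i * j) *: b (s1 ++ y :: x :: s2)).

Definition homog_family (n : nat) (V : Type) (GV : int -> V -> Prop)
    (d : 'I_n -> int) (v : 'I_n -> V) : Prop :=
  forall i, GV (d i) (v i).

(* b_n \in Hom(S^n V, W)^e[[hbar]] *)
Definition in_Hom_sym (k : fieldType) (V W : lmodType k)
    (GV : int -> V -> Prop) (GW : int -> W -> Prop)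
    (n : nat) (e : int) (b : seq V -> nat -> W) : Prop :=
  forall m : nat, sym_multilinear GV n (fun vs => b vs m) /\
    forall (d : 'I_n -> int) (v : 'I_n -> V), homog_family GV d v ->
      GW (\sum_(i < n) d i + e) (b (codom v) m).

Definition hconst (V : zmodType) (x : V) : nat -> V :=
  fun m => if m is 0 then x else 0.

(* Multiplication by (- hbar)^r. *)
Definition mhbar (k : fieldType) (V : lmodType k) (r : nat) (x : nat -> V) :
    nat -> V :=
  fun m => if (r <= m)%N then (-1) ^+ r *: x (m - r)%N else 0.

Definition hmul (k : fieldType) (A : algType k) (x y : nat -> A) : nat -> A :=
  fun m => \sum_(i < m.+1) x i * y (m - i)%N.

Definition hprod (k : fieldType) (A : algType k) (xs : seq (nat -> A)) :
    nat -> A :=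
  foldr (@hmul k A) (hconst 1) xs.

(* The k[[hbar]]-linear map determined by a series of k-linear maps. *)
Definition hact (k : fieldType) (V W : lmodType k) (F : nat -> {linear V -> W})
    (x : nat -> V) : nat -> W :=
  fun m => \sum_(i < m.+1) F i (x (m - i)%N).

(* The k[[hbar]]-multilinear extension of b, applied to a list of series. *)
Fixpoint happ (V : Type) (W : zmodType) (b : seq V -> nat -> W)
    (xs : seq (nat -> V)) : nat -> W :=
  if xs is x :: xs' then
    fun m => \sum_(i < m.+1) happ (fun vs => b (x i :: vs)) xs' (m - i)%N
  else b [::].

(* V[[hbar]] is the direct sum of the V^j[[hbar]], so only finitely many degrees
   occur in a given series. *)
Definition in_hseries (k : fieldType) (V : lmodType k) (GV : int -> V -> Prop)
    (x : nat -> V) : Prop :=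
  exists s : seq int, forall m, exists w : int -> V,
    (forall j, GV j (w j)) /\ x m = \sum_(j <- s) w j.

Definition Pn (n : nat) : {set {set {set 'I_n}}} :=
  [set p | partition p [set: 'I_n]].

Definition blocks (n : nat) (p : {set {set 'I_n}}) : seq {set 'I_n} :=
  sort (fun A B : {set 'I_n} =>
          (\max_(i in A) (i : nat) <= \max_(i in B) (i : nat))%N) (enum p).

Definition block (n : nat) (p : {set {set 'I_n}}) (i : nat) : {set 'I_n} :=
  nth set0 (blocks p) i.

(* v_B; enum B lists B in increasing order. *)
Definition restr (n : nat) (V : Type) (v : 'I_n -> V) (B : {set 'I_n}) : seq V :=
  [seq v i | i <- enum B].

Definition block_word (n : nat) (bs : seq {set 'I_n}) : seq 'I_n :=
  flatten [seq enum (B : {set 'I_n}) | B <- bs].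

(* The Koszul sign of v_1 ... v_n = +/- v_(w_1) ... v_(w_n), for w a rearrangement
   of the indices and v_i of degree d i: the letter w_1 is moved to the left past
   all smaller indices, then the remaining letters are treated in the same way
   (see koszulP). *)
Fixpoint koszul (k : fieldType) (n : nat) (d : 'I_n -> int) (w : seq 'I_n) : k :=
  if w is i :: w' then
    (\prod_(j <- w' | (j < i)%N) (-1) ^ (d i * d j)) * koszul k d w'
  else 1.

Definition eps (k : fieldType) (n : nat) (d : 'I_n -> int)
    (p : {set {set 'I_n}}) : k :=
  koszul k d (block_word (blocks p)).

Section KoszulSign.
Context (k : fieldType) (V W : lmodType k) (GV : int -> V -> Prop) (n : nat).
Context (b : seq V -> W) (b_sym : sym_multilinear GV n b).
Context (d : 'I_n -> int) (v : 'I_n -> V) (v_homog : homog_family GV d v).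
Let ordlt : rel 'I_n := fun i j => (i < j)%N.

Fact koszul_insert (i : 'I_n) (t : seq 'I_n) : sorted ordlt t -> i \notin t ->
  exists u, [/\ perm_eq u (i :: t), sorted ordlt u & forall s,
    (size s + size t).+1 = n ->
    b (s ++ map v u)
    = \prod_(j <- t | (j < i)%N) (-1) ^ (d i * d j) *: b (s ++ v i :: map v t)].
Proof.
have lt_tr : transitive ordlt by move=> y x z; apply: ltn_trans.
elim: t => [|j t IH] /=.
  by move=> _ _; exists [:: i]; split=> // s _; rewrite big_nil scale1r.
move=> jt; rewrite inE negb_or => /andP[ij it].
have /= := jt; rewrite (path_sortedE lt_tr) => /andP[/allP jlt st].
case: (ltnP j i) => [ji|le_ij].
  have [u [pu su Hu]] := IH st it.
  exists (j :: u); split=> [||s sz].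
  - by rewrite perm_sym (perm_catCA [:: i] [:: j] t) /= perm_cons perm_sym.
  - rewrite /= (path_sortedE lt_tr) su andbT; apply/allP => x.
    by rewrite (perm_mem pu) inE => /predU1P[->|/jlt].
  have sz' : (size (rcons s (v j)) + size t).+1 = n.
    by rewrite size_rcons addSnnS.
  rewrite /= -cat_rcons (Hu _ sz') cat_rcons big_cons ji.
  rewrite (b_sym.2 (d j) (d i) (v j) (v i)) ?size_map; first last.
  - exact: v_homog.
  - exact: v_homog.
  - by move: sz; rewrite /= addnS.
  by rewrite scalerA mulrC (mulrC (d j)).
have lij : (i < j)%N by rewrite ltn_neqAle le_ij andbT; apply: contra ij => /eqP/val_inj ->.
exists (i :: j :: t); split=> [//||s _].
  by rewrite /= jt andbT.
rewrite big1_seq ?scale1r // => x /andP[xi].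
rewrite inE => /predU1P[xj|/jlt jx]; first by move: xi; rewrite xj ltnNge ltnW.
by move: (ltn_trans (ltn_trans lij jx) xi); rewrite ltnn.
Qed.

(* The defining property of the Koszul sign. *)
Lemma koszulP (w : seq 'I_n) : perm_eq w (enum 'I_n) ->
  b (codom v) = koszul k d w *: b (map v w).
Proof.
have lt_tr : transitive ordlt by move=> y x z; apply: ltn_trans.
have sortw (t : seq 'I_n) : uniq t -> exists u, [/\ perm_eq u t, sorted ordlt u & forall s,
    (size s + size t)%N = n ->
    b (s ++ map v u) = koszul k d t *: b (s ++ map v t)].
  elim: t => [_|i t IH /= /andP[it ut]].
    by exists [::]; split=> // s _; rewrite scale1r.
  have [u [pu su Hu]] := IH ut.
  have iu : i \notin u by rewrite (perm_mem pu).
  have [u' [pu' su' Hu']] := koszul_insert su iu.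
  exists u'; split=> // [|s sz].
    by rewrite (permPl pu') perm_cons.
  rewrite Hu' ?(perm_size pu) -?addnS // -cat_rcons Hu; last first.
    by rewrite size_rcons addSnnS.
  by rewrite cat_rcons scalerA (perm_big _ pu).
move=> pw; have uw : uniq w by rewrite (perm_uniq pw) enum_uniq.
have [u [pu su Hu]] := sortw w uw.
have := Hu [::]; rewrite /= (perm_size pw) size_enum_ord => <- //.
congr (b (map v _)); apply: (irr_sorted_eq lt_tr) => //.
- by move=> i; apply: ltnn.
- have := iota_ltn_sorted 0 n; rewrite -val_enum_ord sorted_map.
  by [].
by move=> i; rewrite (perm_mem pu) (perm_mem pw).
Qed.

End KoszulSign.

(* The list J v_(B_1), ..., J v_(B_(i-1)), l(v_(B_i)), v_(B_(i+1)), ... of elements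
   of V[[hbar]], for i counted from 0. *)
Definition bracket_word (k : fieldType) (V : lmodType k) (l : seq V -> nat -> V)
    (n : nat) (d : 'I_n -> int) (v : 'I_n -> V) (p : {set {set 'I_n}}) (i : nat) :
    seq (nat -> V) :=
  [seq hconst ((-1) ^ d j *: v j) | j <- block_word (take i (blocks p))]
  ++ l (restr v (block p i))
  :: [seq hconst (v j) | j <- block_word (drop i.+1 (blocks p))].

Record unital_sLinf_morphism (k : fieldType) (V W : lmodType k)
    (GV : int -> V -> Prop) (oneV : V) (l : seq V -> nat -> V)
    (GW : int -> W -> Prop) (oneW : W) (l' : seq W -> nat -> W)
    (phi : seq V -> nat -> W) : Prop := UnitalSLinfMorphism {
  sLinf_morphism_hom : forall n, (0 < n)%N -> in_Hom_sym GV GW n 0 phi;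
  sLinf_morphism_unit : phi [:: oneV] = hconst oneW;
  sLinf_morphism_unital : forall vs, (0 < size vs)%N -> phi (rcons vs oneV) = 0;
  sLinf_morphism_eq : forall n (d : 'I_n -> int) (v : 'I_n -> V),
    (0 < n)%N -> homog_family GV d v ->
    \sum_(p in Pn n) eps k d p *: happ l' [seq phi (restr v B) | B <- blocks p]
    = \sum_(p in Pn n)
        \sum_(i < #|p| | #|block p i| == (n - #|p|).+1)
          eps k d p *: happ phi (bracket_word l d v p i) }.

(* phi_1 induces an isomorphism H(V[[hbar]], l_1) -> H(W[[hbar]], l'_1). *)
Definition quasi_iso (k : fieldType) (V W : lmodType k)
    (GV : int -> V -> Prop) (l : seq V -> nat -> V)
    (GW : int -> W -> Prop) (l' : seq W -> nat -> W)
    (phi : seq V -> nat -> W) : Prop :=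
  (forall x, in_hseries GV x -> happ l [:: x] = 0 ->
     (exists2 y, in_hseries GW y & happ phi [:: x] = happ l' [:: y]) ->
     exists2 z, in_hseries GV z & x = happ l [:: z])
  /\
  (forall y, in_hseries GW y -> happ l' [:: y] = 0 ->
     exists x z, [/\ in_hseries GV x, happ l [:: x] = 0, in_hseries GW z
                   & y = happ phi [:: x] + happ l' [:: z]]).

Definition unital_sLinf_quasi_iso (k : fieldType) (V W : lmodType k)
    (GV : int -> V -> Prop) (oneV : V) (l : seq V -> nat -> V)
    (GW : int -> W -> Prop) (oneW : W) (l' : seq W -> nat -> W)
    (phi : seq V -> nat -> W) : Prop :=
  unital_sLinf_morphism GV oneV l GW oneW l' phi /\ quasi_iso GV l GW l' phi.

Record graded_comm_algebra (k : fieldType) (C : algType k)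
    (GC : int -> C -> Prop) : Prop := GradedCommAlgebra {
  gca_grading : is_grading GC;
  gca_one : GC 0 1;
  gca_mul : forall i j x y, GC i x -> GC j y -> GC (i + j) (x * y);
  gca_comm : forall i j x y, GC i x -> GC j y ->
    x * y = (-1) ^ (i * j) *: (y * x) }.

Record quantum_descendant (k : fieldType) (C : algType k) (GC : int -> C -> Prop)
    (K : nat -> {linear C -> C}) (l : seq C -> nat -> C) : Prop :=
  QuantumDescendant {
  descendant_hom : forall n, (0 < n)%N -> in_Hom_sym GC GC n 1 l;
  descendant_eq : forall n (d : 'I_n -> int) (x : 'I_n -> C),
    (0 < n)%N -> homog_family GC d x ->
    hact K (hconst (\prod_(i < n) x i))
    = \sum_(p in Pn n)
        \sum_(i < #|p| | #|block p i| == (n - #|p|).+1)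
          mhbar (n - #|p|) (eps k d p *: hprod (bracket_word l d x p i)) }.

(* The defining recursion has at most one solution, since multiplication by
   (- hbar)^(n-1) is injective; the last field says that this solution has no
   negative powers of hbar. *)
Record binary_QFT_algebra (k : fieldType) (C : algType k) (GC : int -> C -> Prop)
    (K : nat -> {linear C -> C}) : Prop := BinaryQFTAlgebra {
  qft_algebra : graded_comm_algebra GC;
  qft_degree : forall m, homog_map GC GC 1 (K m);
  qft_one : forall m, K m 1 = 0;
  qft_square : forall x, in_hseries GC x -> hact K (hact K x) = 0;
  qft_nontrivial : forall x, 1 <> K 0%N x;
  qft_descendant : exists l, quantum_descendant GC K l }.

Section Cohomology.
Context (k : fieldType) (V : lmodType k) (K : {linear V -> V}).

Definition is_cocycle : pred V := fun x => K x == 0.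

Fact is_cocycle_submod : submod_closed is_cocycle.
Proof.
split=> [|a x y]; first by apply/eqP; rewrite linear0.
by move=> /eqP x0 /eqP y0; apply/eqP; rewrite linearP x0 y0 scaler0 addr0.
Qed.
HB.instance Definition _ := GRing.isSubmodClosed.Build k V is_cocycle
  is_cocycle_submod.

Record cocycle := Cocycle { cocycle_val :> V; _ : cocycle_val \in is_cocycle }.
HB.instance Definition _ := [isSub for cocycle_val].
HB.instance Definition _ := [Choice of cocycle by <:].
HB.instance Definition _ := [SubChoice_isSubLmodule of cocycle by <:].

Definition is_coboundary : pred cocycle :=
  fun z => `[< exists x, val z = K x >].

Fact is_coboundary_zmod : zmod_closed is_coboundary.
Proof.
split=> [|z1 z2]; first by apply/asboolP; exists 0; rewrite linear0.
move=> /asboolP[x ex] /asboolP[y ey]; apply/asboolP; exists (x - y).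
by rewrite [RHS]linearB -ex -ey raddfB.
Qed.
HB.instance Definition _ := GRing.isZmodClosed.Build cocycle is_coboundary
  is_coboundary_zmod.

Definition coboundaries : zmodClosed cocycle :=
  GRing.ZmodClosed.clone _ is_coboundary _.

Definition cohomology := Quotient.quot coboundaries.
HB.instance Definition _ := GRing.Zmodule.on cohomology.

Definition coh_scale (a : k) : cohomology -> cohomology :=
  lift_op1 cohomology ( *:%R a).

Fact pi_coh_scale a : {morph \pi_cohomology : z / a *: z >-> coh_scale a z}.
Proof.
move=> z; unlock coh_scale; apply/eqP; rewrite -Quotient.idealrBE.
have : z - repr (\pi_cohomology z) \in coboundaries.
  by rewrite Quotient.idealrBE reprK.
move=> /asboolP[x ex]; apply/asboolP; exists (a *: x).
by rewrite -scalerBr [RHS]linearZ -ex linearZ.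
Qed.


Fact coh_scaleA a b x : coh_scale a (coh_scale b x) = coh_scale (a * b) x.
Proof. by rewrite -[x]reprK -!pi_coh_scale scalerA. Qed.

Fact coh_scale1 : left_id 1 coh_scale.
Proof. by move=> x; rewrite -[x]reprK -pi_coh_scale scale1r. Qed.

Fact coh_scaleDr : right_distributive coh_scale +%R.
Proof.
move=> a x y; rewrite -[x]reprK -[y]reprK -raddfD -!pi_coh_scale -raddfD.
by rewrite scalerDr.
Qed.

Fact coh_scaleDl x : {morph coh_scale^~ x : a b / a + b}.
Proof. by move=> a b; rewrite -[x]reprK -!pi_coh_scale -raddfD scalerDl. Qed.

HB.instance Definition _ := GRing.Zmodule_isLmodule.Build k cohomology
  coh_scaleA coh_scale1 coh_scaleDr coh_scaleDl.

(* The class of a cocycle; 0 if x is not a cocycle. *)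
Definition coh_class (x : V) : cohomology := \pi_cohomology (insubd 0 x).

Lemma coh_class_eq x y : K x = 0 -> K y = 0 ->
  (coh_class x = coh_class y <-> exists z, x - y = K z).
Proof.
move=> /eqP Kx /eqP Ky.
have vB : val ((insubd 0 x : cocycle) - insubd 0 y) = x - y.
  by rewrite raddfB /= !insubdK.
split=> [/eqP|[z xy]].
  by rewrite -Quotient.idealrBE => /asboolP[z]; rewrite vB; exists z.
by apply/eqP; rewrite -Quotient.idealrBE; apply/asboolP; exists z; rewrite vB.
Qed.

Lemma coh_class_linear a x y : K x = 0 -> K y = 0 ->
  coh_class (a *: x + y) = a *: coh_class x + coh_class y.
Proof.
move=> Kx Ky; rewrite -[RHS]/(coh_scale a (\pi_cohomology (insubd 0 x)) + coh_class y).
rewrite -pi_coh_scale -raddfD; congr (\pi_cohomology _); apply: val_inj.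
rewrite [RHS](linearP \val) /= !insubdK //; apply/eqP; rewrite ?Kx ?Ky //.
by rewrite linearP Kx Ky scaler0 addr0.
Qed.

Lemma coh_class_surj c : exists2 x, K x = 0 & c = coh_class x.
Proof.
exists (val (repr c)); first exact/eqP/(valP (repr c)).
by rewrite /coh_class valKd reprK.
Qed.

Definition coh_grading (GV : int -> V -> Prop) (j : int) (c : cohomology) : Prop :=
  exists x, [/\ GV j x, K x = 0 & c = coh_class x].

End Cohomology.

Record on_shell_retract (k : fieldType) (C : algType k) (GC : int -> C -> Prop)
    (K : {linear C -> C}) (f : {linear cohomology K -> C})
    (h : {linear C -> cohomology K}) (s : {linear C -> C}) : Prop :=
  OnShellRetract {
  retract_f_degree : homog_map (coh_grading GC) GC 0 f;
  retract_h_degree : homog_map GC (coh_grading GC) 0 h;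
  retract_s_degree : homog_map GC GC (-1) s;
  retract_f1 : f (coh_class K 1) = 1;
  retract_Kf : forall a, K (f a) = 0;
  retract_f_class : forall a, coh_class K (f a) = a;
  retract_h1 : h 1 = coh_class K 1;
  retract_hK : forall x, h (K x) = 0;
  retract_hf : forall a, h (f a) = a;
  retract_fh : forall x, f (h x) = x - K (s x) - s (K x);
  retract_KsK : forall x, K x = K (s (K x));
  retract_s1 : s 1 = 0;
  retract_ss : forall x, s (s x) = 0;
  retract_sf : forall a, s (f a) = 0;
  retract_hs : forall x, h (s x) = 0 }.

(* g^(n) in terms of f^(j), j < n, and kappa^(j), 1 <= j < n. *)
Definition obstruction (k : fieldType) (H C : lmodType k)
    (K : nat -> {linear C -> C}) (f : nat -> H -> C) (kappa : nat -> H -> H)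
    (n : nat) (a : H) : C :=
  \sum_(0 <= j < n) K (n - j)%N (f j a)
  - \sum_(1 <= j < n) f (n - j)%N (kappa j a).

(* The three equations determine f^(n) and kappa^(n) recursively from the
   retract (f, h, s). *)
Definition anomaly_free (k : fieldType) (C : algType k) (GC : int -> C -> Prop)
    (K : nat -> {linear C -> C}) : Prop :=
  exists (f : {linear cohomology (K 0%N) -> C})
         (h : {linear C -> cohomology (K 0%N)}) (s : {linear C -> C})
         (fs : nat -> cohomology (K 0%N) -> C)
         (kappa : nat -> cohomology (K 0%N) -> cohomology (K 0%N)),
    [/\ on_shell_retract GC f h s,
        forall a, fs 0%N a = f a,
        forall n a, (0 < n)%N -> kappa n a = h (obstruction K fs kappa n a),
        forall n a, (0 < n)%N -> fs n a = - s (obstruction K fs kappa n a)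
      & forall n a, (0 < n)%N -> kappa n a = 0].

Record quantum_expectation (k : fieldType) (C : algType k)
    (GC : int -> C -> Prop) (K : nat -> {linear C -> C})
    (c : nat -> {linear C -> k^o}) : Prop := QuantumExpectation {
  expectation_degree : forall m, homog_map GC (@ground_grading k) 0 (c m);
  expectation_one : hact c (hconst 1) = hconst (1 : k^o);
  expectation_cochain : forall x, in_hseries GC x -> hact c (hact K x) = 0 }.

Definition Pi_corr (k : fieldType) (H : lmodType k) (C : algType k)
    (phi : seq H -> nat -> C) (n : nat) (d : 'I_n -> int) (v : 'I_n -> H) :
    nat -> C :=
  \sum_(p in Pn n)
    mhbar (n - #|p|) (eps k d p *: hprod [seq phi (restr v B) | B <- blocks p]).

(* Main.v *)
Require Import Defs.
From HB Require Import structures.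
From mathcomp Require Import all_boot all_algebra.
From mathcomp Require Import boolp functions.
From mathcomp Require Import zify ring ssrAC.

Set Implicit Arguments.
Unset Strict Implicit.
Unset Printing Implicit Defensive.

Import GRing.Theory.
Local Open Scope ring_scope.


(** Since K has no anomaly, the homological perturbation lemma turns the
    classical retract into a deformation retract (F, Hh, S) of (C[[hbar]], K) onto
    (H[[hbar]], 0) over the power series ring ([quantum_retract_exists]).

    Let Pi_n be the partition sum of a family phi, and M_n the left side of the
    morphism equation for phi (its right side vanishes, the source structure being
    zero).  Expanding K of each product in Pi_n by the descendant relation, and
    collecting the terms by the set A of all indices fed into the descendant, gives
      K Pi(v) = sum over A of (- hbar)^(|A| - 1) M(v_A) Pi(v_(A^c)),
    up to Koszul signs ([hact_partition_sum]).  As hbar is not a zero divisor, phi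
    is a morphism as soon as every Pi_n is K-closed.

    The components of phi are built one after the other, starting with phi_1 = F.
    Let X be the part of Pi_n made of the components of arity less than n, so that
    Pi_n = X + (- hbar)^(n-1) phi_n.  By the formula, K X = (- hbar)^(n-1) L
    for some L ([obstruction_divisible]), and K L = 0, Hh L = 0 because hbar is not
    a zero divisor.  Hence L = K S L, and phi_n = - S L - F psi makes Pi_n closed
    whatever psi is.  Let psi be such that (- hbar)^(n-1) psi is the part of order at
    least n-1 of Hh X.  Then the class pi_n = Hh Pi_n is the part of order at most
    n-2 of Hh X ([correction], [stage_step]).

    When the last argument is the unit, X becomes Pi_(n-1), which is closed and has
    a class without terms of order n-1 or more; so both terms of phi_n vanish, phi
    is unital, and pi_n restricts to pi_(n-1).  Finally Pi_n = F pi_n + K S Pi_n, and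
    a quantum expectation c kills the image of K, so c Pi_n = (c F) pi_n.

    Sums over set partitions are handled as sums over lists of words of natural
    numbers ([big_Pn]), which obey a recursion on the block of the largest index.
    Signs enter only through the rule for exchanging two neighbouring letters
    ([koszul_type]).  They depend on degrees, so Pi_n is first defined on
    homogeneous arguments and then extended multilinearly ([extended_sum]). *)

(** * Formal power series *)

Lemma serE (V : zmodType) (x y : nat -> V) m : (x + y) m = x m + y m.
Proof. by []. Qed.

Lemma serN (V : zmodType) (x : nat -> V) m : (- x) m = - x m.
Proof. by []. Qed.

Lemma serZ (k : fieldType) (V : lmodType k) a (x : nat -> V) m :
  (a *: x) m = a *: x m.
Proof. by []. Qed.

Lemma ser_sum (V : zmodType) (I : Type) (r : seq I) (P : pred I)
    (F : I -> nat -> V) m :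
  (\sum_(i <- r | P i) F i) m = \sum_(i <- r | P i) F i m.
Proof. by rewrite fct_sumE. Qed.

(** Associativity of the convolution of power series: both sides sum over the
    decompositions of m into three parts. *)
Lemma triangle_sum (V : zmodType) (A : nat -> nat -> nat -> V) m :
  \sum_(i < m.+1) \sum_(j < (m - i).+1) A i j (m - i - j)%N
  = \sum_(t < m.+1) \sum_(i < t.+1) A i (t - i)%N (m - t)%N.
Proof.
transitivity (\sum_(i < m.+1) \sum_(t < m.+1 | (i <= t)%N)
    A i (t - i)%N (m - t)%N).
  apply: eq_bigr => i _.
  rewrite -(big_mkord (fun t => (i <= t)%N) (fun t => A i (t - i)%N (m - t)%N)).
  have im : (i <= m.+1)%N by apply: ltnW.
  rewrite (big_cat_nat (leq0n i) im) /= big_nat_cond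
    [X in _ = X + _]big1 ?add0r; last first.
    by move=> t /andP[/andP[_ ti]]; rewrite leqNgt ti.
  rewrite -[X in index_iota X m.+1]add0n big_addn subSn; last by rewrite -ltnS.
  rewrite [RHS](eq_bigl (fun=> true)); last by move=> t; rewrite leq_addl.
  by rewrite big_mkord; apply: eq_bigr => t _; rewrite addnK subnDA subnAC.
rewrite (exchange_big_dep xpredT) //=; apply: eq_bigr => t _.
rewrite -(big_mkord (fun i => (i <= t)%N) (fun i => A i (t - i)%N (m - t)%N)).
rewrite (big_cat_nat (n := t.+1)) //= addrC big_nat_cond
  [X in X + _ = _]big1 ?add0r; last first.
  by move=> i /andP[/andP[ti _]]; rewrite leqNgt ti.
rewrite big_nat_cond [LHS](eq_bigl (fun i => (0 <= i < t.+1)%N)).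
  by rewrite -big_nat big_mkord.
by move=> i; rewrite ltnS andbC; case: (i <= t)%N.
Qed.

Section Series.
Context (k : fieldType).

Fact mhbar_linear (V : lmodType k) r : linear (@mhbar k V r).
Proof.
move=> a x y; apply/funext => m; rewrite !serE serZ /mhbar.
by case: leqP => _; [rewrite linearP | rewrite scaler0 addr0].
Qed.
HB.instance Definition _ (V : lmodType k) r :=
  GRing.isLinear.Build k (nat -> V) (nat -> V) _ (@mhbar k V r)
    (@mhbar_linear V r).

Fact hact_linear (V W : lmodType k) (F : nat -> {linear V -> W}) :
  linear (hact F).
Proof.
move=> a x y; apply/funext => m; rewrite !serE serZ /hact scaler_sumr -big_split.
by apply: eq_bigr => i _; rewrite serE serZ linearP.
Qed.
HB.instance Definition _ (V W : lmodType k) (F : nat -> {linear V -> W}) :=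
  GRing.isLinear.Build k (nat -> V) (nat -> W) _ (hact F) (@hact_linear V W F).

Fact hmul_linear (A : algType k) (x : nat -> A) : linear (hmul x).
Proof.
move=> a y z; apply/funext => m; rewrite !serE serZ /hmul scaler_sumr -big_split.
by apply: eq_bigr => i _; rewrite serE serZ mulrDr scalerAr.
Qed.
HB.instance Definition _ (A : algType k) (x : nat -> A) :=
  GRing.isLinear.Build k (nat -> A) (nat -> A) _ (hmul x) (@hmul_linear A x).

(** Makes multiplication on the right an instance of a linear map. *)
Definition hmulr (A : algType k) (y x : nat -> A) := hmul x y.

Fact hmulr_linear (A : algType k) (y : nat -> A) : linear (hmulr y).
Proof.
move=> a x z; apply/funext => m; rewrite /hmulr !serE serZ /hmul scaler_sumr.
rewrite -big_split; apply: eq_bigr => i _.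
by rewrite serE serZ mulrDl scalerAl.
Qed.
HB.instance Definition _ (A : algType k) (y : nat -> A) :=
  GRing.isLinear.Build k (nat -> A) (nat -> A) _ (hmulr y) (@hmulr_linear A y).

Fact hconst_linear (V : lmodType k) : linear (@hconst V).
Proof.
by move=> a x y; apply/funext => -[|m]; rewrite serE serZ //= scaler0 addr0.
Qed.
HB.instance Definition _ (V : lmodType k) :=
  GRing.isLinear.Build k V (nat -> V) _ (@hconst V) (@hconst_linear V).

(** Division by the r-th power of minus hbar, discarding the coefficients of
    order less than r. *)
Definition hdiv (V : lmodType k) (r : nat) (x : nat -> V) : nat -> V :=
  fun m => (-1) ^+ r *: x (m + r)%N.

Fact hdiv_linear (V : lmodType k) r : linear (@hdiv V r).
Proof.
by move=> a x y; apply/funext => m; rewrite !serE serZ /hdiv serE serZ linearP.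
Qed.
HB.instance Definition _ (V : lmodType k) r :=
  GRing.isLinear.Build k (nat -> V) (nat -> V) _ (@hdiv V r)
    (@hdiv_linear V r).

Section Module.
Context (V : lmodType k).
Implicit Type x : nat -> V.

Lemma mhbar0 x : mhbar 0 x = x.
Proof. by apply/funext => m; rewrite /mhbar leq0n expr0 scale1r subn0. Qed.

Lemma mhbarD r s x : mhbar r (mhbar s x) = mhbar (r + s) x.
Proof.
apply/funext => m; rewrite /mhbar.
have [rm|mr] := leqP r m; last by rewrite leqNgt (leq_trans mr) ?leq_addr.
rewrite leq_subRL //; case: ifP => _; last by rewrite scaler0.
by rewrite scalerA exprD subnDA.
Qed.

Lemma mhbar1S x m : mhbar 1 x m.+1 = - x m.
Proof. by rewrite /mhbar /= expr1 scaleN1r subn1. Qed.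

Lemma hdivK r x : hdiv r (mhbar r x) = x.
Proof.
apply/funext => m; rewrite /hdiv /mhbar leq_addl addnK scalerA -exprD.
by rewrite addnn -signr_odd odd_double scale1r.
Qed.

Lemma mhbar_inj r : injective (@mhbar k V r).
Proof. exact: can_inj (hdivK r). Qed.

Lemma mhbar_hdiv r x :
  mhbar r (hdiv r x) = (fun m => if (r <= m)%N then x m else 0).
Proof.
apply/funext => m; rewrite /hdiv /mhbar; case: leqP => // rm.
by rewrite scalerA -exprD addnn -signr_odd odd_double scale1r subnK.
Qed.

End Module.

Lemma hact_mhbar (V W : lmodType k) (F : nat -> {linear V -> W}) r x :
  hact F (mhbar r x) = mhbar r (hact F x).
Proof.
elim: r x => [|r IH] x; first by rewrite !mhbar0.
rewrite -addn1 -!mhbarD IH; congr (mhbar _ _); apply/funext => -[|m].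
  by rewrite /hact /mhbar /= big_ord1 /= linear0.
rewrite mhbar1S /hact -sumrN big_ord_recr /= subnn /mhbar /= linear0 addr0.
apply: eq_bigr => i _; rewrite (subSn (leq_ord i)) /mhbar.
by rewrite expr1 scaleN1r subn1 linearN.
Qed.

Lemma hmulA (A : algType k) (x y z : nat -> A) :
  hmul x (hmul y z) = hmul (hmul x y) z.
Proof.
apply/funext => m; rewrite /hmul.
transitivity (\sum_(i < m.+1) \sum_(j < (m - i).+1)
    x i * (y j * z (m - i - j)%N)).
  by apply: eq_bigr => i _; rewrite mulr_sumr.
rewrite (triangle_sum (fun i j l => x i * (y j * z l))).
apply: eq_bigr => t _; rewrite mulr_suml; apply: eq_bigr => i _.
by rewrite mulrA.
Qed.

Lemma hmulCl (A : algType k) (a : A) (y : nat -> A) :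
  hmul (hconst a) y = fun m => a * y m.
Proof.
apply/funext => m; rewrite /hmul big_ord_recl /= subn0 big1 ?addr0 //.
by move=> i _; rewrite mul0r.
Qed.

Lemma hmul1s (A : algType k) (x : nat -> A) : hmul (hconst 1) x = x.
Proof. by rewrite hmulCl; apply/funext => m; rewrite mul1r. Qed.

Lemma hmuls1 (A : algType k) (x : nat -> A) : hmul x (hconst 1) = x.
Proof.
apply/funext => m; rewrite /hmul big_ord_recr /= subnn /= mulr1 big1 ?add0r //.
move=> i _; have: (0 < m - i)%N by rewrite subn_gt0.
by case: (m - i)%N => //= j; rewrite mulr0.
Qed.

Lemma hprod_cat (A : algType k) (xs ys : seq (nat -> A)) :
  hprod (xs ++ ys) = hmul (hprod xs) (hprod ys).
Proof.
by elim: xs => [|x xs IH] /=; [rewrite hmul1s | rewrite IH hmulA].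
Qed.

Lemma hprod_const (A : algType k) (I : Type) (f : I -> A) s :
  hprod [seq hconst (f i) | i <- s] = hconst (\prod_(i <- s) f i).
Proof.
elim: s => [|i s IH] /=; first by rewrite big_nil.
rewrite IH hmulCl big_cons; apply/funext => -[|m] //=; first by rewrite mulr0.
Qed.

Lemma hact_const (V W : lmodType k) (F : nat -> {linear V -> W}) x m :
  hact F (hconst x) m = F m x.
Proof.
rewrite /hact big_ord_recr /= subnn /= big1 ?add0r // => i _.
have: (0 < m - i)%N by rewrite subn_gt0.
by case: (m - i)%N => //= j; rewrite linear0.
Qed.

(** Reduces identities between series of linear maps to constant series. *)
Lemma hact_coef (V W : lmodType k) (F : nat -> {linear V -> W}) x m :
  hact F x m = \sum_(i < m.+1) hact F (hconst (x i)) (m - i)%N.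
Proof.
rewrite /hact (reindex_inj rev_ord_inj) /=; apply: eq_bigr => i _.
by rewrite -[RHS]/(hact F _ _) hact_const subKn // -ltnS.
Qed.

End Series.

Section Scaling.
Context (k : fieldType) (C : algType k).

Lemma hconstZ (V : lmodType k) a (x : V) : hconst (a *: x) = a *: hconst x.
Proof. by apply/funext => -[|m] //=; rewrite serZ /= scaler0. Qed.

Lemma hmulZl a (X Y : nat -> C) : hmul (a *: X) Y = a *: hmul X Y.
Proof. exact: (linearZ_LR (hmulr Y)). Qed.

Lemma hmulZr a (X Y : nat -> C) : hmul X (a *: Y) = a *: hmul X Y.
Proof. exact: linearZ_LR. Qed.

Lemma hmul0l (Y : nat -> C) : hmul 0 Y = 0.
Proof. exact: (linear0 (hmulr Y)). Qed.

Lemma hmul0r (X : nat -> C) : hmul X 0 = 0.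
Proof. exact: linear0. Qed.

Lemma hmul_suml (I : Type) (r : seq I) (F : I -> nat -> C) Y :
  hmul (\sum_(i <- r) F i) Y = \sum_(i <- r) hmul (F i) Y.
Proof. exact: (linear_sum (hmulr Y)). Qed.

Lemma mhbarZ (V : lmodType k) r a (x : nat -> V) : mhbar r (a *: x) = a *: mhbar r x.
Proof. exact: linearZ_LR. Qed.

Lemma mhbar_sum (V : lmodType k) r (I : Type) (t : seq I) (F : I -> nat -> V) :
  mhbar r (\sum_(i <- t) F i) = \sum_(i <- t) mhbar r (F i).
Proof. exact: linear_sum. Qed.

Lemma mhbar_0 (V : lmodType k) r : mhbar r (0 : nat -> V) = 0.
Proof. exact: linear0. Qed.

Lemma hact_sum (V W : lmodType k) (F : nat -> {linear V -> W}) (I : Type)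
    (t : seq I) (x : I -> nat -> V) :
  hact F (\sum_(i <- t) x i) = \sum_(i <- t) hact F (x i).
Proof. exact: linear_sum. Qed.

Lemma mhbar_D (V : lmodType k) r (x y : nat -> V) :
  mhbar r (x + y) = mhbar r x + mhbar r y.
Proof. exact: linearD. Qed.

Lemma mhbar_N (V : lmodType k) r (x : nat -> V) : mhbar r (- x) = - mhbar r x.
Proof. exact: linearN. Qed.

Lemma hact0 (V W : lmodType k) (F : nat -> {linear V -> W}) : hact F 0 = 0.
Proof. exact: linear0. Qed.

Lemma hactD (V W : lmodType k) (F : nat -> {linear V -> W}) x y :
  hact F (x + y) = hact F x + hact F y.
Proof. exact: linearD. Qed.

Lemma hactN (V W : lmodType k) (F : nat -> {linear V -> W}) x :
  hact F (- x) = - hact F x.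
Proof. exact: linearN. Qed.

Lemma hactB (V W : lmodType k) (F : nat -> {linear V -> W}) x y :
  hact F (x - y) = hact F x - hact F y.
Proof. exact: linearB. Qed.

Lemma hactZ (V W : lmodType k) (F : nat -> {linear V -> W}) a x :
  hact F (a *: x) = a *: hact F x.
Proof. exact: linearZ_LR. Qed.

End Scaling.

(** * Series of multilinear maps at series *)

Lemma triangle_exchange (V : zmodType) (A : nat -> nat -> nat -> V) m :
  \sum_(i < m.+1) \sum_(j < (m - i).+1) A i j (m - i - j)%N
  = \sum_(j < m.+1) \sum_(i < (m - j).+1) A i j (m - j - i)%N.
Proof.
rewrite triangle_sum (triangle_sum (fun j i l => A i j l)).
apply: eq_bigr => t _; rewrite (reindex_inj rev_ord_inj) /=.
by apply: eq_bigr => i _; rewrite subSS subKn // -ltnS.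
Qed.

(** The lists at which [happ b xs] evaluates b. If the entries of [xs] are
    homogeneous, so are all these lists, and identities known for homogeneous
    elements extend to homogeneous series. *)
Fixpoint coefs_of (V : Type) (xs : seq (nat -> V)) (vs : seq V) : Prop :=
  match xs, vs with
  | [::], [::] => True
  | x :: xs', v :: vs' => (exists m, v = x m) /\ coefs_of xs' vs'
  | _, _ => False
  end.

Lemma eq_happ (V : Type) (W : zmodType) (b b' : seq V -> nat -> W) xs :
  (forall vs, coefs_of xs vs -> b vs = b' vs) -> happ b xs = happ b' xs.
Proof.
elim: xs b b' => [|x xs IH] b b' H /=; first by rewrite H.
apply/funext => m; apply: eq_bigr => i _; congr (_ _).
by apply: IH => vs xvs; apply: H; split=> //; exists i.
Qed.

Lemma happ_sum (V : Type) (W : zmodType) (I : Type) (r : seq I)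
    (F : I -> seq V -> nat -> W) xs :
  happ (fun vs => \sum_(i <- r) F i vs) xs = \sum_(i <- r) happ (F i) xs.
Proof.
elim: xs F => [//|x xs IH] F; apply/funext => m; rewrite /= ser_sum exchange_big.
by apply: eq_bigr => i _; rewrite IH ser_sum.
Qed.

Lemma happ_hact (k : fieldType) (V : Type) (W W' : lmodType k)
    (F : nat -> {linear W -> W'}) (b : seq V -> nat -> W) xs :
  happ (fun vs => hact F (b vs)) xs = hact F (happ b xs).
Proof.
elim: xs b => [//|x xs IH] b; apply/funext => m /=.
rewrite /hact /= (eq_bigr (fun i : 'I_m.+1 => \sum_(j < (m - i).+1)
  F j (happ (fun vs => b (x i :: vs)) xs (m - i - j)%N))).
  rewrite (triangle_exchange
    (fun i j l => F j (happ (fun vs => b (x i :: vs)) xs l))).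
  by apply: eq_bigr => j _; rewrite linear_sum.
by move=> i _; rewrite (IH (fun vs => b (x i :: vs))).
Qed.

Lemma mhbar_scale_hact (k : fieldType) (W : lmodType k) (a : k) r
    (x : nat -> W) :
  mhbar r (a *: x)
  = hact (fun j => if j == r then ( *:%R ((-1) ^+ r * a) : {linear W -> W})
                   else (\0 : {linear W -> W})) x.
Proof.
apply/funext => m; rewrite /mhbar /hact; case: leqP => rm.
  rewrite (bigD1 (Ordinal (rm : r < m.+1)%N)) //= eqxx big1 ?addr0 ?scalerA //.
  by move=> i ir; rewrite ifF //; apply: contra_neqF ir => /eqP ir; apply: val_inj.
rewrite big1 // => i _; rewrite ifF //; apply/negbTE.
by rewrite neq_ltn (leq_ltn_trans (leq_ord i) rm).
Qed.

Lemma happ_mhbar_scale (k : fieldType) (V : Type) (W : lmodType k) (a : k) r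
    (b : seq V -> nat -> W) xs :
  happ (fun vs => mhbar r (a *: b vs)) xs = mhbar r (a *: happ b xs).
Proof.
rewrite mhbar_scale_hact -happ_hact; apply: eq_happ => vs _.
by rewrite mhbar_scale_hact.
Qed.

(** The extension to series is compatible with any distribution of the arguments
    over two factors; this allows the factors of the descendant relation, which
    permute the arguments, to be extended separately. *)
Lemma happ_hmul (k : fieldType) (V : Type) (A : algType k)
    (b1 b2 : seq V -> nat -> A) (m : bitseq) xs : size m = size xs ->
  happ (fun vs => hmul (b1 (mask m vs)) (b2 (mask (map negb m) vs))) xs
  = hmul (happ b1 (mask m xs)) (happ b2 (mask (map negb m) xs)).
Proof.
elim: xs m b1 b2 => [|x xs IH] [|[] m] b1 b2 //= [sm]; apply/funext => M.
  rewrite (eq_bigr (fun i : 'I_M.+1 =>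
    hmul (happ (fun vs => b1 (x i :: vs)) (mask m xs))
         (happ b2 (mask (map negb m) xs)) (M - i)%N)); last first.
    by move=> i _; rewrite -(IH m (fun vs => b1 (x i :: vs))).
  rewrite /hmul (triangle_sum (fun i j l =>
    happ (fun vs => b1 (x i :: vs)) (mask m xs) j
    * happ b2 (mask (map negb m) xs) l)).
  by apply: eq_bigr => t _; rewrite mulr_suml.
rewrite (eq_bigr (fun i : 'I_M.+1 =>
  hmul (happ b1 (mask m xs))
       (happ (fun vs => b2 (x i :: vs)) (mask (map negb m) xs)) (M - i)%N)).
  rewrite /hmul (triangle_exchange (fun i j l => happ b1 (mask m xs) j
    * happ (fun vs => b2 (x i :: vs)) (mask (map negb m) xs) l)).
  by apply: eq_bigr => t _; rewrite mulr_sumr.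
by move=> i _; rewrite -(IH m b1 (fun vs => b2 (x i :: vs))).
Qed.

Lemma coefs_of_size (V : Type) (xs : seq (nat -> V)) vs :
  coefs_of xs vs -> size vs = size xs.
Proof. by elim: xs vs => [|x xs IH] [|v vs] //= [_ /IH ->]. Qed.

Lemma happ_hconst1 (V : zmodType) (x : nat -> V) :
  happ (fun vs => hconst (head 0 vs)) [:: x] = x.
Proof.
apply/funext => m; rewrite /= big_ord_recr /= subnn /= big1 ?add0r // => i _.
have: (0 < m - i)%N by rewrite subn_gt0.
by case: (m - i)%N.
Qed.

Lemma hprod_happ (k : fieldType) (A : algType k) (xs : seq (nat -> A)) :
  hprod xs = happ (fun vs => hconst (\prod_(v <- vs) v)) xs.
Proof.
elim: xs => [|x xs IH]; first by rewrite /= big_nil.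
have := happ_hmul (fun vs => hconst (head 0 vs))
  (fun vs => hconst (\prod_(v <- vs) v))
  (m := true :: nseq (size xs) false) (xs := x :: xs).
have -> : mask (true :: nseq (size xs) false) (x :: xs) = [:: x].
  by rewrite /= mask_false.
have -> : mask (map negb (true :: nseq (size xs) false)) (x :: xs) = xs.
  by rewrite /= map_nseq mask_true.
rewrite happ_hconst1 -IH /= size_nseq => <- //.
apply/funext => m; apply: eq_bigr => i _; congr (_ _).
apply: eq_happ => vs /coefs_of_size sv.
rewrite /= map_nseq mask_true ?sv // hmulCl big_cons; apply/funext => -[|j] //=.
by rewrite mulr0.
Qed.

Lemma happ_zero (V W : zmodType) (b : seq V -> nat -> W) xs1 xs2 :
  (forall s1 s2, size s1 = size xs1 -> size s2 = size xs2 ->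
    b (s1 ++ 0 :: s2) = 0) ->
  happ b (xs1 ++ 0 :: xs2) = 0.
Proof.
have Z xs : forall b', (forall s, size s = size xs -> b' s = 0 :> (nat -> W)) ->
    happ b' xs = 0.
  move=> b' H; rewrite (@eq_happ _ _ _ (fun=> 0)).
    elim: xs {H} => [|x xs IH] //=.
    by apply/funext => m; rewrite big1 // => i _; rewrite IH.
  by move=> vs /coefs_of_size; apply: H.
elim: xs1 b => [|x xs1 IH] b H; apply/funext => m /=; rewrite big1 // => i _.
  by rewrite Z // => s ss; apply: (H [::] s).
by rewrite IH // => s1 s2 ss1 ss2; apply: (H (x i :: s1) s2) => //=; rewrite ss1.
Qed.

(** * Splittings and set partitions of a word *)

Fixpoint bits (n : nat) : seq bitseq :=
  if n is n'.+1 then map (cons true) (bits n') ++ map (cons false) (bits n')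
  else [:: [::]].

(** All ways to distribute the letters of a word over two subwords: the
    coproduct of the shuffle coalgebra, without signs. *)
Fixpoint splits (T : Type) (s : seq T) : seq (seq T * seq T) :=
  if s is x :: s' then
    [seq (x :: ab.1, ab.2) | ab <- splits s']
    ++ [seq (ab.1, x :: ab.2) | ab <- splits s']
  else [:: ([::], [::])].

Fixpoint parts_rec (T : Type) (n : nat) (s : seq T) : seq (seq (seq T)) :=
  if n is n'.+1 then
    if s is x :: s' then
      flatten [seq [seq rcons q (rcons ab.1 (last x s')) | q <- parts_rec n' ab.2]
              | ab <- splits (belast x s')]
    else [:: [::]]
  else [:: [::]].

(** The partitions of the letters of a word into nonempty subwords. Recursing on
    the block that contains the last letter lists the blocks in the order of their
    last letters, which is the order by maxima when the word is increasing. The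
    first argument of [parts_rec] bounds the recursion. *)
Definition parts (T : Type) (s : seq T) : seq (seq (seq T)) :=
  parts_rec (size s) s.

Lemma size_ind (T : Type) (P : seq T -> Prop) :
  (forall s, (forall t, (size t < size s)%N -> P t) -> P s) -> forall s, P s.
Proof.
move=> H s; have [n] := ubnP (size s); elim: n s => // n IH s sn.
by apply: H => t ts; apply: IH; apply: leq_trans ts _.
Qed.

Section BigSplits.
Context (V : zmodType) (T : Type).
Implicit Types (s : seq T) (F : seq T -> seq T -> V).

Lemma big_bits_cons n (F : bitseq -> V) :
  \sum_(m <- bits n.+1) F m
  = \sum_(m <- bits n) F (true :: m) + \sum_(m <- bits n) F (false :: m).
Proof. by rewrite big_cat !big_map. Qed.

Lemma big_splits_cons x s F :
  \sum_(ab <- splits (x :: s)) F ab.1 ab.2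
  = \sum_(ab <- splits s) F (x :: ab.1) ab.2
    + \sum_(ab <- splits s) F ab.1 (x :: ab.2).
Proof. by rewrite big_cat !big_map. Qed.

Lemma big_splits_cat s1 s2 F :
  \sum_(ab <- splits (s1 ++ s2)) F ab.1 ab.2
  = \sum_(ab1 <- splits s1) \sum_(ab2 <- splits s2)
      F (ab1.1 ++ ab2.1) (ab1.2 ++ ab2.2).
Proof.
elim: s1 F => [|x s1 IH] F; first by rewrite big_seq1.
rewrite [LHS]big_splits_cons (IH (fun a b => F (x :: a) b)).
rewrite (IH (fun a b => F a (x :: b))).
by rewrite (big_splits_cons x s1 (fun a b => \sum_(ab2 <- splits s2)
      F (a ++ ab2.1) (b ++ ab2.2))).
Qed.

Lemma big_splits_rcons x s F :
  \sum_(ab <- splits (rcons s x)) F ab.1 ab.2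
  = \sum_(ab <- splits s) F (rcons ab.1 x) ab.2
    + \sum_(ab <- splits s) F ab.1 (rcons ab.2 x).
Proof.
rewrite -cats1 big_splits_cat -big_split; apply: eq_bigr => ab _.
by rewrite /= !big_cons big_nil addr0 /= !cats1 !cats0.
Qed.

(** Masks keep track of positions, hence of signs, when letters repeat. *)
Lemma big_splits_mask s F :
  \sum_(ab <- splits s) F ab.1 ab.2
  = \sum_(m <- bits (size s)) F (mask m s) (mask (map negb m) s).
Proof.
elim: s F => [|x s IH] F; first by rewrite !big_seq1.
by rewrite big_splits_cons big_bits_cons (IH (fun a b => F (x :: a) b))
  (IH (fun a b => F a (x :: b))).
Qed.

(** Coassociativity of the coproduct. *)
Lemma big_splits_assoc s (F : seq T -> seq T -> seq T -> V) :
  \sum_(tc <- splits s) \sum_(ab <- splits tc.1) F ab.1 ab.2 tc.2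
  = \sum_(ar <- splits s) \sum_(bc <- splits ar.2) F ar.1 bc.1 bc.2.
Proof.
elim: s F => [|x s IH] F; first by rewrite !big_seq1.
rewrite (big_splits_cons x s (fun t c => \sum_(ab <- splits t) F ab.1 ab.2 c)).
rewrite (big_splits_cons x s (fun a r => \sum_(bc <- splits r) F a bc.1 bc.2)).
under [X in X + _]eq_bigr => tc _ do
  rewrite (big_splits_cons x tc.1 (fun a b => F a b tc.2)).
under [X in _ = _ + X]eq_bigr => ar _ do
  rewrite (big_splits_cons x ar.2 (fun b c => F ar.1 b c)).
rewrite !big_split /= !addrA.
by rewrite (IH (fun a b c => F (x :: a) b c)) (IH (fun a b c => F a (x :: b) c))
  (IH (fun a b c => F a b (x :: c))).
Qed.

(** Cocommutativity, in the form used to exchange two blocks of a partition. *)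
Lemma big_splits_exchange s (F : seq T -> seq T -> seq T -> V) :
  \sum_(ar <- splits s) \sum_(bc <- splits ar.2) F ar.1 bc.1 bc.2
  = \sum_(ar <- splits s) \sum_(bc <- splits ar.2) F bc.1 ar.1 bc.2.
Proof.
elim: s F => [|x s IH] F; first by rewrite !big_seq1.
rewrite (big_splits_cons x s (fun a r => \sum_(bc <- splits r) F a bc.1 bc.2)).
rewrite (big_splits_cons x s (fun a r => \sum_(bc <- splits r) F bc.1 a bc.2)).
under [X in _ + X]eq_bigr => ar _ do
  rewrite (big_splits_cons x ar.2 (fun b c => F ar.1 b c)).
under [X in _ = _ + X]eq_bigr => ar _ do
  rewrite (big_splits_cons x ar.2 (fun b c => F b ar.1 c)).
rewrite !big_split /= !addrA.
rewrite (IH (fun a b c => F (x :: a) b c)) (IH (fun a b c => F a (x :: b) c))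
  (IH (fun a b c => F a b (x :: c))).
by rewrite [X in X + _]addrC.
Qed.

End BigSplits.

Lemma size_bits n m : m \in bits n -> size m = n.
Proof.
elim: n m => [|n IH] m /=; first by rewrite inE => /eqP ->.
by rewrite mem_cat => /orP[] /mapP[m' /IH <- ->].
Qed.

Lemma mem_bits m : m \in bits (size m).
Proof.
by elim: m => [|[] m IH] //=; rewrite mem_cat map_f ?orbT.
Qed.

Lemma bits_uniq n : uniq (bits n).
Proof.
elim: n => [|n IH] //=; rewrite cat_uniq !map_inj_uniq ?IH //; last first.
- by move=> a b [].
- by move=> a b [].
rewrite andbT /=; apply/hasPn => m /mapP[a _ ->].
by apply/mapP => -[b _].
Qed.

Section Splits.
Context (T : eqType).
Implicit Types (s : seq T) (ab : seq T * seq T).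

Lemma splits_perm s ab : ab \in splits s -> perm_eq (ab.1 ++ ab.2) s.
Proof.
elim: s ab => [|x s IH] ab /=; first by rewrite inE => /eqP ->.
rewrite mem_cat => /orP[] /mapP[cd /IH cds ->] /=; first by rewrite perm_cons.
by rewrite (perm_catCA cd.1 [:: x]) /= perm_cons.
Qed.

Lemma splits_subseq1 s ab : ab \in splits s -> subseq ab.1 s.
Proof.
elim: s ab => [|x s IH] ab /=; first by rewrite inE => /eqP ->.
rewrite mem_cat => /orP[] /mapP[cd /IH cds ->] /=; first by rewrite eqxx.
by apply: subseq_trans cds (subseq_cons _ _).
Qed.

Lemma splits_subseq2 s ab : ab \in splits s -> subseq ab.2 s.
Proof.
elim: s ab => [|x s IH] ab /=; first by rewrite inE => /eqP ->.
rewrite mem_cat => /orP[] /mapP[cd /IH cds ->] /=; last by rewrite eqxx.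
by apply: subseq_trans cds (subseq_cons _ _).
Qed.

Lemma splits_size s ab : ab \in splits s -> (size ab.1 + size ab.2)%N = size s.
Proof. by move=> /splits_perm/perm_size; rewrite size_cat. Qed.

End Splits.

Lemma size_splits (T : Type) (s : seq T) :
  all (fun ab => (size ab.1 + size ab.2)%N == size s) (splits s).
Proof.
elim: s => //= x s IH; rewrite all_cat !all_map; apply/andP; split;
  apply: sub_all IH => ab /= /eqP <-; by rewrite ?addSn ?addnS.
Qed.

Lemma splits_map (T T' : Type) (g : T -> T') s :
  splits (map g s) = [seq (map g ab.1, map g ab.2) | ab <- splits s].
Proof. by elim: s => //= x s ->; rewrite map_cat -!map_comp. Qed.

Lemma parts_rec_rcons (T : Type) n (s : seq T) x :
  parts_rec n.+1 (rcons s x)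
  = flatten [seq [seq rcons q (rcons ab.1 x) | q <- parts_rec n ab.2]
            | ab <- splits s].
Proof. by case: s => [|y s] //=; rewrite belast_rcons last_rcons. Qed.

Lemma parts_recE (T : Type) n (s : seq T) :
  (size s <= n)%N -> parts_rec n s = parts s.
Proof.
rewrite /parts; elim/size_ind: s n => s; case/lastP: s => [|s x] IH [|n] //.
  by rewrite size_rcons.
rewrite size_rcons ltnS => sn; rewrite !parts_rec_rcons; congr (flatten _).
have: all (fun ab => size ab.2 <= size s)%N (splits s).
  by apply: sub_all (size_splits s) => ab /= /eqP <-; rewrite leq_addl.
elim: (splits s) => //= ab r IHr /andP[abs /IHr ->]; congr (map _ _ :: _).
have ab_lt : (size ab.2 < size (rcons s x))%N by rewrite size_rcons ltnS.
by rewrite (IH _ ab_lt n) 1?(IH _ ab_lt (size s)) // (leq_trans abs).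
Qed.

Lemma parts_nil (T : Type) : parts [::] = [:: [::]] :> seq (seq (seq T)).
Proof. by []. Qed.

Lemma parts_rcons (T : Type) (s : seq T) x :
  parts (rcons s x)
  = flatten [seq [seq rcons q (rcons ab.1 x) | q <- parts ab.2] | ab <- splits s].
Proof.
rewrite {1}/parts size_rcons parts_rec_rcons; congr (flatten _).
have: all (fun ab => size ab.2 <= size s)%N (splits s).
  by apply: sub_all (size_splits s) => ab /= /eqP <-; rewrite leq_addl.
by elim: (splits s) => //= ab r IHr /andP[abs /IHr ->]; rewrite parts_recE.
Qed.

Lemma big_parts_rcons (V : zmodType) (T : Type) (s : seq T) x
    (F : seq (seq T) -> V) :
  \sum_(q <- parts (rcons s x)) F q
  = \sum_(ab <- splits s) \sum_(q <- parts ab.2) F (rcons q (rcons ab.1 x)).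
Proof.
rewrite parts_rcons big_flatten big_map; apply: eq_bigr => ab _.
by rewrite big_map.
Qed.

Lemma parts_map (T T' : Type) (g : T -> T') s :
  parts (map g s) = [seq map (map g) q | q <- parts s].
Proof.
elim/size_ind: s => s; case/lastP: s => [//|s x] IH.
rewrite map_rcons !parts_rcons splits_map map_flatten -!map_comp.
congr (flatten _).
have: all (fun ab => size ab.2 < size (rcons s x))%N (splits s).
  apply: sub_all (size_splits s) => ab /=.
  by rewrite size_rcons ltnS => /eqP <-; rewrite leq_addl.
elim: (splits s) => //= ab r IHr /andP[abs /IHr ->]; congr (_ :: _).
rewrite (IH _ abs) -!map_comp; apply: eq_map => q /=.
by rewrite map_rcons map_rcons.
Qed.

Lemma parts_ind (T : eqType) (P : seq T -> seq (seq T) -> Prop) :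
  P [::] [::] ->
  (forall s x ab q, ab \in splits s -> q \in parts ab.2 -> P ab.2 q ->
     P (rcons s x) (rcons q (rcons ab.1 x))) ->
  forall s q, q \in parts s -> P s q.
Proof.
move=> P0 PS; elim/size_ind => s; case/lastP: s => [_ q|s x IH q].
  by rewrite inE => /eqP ->.
rewrite parts_rcons => /flatten_mapP[ab abs /mapP[r rab ->]].
apply: PS => //; apply: IH => //.
by rewrite size_rcons ltnS -(splits_size abs) leq_addl.
Qed.

Lemma parts_perm (T : eqType) (s : seq T) q :
  q \in parts s -> perm_eq (flatten q) s.
Proof.
elim/parts_ind: s q / => // s x ab q abs _ IH.
rewrite flatten_rcons -rcons_cat -!cats1 perm_cat2r.
by rewrite perm_catC (perm_trans _ (splits_perm abs)) // perm_cat2l.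
Qed.

Lemma parts_nonempty (T : eqType) (s : seq T) q : q \in parts s -> [::] \notin q.
Proof.
elim/parts_ind: s q / => // s x ab q _ _ IH.
by rewrite mem_rcons inE negb_or IH andbT; case: (ab.1).
Qed.

Lemma size_parts (T : eqType) (s : seq T) q : q \in parts s ->
  (size q <= size s)%N.
Proof.
elim/parts_ind: s q / => // s x ab q abs _ IH; rewrite !size_rcons ltnS.
by rewrite (leq_trans IH) // -(splits_size abs) leq_addl.
Qed.

Section PartsSums.
Context (V : zmodType) (T : eqType).
Implicit Types (s : seq T) (q : seq (seq T)).

Lemma big_splits_left s (F : seq T -> seq T -> V) :
  (forall ab, ab \in splits s -> ab.2 != [::] -> F ab.1 ab.2 = 0) ->
  \sum_(ab <- splits s) F ab.1 ab.2 = F s [::].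
Proof.
elim: s F => [|x s IH] F H; first by rewrite big_seq1.
rewrite big_splits_cons (IH (fun a b => F (x :: a) b)); last first.
  by move=> ab abs; apply: (H (x :: ab.1, ab.2)); rewrite mem_cat map_f.
rewrite big_seq big1 ?addr0 // => ab abs.
by apply: (H (ab.1, x :: ab.2)); rewrite // mem_cat orbC map_f.
Qed.

Lemma big_splits_right s (F : seq T -> seq T -> V) :
  (forall ab, ab \in splits s -> ab.1 != [::] -> F ab.1 ab.2 = 0) ->
  \sum_(ab <- splits s) F ab.1 ab.2 = F [::] s.
Proof.
elim: s F => [|x s IH] F H; first by rewrite big_seq1.
rewrite big_splits_cons (IH (fun a b => F a (x :: b))); last first.
  by move=> ab abs; apply: (H (ab.1, x :: ab.2)); rewrite mem_cat orbC map_f.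
rewrite big_seq big1 ?add0r // => ab abs.
by apply: (H (x :: ab.1, ab.2)); rewrite // mem_cat map_f.
Qed.

(** Choosing a partition and some of its blocks is choosing the union of these
    blocks, a partition of it, and a partition of its complement. *)
Lemma big_parts_splits s (F : seq (seq T) -> seq (seq T) -> V) :
  \sum_(q <- parts s) \sum_(ab <- splits q) F ab.1 ab.2
  = \sum_(uv <- splits s) \sum_(q1 <- parts uv.1) \sum_(q2 <- parts uv.2) F q1 q2.
Proof.
elim/size_ind: s F => s; case/lastP: s => [_ F|s x IH F].
  by rewrite /= !big_seq1.
rewrite big_parts_rcons.
transitivity (\sum_(ar <- splits s) \sum_(uv <- splits ar.2)
    (\sum_(q1 <- parts uv.1) \sum_(q2 <- parts uv.2)
       (F (rcons q1 (rcons ar.1 x)) q2 + F q1 (rcons q2 (rcons ar.1 x))))).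
  rewrite big_seq [RHS]big_seq; apply: eq_bigr => ar ars.
  rewrite -(IH ar.2 _ (fun q1 q2 => F (rcons q1 (rcons ar.1 x)) q2
     + F q1 (rcons q2 (rcons ar.1 x)))); last first.
    by rewrite size_rcons ltnS -(splits_size ars) leq_addl.
  by apply: eq_bigr => q _; rewrite big_splits_rcons -big_split.
rewrite (big_splits_rcons x s
  (fun u v => \sum_(q1 <- parts u) \sum_(q2 <- parts v) F q1 q2)).
under [X in _ = X + _]eq_bigr => uv _ do
  rewrite (big_parts_rcons uv.1 x (fun q1 => \sum_(q2 <- parts uv.2) F q1 q2)).
rewrite (big_splits_assoc s (fun a b c => \sum_(q1 <- parts b)
   \sum_(q2 <- parts c) F (rcons q1 (rcons a x)) q2)).
under [X in _ = _ + X]eq_bigr => uv _.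
  under eq_bigr => q1 _ do rewrite (big_parts_rcons uv.2 x (fun q2 => F q1 q2)).
  rewrite exchange_big; over.
rewrite (big_splits_exchange s (fun u a b => \sum_(q1 <- parts u)
   \sum_(q2 <- parts b) F q1 (rcons q2 (rcons a x)))).
rewrite -big_split; apply: eq_bigr => ar _; rewrite -big_split.
apply: eq_bigr => uv _; rewrite -big_split; apply: eq_bigr => q1 _.
by rewrite -big_split.
Qed.

Lemma parts_size0 s q : q \in parts s -> (size q == 0%N) = (s == [::]).
Proof.
move=> qs; have := parts_perm qs; have := parts_nonempty qs.
case: q qs => [|B q] qs /=; first by move=> _; rewrite perm_sym => /perm_nilP ->.
case: B qs => //= x B qs _ /perm_size; by case: s qs.
Qed.

(** The partition with one block is the only one with less than two blocks. *)
Lemma big_parts_single s (F : seq (seq T) -> V) : s != [::] ->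
  (forall q, q \in parts s -> (1 < size q)%N -> F q = 0) ->
  \sum_(q <- parts s) F q = F [:: s].
Proof.
case/lastP: s => [//|s x] _ H; rewrite big_parts_rcons.
rewrite (big_splits_left (F := fun a r => \sum_(q <- parts r) F (rcons q (rcons a x)))).
  by rewrite big_seq1.
move=> ab abs ab0; rewrite big_seq big1 // => q qs; apply: H.
  by rewrite parts_rcons; apply/flatten_mapP; exists ab => //; apply: map_f.
by rewrite size_rcons ltnS lt0n (parts_size0 qs).
Qed.

(** The symmetry of partition sums comes from this lemma: a function of lists of
    words that does not see the order of the blocks, nor the order inside a block,
    is a function of set partitions, and these do not depend on an ordering of the
    letters. If the two letters are not the last ones, the recursion on the last
    block applies; if they are, two blocks may have to be exchanged. *)
Lemma big_parts_swap (F : seq (seq T) -> V) s1 x y s2 :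
  (forall q1 B C q2, F (q1 ++ B :: C :: q2) = F (q1 ++ C :: B :: q2)) ->
  (forall q1 a z t b q2,
     F (q1 ++ (a ++ z :: t :: b) :: q2) = F (q1 ++ (a ++ t :: z :: b) :: q2)) ->
  \sum_(q <- parts (s1 ++ x :: y :: s2)) F q
  = \sum_(q <- parts (s1 ++ y :: x :: s2)) F q.
Proof.
have [n] := ubnP (size s1 + size s2)%N.
elim: n F s1 s2 => // n IH F s1 s2 sn hB hL; case/lastP: s2 sn => [_|s2 z sn].
  have cat2 u v : s1 ++ [:: u; v] = rcons (rcons s1 u) v.
    by rewrite -!cats1 -catA.
  rewrite !cat2 !big_parts_rcons.
  rewrite (big_splits_rcons x s1 (fun a r => \sum_(q <- parts r) F (rcons q (rcons a y)))).
  rewrite (big_splits_rcons y s1 (fun a r => \sum_(q <- parts r) F (rcons q (rcons a x)))).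
  congr (_ + _).
    apply: eq_bigr => ar _; apply: eq_bigr => q _.
    by rewrite -!cats1 -!catA; apply: (hL q ar.1 x y [::] [::]).
  under eq_bigr => ar _ do rewrite big_parts_rcons.
  under [RHS]eq_bigr => ar _ do rewrite big_parts_rcons.
  rewrite (big_splits_exchange s1 (fun a b c => \sum_(q <- parts c)
     F (rcons (rcons q (rcons b x)) (rcons a y)))).
  apply: eq_bigr => ar _; apply: eq_bigr => bc _; apply: eq_bigr => q _.
  by rewrite -!cats1 -!catA; apply: hB.
rewrite -!rcons_cons -!rcons_cat !big_parts_rcons.
pose G a r : V := \sum_(q <- parts r) F (rcons q (rcons a z)).
have E u v : \sum_(ab <- splits (s1 ++ u :: v :: s2)) G ab.1 ab.2
  = \sum_(ab1 <- splits s1) \sum_(ab2 <- splits s2)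
    (G (ab1.1 ++ u :: v :: ab2.1) (ab1.2 ++ ab2.2)
     + G (ab1.1 ++ u :: ab2.1) (ab1.2 ++ v :: ab2.2)
     + (G (ab1.1 ++ v :: ab2.1) (ab1.2 ++ u :: ab2.2)
       + G (ab1.1 ++ ab2.1) (ab1.2 ++ u :: v :: ab2.2))).
  rewrite big_splits_cat; apply: eq_bigr => ab1 _.
  rewrite (big_splits_cons u (v :: s2) (fun a b => G (ab1.1 ++ a) (ab1.2 ++ b))).
  rewrite (big_splits_cons v s2 (fun a b => G (ab1.1 ++ u :: a) (ab1.2 ++ b))).
  rewrite (big_splits_cons v s2 (fun a b => G (ab1.1 ++ a) (ab1.2 ++ u :: b))).
  by rewrite -!big_split.
rewrite (E x y) (E y x) big_seq [RHS]big_seq; apply: eq_bigr => ab1 ab1s.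
rewrite big_seq [RHS]big_seq; apply: eq_bigr => ab2 ab2s.
rewrite -!addrA; congr (_ + _).
  rewrite /G; apply: eq_bigr => q _; rewrite !rcons_cat !rcons_cons.
  by have := hL q ab1.1 x y (rcons ab2.1 z) [::]; rewrite !cats1.
rewrite addrCA; congr (_ + (_ + _)).
rewrite /G; apply: (IH (fun q => F (rcons q (rcons (ab1.1 ++ ab2.1) z)))).
- rewrite ltnS in sn; apply: leq_trans sn.
  rewrite size_rcons addnS ltnS leq_add //.
    by rewrite -(splits_size ab1s) leq_addl.
  by rewrite -(splits_size ab2s) leq_addl.
- by move=> q1 B C q2; rewrite !rcons_cat; apply: hB.
- by move=> q1 a t u b q2; rewrite !rcons_cat; apply: hL.
Qed.

Let single (B : seq T) := size B == 1%N.

(** Only the partition into singletons survives. *)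
Lemma big_parts_singles s (F : seq (seq T) -> V) :
  \sum_(q <- parts s | all single q) F q = F [seq [:: x] | x <- s].
Proof.
elim/last_ind: s F => [|s x IH] F; first by rewrite big_cons big_nil addr0.
rewrite big_mkcond big_parts_rcons.
rewrite (big_splits_right (F := fun a r => \sum_(q <- parts r)
   if all single (rcons q (rcons a x)) then F (rcons q (rcons a x)) else 0)).
  rewrite /= map_rcons -(IH (fun q => F (rcons q [:: x]))) [RHS]big_mkcond /=.
  by apply: eq_bigr => q _; rewrite all_rcons.
move=> ab _ ab1; rewrite big1 // => q _; rewrite all_rcons /single size_rcons.
by rewrite eqSS size_eq0 (negbTE ab1).
Qed.

(** A partition with a marked block, all of whose other blocks are singletons, is
    the same as the subword formed by the marked block. In the recursion on the
    last letter, that letter is either in the marked block, which then comes last,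
    or a singleton that follows all other blocks. *)
Lemma big_parts_block s (G : seq (seq T) -> seq T -> seq (seq T) -> V)
    (g : seq T -> seq T -> V) :
  (forall r, g [::] r = 0) ->
  (forall L B R, G [seq [:: x] | x <- L] B [seq [:: x] | x <- R] = g B (L ++ R)) ->
  \sum_(q <- parts s)
    \sum_(i < size q | all single (take i q) && all single (drop i.+1 q))
      G (take i q) (nth [::] q i) (drop i.+1 q)
  = \sum_(ab <- splits s) g ab.1 ab.2.
Proof.
elim/last_ind: s G g => [|s x IH] G g g0 Gg.
  by rewrite !big_seq1 big_ord0 g0.
rewrite big_parts_rcons big_splits_rcons.
rewrite -(IH (fun L B R => G L B (rcons R [:: x])) (fun a b => g a (rcons b x))).
- transitivity (\sum_(ab <- splits s) \sum_(q <- parts ab.2)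
    ((if all single q then G q (rcons ab.1 x) [::] else 0) +
     if single (rcons ab.1 x) then
      \sum_(i < size q | all single (take i q) && all single (drop i.+1 q))
        G (take i q) (nth [::] q i) (rcons (drop i.+1 q) (rcons ab.1 x))
     else 0)).
    apply: eq_bigr => ab _; apply: eq_bigr => q _.
    rewrite big_mkcond size_rcons big_ord_recr /= addrC; congr (_ + _).
      rewrite -cats1 take_size_cat // drop_oversize ?size_cat ?addn1 // andbT.
      by rewrite nth_cat ltnn subnn.
    have -> : single (rcons ab.1 x) = all single [:: rcons ab.1 x].
      by rewrite /= andbT.
    rewrite -big_mkcond /= andbT; case: ifP => sab; last first.
      rewrite big1 // => i /andP[_]; rewrite drop_rcons; last exact: ltn_ord.
      by rewrite all_rcons sab.
    apply: eq_big => [i|i _]; rewrite ?drop_rcons ?ltn_ord //.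
      by rewrite -cats1 takel_cat ?(ltnW (ltn_ord i)) // all_rcons sab.
    rewrite -cats1 takel_cat ?(ltnW (ltn_ord i)) //.
    by rewrite nth_cat ltn_ord.
  under eq_bigr => ab _ do rewrite big_split.
  rewrite big_split; congr (_ + _).
    apply: eq_bigr => ab _; rewrite -big_mkcond big_parts_singles.
    by rewrite (Gg ab.2 (rcons ab.1 x) [::]) cats0.
  rewrite (big_splits_right (F := fun a r => \sum_(q <- parts r)
    if single (rcons a x) then
      \sum_(i < size q | all single (take i q) && all single (drop i.+1 q))
        G (take i q) (nth [::] q i) (rcons (drop i.+1 q) (rcons a x))
     else 0)) //.
  move=> ab _ ab1; rewrite big1 // => q _.
  by rewrite /single size_rcons eqSS size_eq0 (negbTE ab1).
- by move=> r; apply: g0.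
- by move=> L B R; have := Gg L B (rcons R x); rewrite map_rcons -rcons_cat.
Qed.

Lemma size_flatten_leqif q : [::] \notin q ->
  (size q <= size (flatten q) ?= iff all single q)%N.
Proof.
elim: q => [|B q IH] /=; first by [].
rewrite inE negb_or eq_sym => /andP[B0 /IH IHq].
rewrite size_cat -add1n; apply: leqif_add => //.
by split; [rewrite lt0n size_eq0 | rewrite eq_sym].
Qed.

(** A partition into r blocks of a set with n elements has a block of size
    n - r + 1 exactly when the other blocks have their least possible size. *)
Lemma parts_block_cond s q i : q \in parts s -> (i < size q)%N ->
  (size (nth [::] q i) == (size s - size q).+1)
  = all single (take i q) && all single (drop i.+1 q).
Proof.
move=> qs iq; have := parts_nonempty qs.
rewrite -(perm_size (parts_perm qs)) -{1 3 4}(cat_take_drop i q).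
rewrite (drop_nth [::] iq) mem_cat inE !negb_or flatten_cat !size_cat /=.
case/and3P=> /size_flatten_leqif hL hB /size_flatten_leqif hR.
rewrite -hL.2 -hR.2.
have := hL.1; have := hR.1; move: hB; rewrite eq_sym -size_eq0.
move: (size (flatten _)) (size (take _ _)) (size (flatten _)) (size (drop _ _)).
by move=> a b c e hB cb ea; lia.
Qed.

End PartsSums.

(** ** Partitions of a set of indices as lists of words *)

Lemma splits_compl (T : eqType) (a s : seq T) : uniq s -> subseq a s ->
  (a, [seq x <- s | x \notin a]) \in splits s.
Proof.
elim: s a => [|y s IH] a /=; first by move=> _ /eqP ->.
case/andP=> ys us; case: a => [_|x a].
  rewrite mem_cat; apply/orP; right.
  exact: (map_f (fun ab => (ab.1, y :: ab.2)) (IH _ us (sub0seq s))).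
case: eqP => [->|/eqP xy] sub.
  have ya : y \notin a by apply: contra ys; apply: mem_subseq.
  rewrite inE eqxx /= mem_cat; apply/orP; left.
  rewrite (_ : [seq z <- s | z \notin y :: a] = [seq z <- s | z \notin a]).
    exact: (map_f (fun ab => (y :: ab.1, ab.2)) (IH _ us sub)).
  apply: eq_in_filter => z zs; rewrite inE negb_or.
  by case: eqP => // zy; rewrite zy (negbTE ys) in zs.
have yxa : y \notin x :: a by apply: contra ys; apply: mem_subseq.
rewrite yxa mem_cat; apply/orP; right.
exact: (map_f (fun ab => (ab.1, y :: ab.2)) (IH _ us sub)).
Qed.

Lemma splits_uniq (T : eqType) (s : seq T) : uniq s -> uniq (splits s).
Proof.
elim: s => [|x s IH] //= /andP[xs us]; rewrite cat_uniq !map_inj_uniq ?IH //.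
- rewrite andbT /=; apply/hasPn => ab /mapP[cd cds ->].
  apply/mapP => -[ef efs [E _]]; move/negP: xs; apply.
  by apply: (mem_subseq (splits_subseq1 cds)); rewrite E mem_head.
- by move=> [a b] [c e] [-> ->].
- by move=> [a b] [c e] [-> ->].
Qed.

(** For a word without repetition, a splitting is determined by its first half. *)
Lemma splits_inj1 (T : eqType) (s : seq T) ab cd : uniq s ->
  ab \in splits s -> cd \in splits s -> ab.1 = cd.1 -> ab = cd.
Proof.
move=> us; elim: s us ab cd => [|x s IH] /= => [_ ab cd|/andP[xs us] ab cd].
  by rewrite !inE => /eqP -> /eqP ->.
have notx ab' : ab' \in splits s -> x \notin ab'.1.
  by move=> abs; apply: contra xs; apply/mem_subseq/splits_subseq1.
rewrite !mem_cat => /orP[] /mapP[a' a's ->] /orP[] /mapP[c' c's ->] /= E.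
- by case: E => /(IH us _ _ a's c's) ->.
- by move: (notx _ c's); rewrite -E mem_head.
- by move: (notx _ a's); rewrite E mem_head.
- by rewrite (IH us _ _ a's c's E).
Qed.

Lemma parts_uniq (T : eqType) (s : seq T) : uniq s -> uniq (parts s).
Proof.
elim/size_ind: s => s; case/lastP: s => [//|s x] IH.
rewrite rcons_uniq parts_rcons => /andP[_ us].
apply: (@allpairs_uniq_dep _ (fun=> seq (seq T)) _
  (fun (ab : seq T * seq T) q => rcons q (rcons ab.1 x)) (splits s)
  (fun ab => parts ab.2)); first exact: splits_uniq.
  move=> ab abs; apply: IH.
    by rewrite size_rcons ltnS -(splits_size abs) leq_addl.
  exact: subseq_uniq (splits_subseq2 abs) us.
move=> [ab q] [cd r] /allpairsPdep[ab' [q' [abs _ [? E]]]].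
subst ab'; move=> /allpairsPdep[cd' [r' [cds _ [? E']]]]; subst cd' => /=.
move=> /rcons_inj[-> /rcons_inj[] /(splits_inj1 us abs cds) ->].
by [].
Qed.

(** The normal form by which a set partition is recovered from a list. *)
Definition canonical_parts (q : seq (seq nat)) (s : seq nat) : Prop :=
  [/\ perm_eq (flatten q) s, [::] \notin q, all (sorted ltn) q
    & sorted ltn [seq last 0%N B | B <- q]].

Lemma last_mem (B : seq nat) : B != [::] -> last 0%N B \in B.
Proof. by case: B => [|x B] // _; apply: mem_last. Qed.

Lemma sorted_ltn_rcons (s : seq nat) x :
  sorted ltn (rcons s x) = all (fun y => (y < x)%N) s && sorted ltn s.
Proof.
rewrite -rev_sorted rev_rcons /= path_sortedE ?all_rev ?rev_sorted //.
by move=> y z t yz ty; apply: ltn_trans ty yz.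
Qed.

Lemma parts_canonical s q : sorted ltn s -> q \in parts s ->
  canonical_parts q s.
Proof.
move=> + qs; elim/parts_ind: s q / qs => [//|s x ab q abs qab IH].
move=> sx; have := sx; rewrite sorted_ltn_rcons => /andP[/allP lex ss].
have [|Hp Hn Hs Hl] := IH.
  exact: (subseq_sorted ltn_trans (splits_subseq2 abs) ss).
split.
- apply: parts_perm; rewrite parts_rcons; apply/flatten_mapP; exists ab => //.
  exact: map_f.
- by rewrite mem_rcons inE negb_or Hn andbT; case: (ab.1).
- rewrite all_rcons Hs andbT sorted_ltn_rcons.
  rewrite (subseq_sorted ltn_trans (splits_subseq1 abs) ss) andbT.
  by apply/allP => y /(mem_subseq (splits_subseq1 abs)); apply: lex.
rewrite map_rcons last_rcons sorted_ltn_rcons Hl andbT.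
apply/allP => y /mapP[B Bq ->]; apply: lex.
apply: (mem_subseq (splits_subseq2 abs)); rewrite -(perm_mem Hp).
apply/flattenP; exists B => //; apply: last_mem.
by apply: contra Hn => /eqP <-.
Qed.

Lemma sorted_last_max (B : seq nat) x : sorted ltn B -> x \in B ->
  (x <= last 0%N B)%N.
Proof.
case/lastP: B => [//|B y]; rewrite sorted_ltn_rcons last_rcons mem_rcons inE.
by case/andP=> /allP lty _ /predU1P[->//|/lty/ltnW].
Qed.

Lemma canonical_in_parts s q : sorted ltn s -> canonical_parts q s ->
  q \in parts s.
Proof.
elim/size_ind: s q => s IH q ss [Hp Hn Hs Hl]; case/lastP: q => [|q B] in Hp Hn Hs Hl *.
  by move: Hp; rewrite perm_sym => /perm_nilP ->.
case/lastP: B => [|a x] in Hp Hn Hs Hl *; first by rewrite mem_rcons mem_head in Hn.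
move: Hp; rewrite flatten_rcons => Hp.
have us := sorted_uniq ltn_trans ltnn ss.
case/lastP: s => [|s y] in IH ss Hp us *.
  by move: (perm_size Hp); rewrite size_cat size_rcons addnS.
move: Hs Hl; rewrite all_rcons => /andP[sa Hs].
rewrite map_rcons last_rcons sorted_ltn_rcons => /andP[/allP ltx Hl].
have := ss; rewrite sorted_ltn_rcons => /andP[/allP lty ss'].
have xy : x = y.
  apply/eqP; rewrite eqn_leq; apply/andP; split.
    have : x \in rcons s y.
      by rewrite -(perm_mem Hp) mem_cat mem_rcons mem_head orbT.
    by rewrite mem_rcons inE => /predU1P[->//|/lty/ltnW].
  have : y \in flatten q ++ rcons a x by rewrite (perm_mem Hp) mem_rcons mem_head.
  rewrite mem_cat => /orP[/flattenP[C Cq yC]|yax].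
    rewrite (leq_trans (sorted_last_max (allP Hs C Cq) yC)) //.
    by apply/ltnW/ltx/map_f.
  by have := sorted_last_max sa yax; rewrite last_rcons.
subst y; move: Hp us.
rewrite -rcons_cat -!cats1 perm_cat2r !cats1 rcons_uniq => Hp /andP[_ us].
move: sa; rewrite sorted_ltn_rcons => /andP[_ sa].
have as_ : subseq a s.
  rewrite -(@irr_sorted_eq _ ltn ltn_trans ltnn [seq z <- s | z \in a] a) //.
  - exact: filter_subseq.
  - exact: sorted_filter ltn_trans _ _ ss'.
  move=> z; rewrite mem_filter -(perm_mem Hp) mem_cat.
  by case: (z \in a); rewrite ?orbT.
rewrite parts_rcons; apply/flatten_mapP; eexists; first exact: splits_compl us as_.
apply: map_f; apply: IH => /=.
- by rewrite size_rcons ltnS size_filter count_size.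
- exact: sorted_filter ltn_trans _ _ ss'.
split=> //; last by apply: contra Hn => h; rewrite mem_rcons inE h orbT.
apply: uniq_perm.
- by move: us; rewrite -(perm_uniq Hp) cat_uniq => /andP[].
- exact: filter_uniq.
move=> z; rewrite mem_filter -(perm_mem Hp) mem_cat.
have := us; rewrite -(perm_uniq Hp) cat_uniq => /and3P[_ /hasPn dis _].
by case: (boolP (z \in a)) => za /=; rewrite ?orbF // (negbTE (dis z za)).
Qed.

Lemma uniq_flatten_eq (T : eqType) (q : seq (seq T)) B C x :
  uniq (flatten q) -> B \in q -> C \in q -> x \in B -> x \in C -> B = C.
Proof.
elim: q => //= D q IH; rewrite cat_uniq => /and3P[_ /hasPn dis uq].
rewrite !inE => /predU1P[->|Bq] /predU1P[->|Cq] // xB xC; last exact: IH.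
- by have := dis x; rewrite xB => /(_ (introT flattenP (ex_intro2 _ _ C Cq xC))).
- by have := dis x; rewrite xC => /(_ (introT flattenP (ex_intro2 _ _ B Bq xB))).
Qed.

Lemma uniq_map_last (q : seq (seq nat)) : uniq (flatten q) -> [::] \notin q ->
  uniq [seq last 0%N B | B <- q].
Proof.
elim: q => //= B q IH; rewrite cat_uniq inE negb_or eq_sym.
case/and3P=> _ /hasPn dis uq /andP[B0 nq]; rewrite IH // andbT.
apply/mapP => -[C Cq E]; have := dis (last 0%N B).
rewrite last_mem // => /(_ _)/negP; apply=> //; rewrite E.
apply/flattenP; exists C => //; apply: last_mem.
by apply: contra nq => /eqP <-.
Qed.

Section IndexPartitions.
Context (n : nat).

Definition set_word (B : {set 'I_n}) : seq nat := [seq val i | i <- enum B].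

Definition part_words (p : {set {set 'I_n}}) : seq (seq nat) :=
  [seq set_word B | B <- blocks p].

Lemma set_word_sorted B : sorted ltn (set_word B).
Proof.
rewrite /set_word; have -> : enum B = [seq i <- enum 'I_n | i \in B].
  by rewrite enumT.
rewrite sorted_map; apply: sorted_filter.
  by move=> y x z; apply: ltn_trans.
have := iota_ltn_sorted 0 n; rewrite -val_enum_ord sorted_map.
by [].
Qed.

Lemma mem_set_word (B : {set 'I_n}) (i : 'I_n) : (val i \in set_word B) = (i \in B).
Proof. by rewrite mem_map ?mem_enum //; apply: val_inj. Qed.

Lemma set_word_inj : injective set_word.
Proof. by move=> B C E; apply/setP => i; rewrite -!mem_set_word E. Qed.

Lemma set_word_of (C : seq nat) : sorted ltn C -> {subset C <= iota 0 n} ->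
  set_word [set i : 'I_n | val i \in C] = C.
Proof.
move=> sC Cn; apply: (irr_sorted_eq ltn_trans ltnn) => //.
  exact: set_word_sorted.
move=> x; apply/mapP/idP => [[i]|xC]; first by rewrite mem_enum inE => iC ->.
have xn : (x < n)%N by have := Cn x xC; rewrite mem_iota.
by exists (Ordinal xn); rewrite // mem_enum inE.
Qed.

Lemma set_word_max (B : {set 'I_n}) :
  (\max_(i in B) (i : nat))%N = last 0%N (set_word B).
Proof.
rewrite -big_enum /= -(big_map val xpredT (fun j => j)) -/(set_word B).
elim/last_ind: (set_word B) (set_word_sorted B) => [|s x IH]; first by rewrite big_nil.
rewrite sorted_ltn_rcons => /andP[/allP ltx ss].
rewrite -cats1 big_cat big_seq1 last_cat /=; apply/maxn_idPr.
by apply/bigmax_leqP_seq => i /ltx/ltnW.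
Qed.

Lemma mem_blocks (p : {set {set 'I_n}}) B : (B \in blocks p) = (B \in p).
Proof. by rewrite mem_sort mem_enum. Qed.

Lemma size_blocks (p : {set {set 'I_n}}) : size (blocks p) = #|p|.
Proof. by rewrite size_sort cardE. Qed.

(** The blocks are increasing words, and their maxima are their last letters. *)
Lemma part_words_canonical (p : {set {set 'I_n}}) : p \in Pn n ->
  canonical_parts (part_words p) (iota 0 n).
Proof.
rewrite inE => Pp; have /and3P[/eqP covp trivp p0] := Pp.
have fl : flatten (part_words p)
    = [seq val i | i <- flatten [seq enum (B : {set 'I_n}) | B <- blocks p]].
  by rewrite map_flatten -map_comp.
have Hp : perm_eq (flatten (part_words p)) (iota 0 n).
  rewrite fl -val_enum_ord; apply: perm_map; rewrite perm_sym.
  set w := flatten _; have uE := enum_uniq 'I_n.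
  have Ew : {subset enum 'I_n <= w}.
    move=> i _; have : i \in cover p by rewrite covp inE.
    case/bigcupP=> B Bp iB; apply/flattenP; exists (enum B); last by rewrite mem_enum.
    by apply: map_f; rewrite mem_blocks.
  suff sw : (size w <= size (enum 'I_n))%N.
    apply: uniq_perm => //; first exact: leq_size_uniq uE Ew sw.
    by have [] := uniq_min_size uE Ew sw.
  rewrite size_flatten /shape -map_comp sumnE big_map.
  rewrite (eq_bigr (fun B : {set 'I_n} => #|B|)); last by move=> B _; rewrite /= -cardE.
  rewrite (perm_big (enum p)) /=; last by rewrite perm_sort.
  by rewrite big_enum -(card_partition Pp) size_enum_ord cardsT card_ord.
have Hn : [::] \notin part_words p.
  apply/mapP => -[B]; rewrite mem_blocks => Bp /esym/eqP.
  rewrite -size_eq0 size_map -cardE cards_eq0 => /eqP B0.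
  by rewrite -B0 Bp in p0.
split=> //.
  by apply/allP => w /mapP[B _ ->]; apply: set_word_sorted.
rewrite ltn_sorted_uniq_leq uniq_map_last ?(perm_uniq Hp) ?iota_uniq //=.
rewrite -map_comp sorted_map.
have := sort_sorted (leT := fun A B : {set 'I_n} =>
   (\max_(i in A) (i : nat) <= \max_(i in B) (i : nat))%N) _ (enum p).
rewrite -/(blocks p); under eq_sorted => A B do rewrite !set_word_max.
by apply=> A B; apply: leq_total.
Qed.

Lemma part_words_onto q : q \in parts (iota 0 n) ->
  exists2 p, p \in Pn n & part_words p = q.
Proof.
move=> qs; have [Hp Hn Hs Hl] := parts_canonical (iota_ltn_sorted 0 n) qs.
have uq : uniq (flatten q) by rewrite (perm_uniq Hp) iota_uniq.
pose p := [set B : {set 'I_n} | set_word B \in q].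
have back C : C \in q -> set_word [set i : 'I_n | val i \in C] = C.
  move=> Cq; apply: set_word_of; first exact: (allP Hs).
  by move=> x xC; rewrite -(perm_mem Hp); apply/flattenP; exists C.
have Pp : p \in Pn n.
  rewrite inE; apply/and3P; split.
  - apply/eqP/setP => i; rewrite inE; apply/bigcupP.
    have : val i \in flatten q by rewrite (perm_mem Hp) mem_iota ltn_ord.
    case/flattenP=> C Cq iC; exists [set i : 'I_n | val i \in C].
      by rewrite inE back.
    by rewrite inE.
  - apply/trivIsetP => A B; rewrite !inE => Aq Bq; apply: contraR => /pred0Pn[i].
    case/andP=> /= iA iB; apply/eqP/set_word_inj.
    by apply: (uniq_flatten_eq uq Aq Bq (x := val i)); rewrite mem_set_word.
  - rewrite inE; apply: contra Hn.
    by rewrite /set_word enum_set0.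
exists p => //; have [_ _ _ Hl'] := part_words_canonical Pp.
apply: (@irr_sorted_eq _ (fun B C => last 0 B < last 0 C)%N).
- by move=> y x z; apply: ltn_trans.
- by move=> x; apply: ltnn.
- by rewrite sorted_map in Hl'.
- by rewrite sorted_map in Hl.
move=> C; apply/mapP/idP => [[B]|Cq]; first by rewrite mem_blocks inE => Bq ->.
exists [set i : 'I_n | val i \in C]; rewrite ?back //.
by rewrite mem_blocks inE back.
Qed.

Lemma part_words_inj : injective part_words.
Proof.
move=> p p' /(inj_map set_word_inj) E; apply/setP => B.
by rewrite -!mem_blocks E.
Qed.

(** Lists in normal form and set partitions determine each other. *)
Lemma big_Pn (V : zmodType) (F : seq (seq nat) -> V) :
  \sum_(p in Pn n) F (part_words p) = \sum_(q <- parts (iota 0 n)) F q.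
Proof.
rewrite -big_enum /= -(big_map part_words xpredT F); apply: perm_big.
apply: uniq_perm.
- by rewrite map_inj_uniq ?enum_uniq //; apply: part_words_inj.
- exact/parts_uniq/iota_uniq.
move=> q; apply/mapP/idP => [[p]|/part_words_onto[p Pp <-]].
  rewrite mem_enum => /part_words_canonical cp ->.
  exact/canonical_in_parts/cp/iota_ltn_sorted.
by exists p; rewrite ?mem_enum.
Qed.

End IndexPartitions.

(** * Koszul signs *)

(** Adjacent transpositions generate all rearrangements; it is enough to move one
    letter to the right across a word. *)
Lemma perm_swap_ind (T : eqType) (P : seq T -> Prop) :
  (forall w1 x y w2, P (w1 ++ x :: y :: w2) -> P (w1 ++ y :: x :: w2)) ->
  forall s1 s2, perm_eq s1 s2 -> P s1 -> P s2.
Proof.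
move=> H s1 s2 E.
have move_right x c : forall w v, P (w ++ x :: c ++ v) -> P (w ++ c ++ x :: v).
  elim: c => //= z c IH w v /H; rewrite -cat_rcons => /IH.
  by rewrite cat_rcons.
suff gen : forall w, P (w ++ s1) -> P (w ++ s2) by apply: (gen [::]).
elim: s1 s2 E => [|x s1 IH] s2 E w Pw.
  by move: E; rewrite perm_sym => /perm_nilP ->.
have: x \in s2 by rewrite -(perm_mem E) mem_head.
move=> xs2; case/splitPr: xs2 E => p1 p2.
rewrite perm_sym -cat1s perm_catCA /= perm_cons perm_sym => /IH Es.
by apply: move_right; rewrite -cat_rcons; apply: Es; rewrite cat_rcons.
Qed.

Section Signs.
Context (k : fieldType).

Definition degree_sign (a b : int) : k := (-1) ^ (a * b).

Let N1 : (-1 : k) != 0. Proof. by rewrite oppr_eq0 oner_eq0. Qed.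

Lemma signz_sqr (a : int) : (-1 : k) ^ a * (-1) ^ a = 1.
Proof. by rewrite -expfzMl mulrNN mulr1 exp1rz. Qed.

Lemma degree_signC a b : degree_sign a b = degree_sign b a.
Proof. by rewrite /degree_sign mulrC. Qed.

Lemma degree_signDl a b c : degree_sign (a + b) c = degree_sign a c * degree_sign b c.
Proof. by rewrite /degree_sign mulrDl expfzDr. Qed.

Lemma degree_signDr a b c : degree_sign a (b + c) = degree_sign a b * degree_sign a c.
Proof. by rewrite /degree_sign mulrDr expfzDr. Qed.

Lemma degree_sign0l b : degree_sign 0 b = 1. Proof. by rewrite /degree_sign mul0r expr0z. Qed.

Lemma degree_sign0r b : degree_sign b 0 = 1. Proof. by rewrite degree_signC degree_sign0l. Qed.

Lemma degree_sign1r a : degree_sign a 1 = (-1) ^ a.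
Proof. by rewrite /degree_sign mulr1. Qed.

Lemma degree_sign_sqr a b : degree_sign a b * degree_sign a b = 1.
Proof. exact: signz_sqr. Qed.

Definition parity (a : int) : bool := odd `|a|.

Lemma signz_parity (a : int) : (-1 : k) ^ a = (-1) ^ (parity a : int).
Proof.
rewrite /parity; case: a => n /=.
  by rewrite -!exprnP signr_odd.
by rewrite NegzE -exprz_inv invrN invr1 -!exprnP -[~~ odd n]/(odd n.+1) signr_odd.
Qed.

Lemma degree_sign_parity a b : degree_sign a b = degree_sign (parity a) (parity b).
Proof.
rewrite /degree_sign signz_parity [RHS]signz_parity; congr (_ ^ _).
by rewrite /parity !abszM !oddM !oddb.
Qed.

(** The rule for exchanging two neighbours that makes a function of words a
    Koszul sign, up to a constant on each class of rearrangements. *)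
Definition koszul_type (T : Type) (deg : T -> int) (sigma : seq T -> k) : Prop :=
  forall w1 x y w2,
    sigma (w1 ++ x :: y :: w2) = degree_sign (deg x) (deg y) * sigma (w1 ++ y :: x :: w2).

(** The quotient of two such functions is invariant under exchanges. *)
Lemma koszul_type_unique (T : eqType) (deg : T -> int) (sigma tau : seq T -> k) :
  koszul_type deg sigma -> koszul_type deg tau ->
  forall w s, perm_eq w s -> sigma w * tau s = tau w * sigma s.
Proof.
move=> Hs Ht w s; rewrite perm_sym => E.
apply: (perm_swap_ind (P := fun w => sigma w * tau s = tau w * sigma s) _ E).
  move=> w1 x y w2; rewrite Hs Ht -!mulrA.
  move=> /(congr1 (fun z => degree_sign (deg x) (deg y) * z)).
  by rewrite !mulrA !degree_sign_sqr !mul1r.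
by rewrite mulrC.
Qed.

Lemma koszul_type_cat (T : Type) (deg : T -> int) sigma :
  koszul_type deg sigma -> forall w1 a b w2,
  sigma (w1 ++ a ++ b ++ w2)
  = degree_sign (\sum_(x <- a) deg x) (\sum_(y <- b) deg y) * sigma (w1 ++ b ++ a ++ w2).
Proof.
move=> H w1 a b w2.
have H1 x : forall w v, sigma (w ++ x :: b ++ v)
    = degree_sign (deg x) (\sum_(y <- b) deg y) * sigma (w ++ b ++ x :: v).
  elim: b => [|y b IH] w v /=; first by rewrite big_nil degree_sign0r mul1r.
  rewrite H -cat_rcons IH big_cons degree_signDr cat_rcons.
  by rewrite mulrA.
elim: a w1 w2 => [|x a IH] w1 w2; first by rewrite big_nil degree_sign0l mul1r.
rewrite /= -cat_rcons IH cat_rcons H1 big_cons degree_signDl mulrA.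
by rewrite [degree_sign (deg x) _ * _]mulrC.
Qed.

Fixpoint koszul_word (d : nat -> int) (w : seq nat) : k :=
  if w is i :: w' then
    (\prod_(j <- w' | (j < i)%N) degree_sign (d i) (d j)) * koszul_word d w'
  else 1.

(** The value 0 on words with a repeated letter makes the exchange rule hold for
    all words. *)
Definition koszul_sign (d : nat -> int) (w : seq nat) : k :=
  if uniq w then koszul_word d w else 0.

Lemma koszul_sign_koszul_type d : koszul_type d (koszul_sign d).
Proof.
move=> w1 x y w2.
have pE : perm_eq (w1 ++ x :: y :: w2) (w1 ++ y :: x :: w2).
  by rewrite perm_cat2l -(cat1s x) -(cat1s y) perm_catCA.
rewrite /koszul_sign (perm_uniq pE); case: ifP => [u|]; last by rewrite mulr0.
have {u} xy : x != y.
  by move: u; rewrite cat_uniq => /and3P[_ _ /= /andP[]];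
    rewrite inE negb_or eq_sym => /andP[].
elim: w1 {pE} => [|z w1 IH] /=; last first.
  rewrite IH mulrCA; congr (_ * (_ * _)); apply: perm_big.
  by rewrite perm_cat2l -(cat1s x) -(cat1s y) perm_catCA.
rewrite !big_cons; case: (ltngtP y x) xy => // xy _.
  rewrite -!mulrA; congr (_ * _); rewrite mulrCA.
  by [].
rewrite mulrCA !mulrA [degree_sign (d x) _]degree_signC; congr (_ * _).
by rewrite mulrAC degree_sign_sqr mul1r mulrC.
Qed.

Lemma koszul_sign_sorted d w : sorted ltn w -> koszul_sign d w = 1.
Proof.
move=> sw; rewrite /koszul_sign (sorted_uniq ltn_trans ltnn sw).
elim: w sw => //= i w IH; rewrite (path_sortedE ltn_trans).
case/andP=> /allP iw /IH ->; rewrite mulr1 big1_seq // => j /andP[ji /iw].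
by rewrite ltnNge ltnW.
Qed.

Lemma koszul_sign_rcons d w x :
  all (fun y => (y < x)%N) w -> koszul_sign d (rcons w x) = koszul_sign d w.
Proof.
move=> wx; rewrite /koszul_sign rcons_uniq.
have -> : x \notin w by apply/negP => /(allP wx); rewrite ltnn.
rewrite /=; case: uniq => //; elim: w wx => [|i w IH] /=.
  by rewrite big_nil mulr1.
case/andP=> ix /IH ->; congr (_ * _); rewrite -cats1 big_cat.
by rewrite /= big_cons ltnNge (ltnW ix) /= big_nil mulr1.
Qed.

Lemma koszul_sign_map d (g : nat -> nat) w :
  {in w &, {mono g : i j / (i < j)%N}} ->
  koszul_sign d (map g w) = koszul_sign (d \o g) w.
Proof.
move=> gw; rewrite /koszul_sign map_inj_in_uniq; last first.
  move=> i j iw jw E; case: (ltngtP i j) => // ij.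
    by have := gw i j iw jw; rewrite E ltnn ij.
  by have := gw j i jw iw; rewrite E ltnn ij.
case: uniq => //; elim: w gw => //= i w IH gw; congr (_ * _); last first.
  by apply: IH => a b aw bw; apply: gw; rewrite inE ?aw ?bw orbT.
rewrite big_map big_seq_cond [RHS]big_seq_cond; apply: eq_bigl => j.
by case: (boolP (j \in w)) => // jw; rewrite gw // inE ?eqxx ?jw ?orbT.
Qed.

Lemma eq_koszul_sign d d' w :
  {in w &, forall i j, degree_sign (d i) (d j) = degree_sign (d' i) (d' j)} ->
  koszul_sign d w = koszul_sign d' w.
Proof.
move=> dw; rewrite /koszul_sign; case: uniq => //; elim: w dw => //= i w IH dw.
congr (_ * _); last first.
  by apply: IH => a b aw bw; apply: dw; rewrite inE ?aw ?bw orbT.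
rewrite big_seq_cond [RHS]big_seq_cond; apply: eq_bigr => j /andP[jw _].
by apply: dw; rewrite inE ?eqxx ?jw ?orbT.
Qed.

(** The value on a list of blocks is again a Koszul sign, for blocks with the
    total degree of their letters. *)
Lemma koszul_sign_flatten_koszul_type d :
  koszul_type (fun B => \sum_(i <- B) d i) (koszul_sign d \o flatten).
Proof.
move=> q1 B C q2 /=; rewrite !flatten_cat /=.
exact: (koszul_type_cat (koszul_sign_koszul_type d)).
Qed.

Lemma koszulE n (d : 'I_n -> int) (d' : nat -> int) (w : seq 'I_n) :
  (forall i, d' (val i) = d i) -> uniq w -> koszul k d w = koszul_sign d' (map val w).
Proof.
move=> dd' uw; rewrite /koszul_sign map_inj_uniq ?uw; last exact: val_inj.
elim: w {uw} => //= i w ->; congr (_ * _).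
by rewrite big_map; apply: eq_bigr => j _; rewrite /degree_sign -!dd'.
Qed.

End Signs.

(** * Graded spaces and algebras *)

Lemma codom_nth (T : Type) (x0 : T) (s : seq T) :
  codom (fun i : 'I_(size s) => nth x0 s i) = s.
Proof.
rewrite codomE (map_comp (nth x0 s) val) val_enum_ord -[in RHS](mkseq_nth x0 s).
by rewrite /mkseq.
Qed.

Section Grading.
Context (k : fieldType) (V : lmodType k) (GV : int -> V -> Prop).
Hypothesis hV : is_grading GV.

Lemma gradingD j x y : GV j x -> GV j y -> GV j (x + y).
Proof. by move=> hx hy; rewrite -[x]scale1r; apply: gradingP. Qed.

Lemma gradingZ j a x : GV j x -> GV j (a *: x).
Proof.
by move=> hx; rewrite -[_ *: _]addr0; apply: gradingP => //; apply: grading0.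
Qed.

Lemma grading_sum j (I : Type) (r : seq I) (P : pred I) (F : I -> V) :
  (forall i, P i -> GV j (F i)) -> GV j (\sum_(i <- r | P i) F i).
Proof.
by move=> H; apply: big_ind => //; [apply: grading0 | apply: gradingD].
Qed.

Definition homog_series (e : int) (X : nat -> V) : Prop := forall m, GV e (X m).

Lemma homog_series_mhbar e r X : homog_series e X -> homog_series e (mhbar r X).
Proof.
move=> H m; rewrite /mhbar; case: ifP => _; last exact: grading0.
exact: gradingZ.
Qed.

Lemma homog_seriesZ e a X : homog_series e X -> homog_series e (a *: X).
Proof. by move=> H m; apply: gradingZ. Qed.

Lemma homog_hconst e x : GV e x -> homog_series e (hconst x).
Proof. by move=> H [|m] //=; apply: grading0. Qed.

End Grading.

Lemma in_Hom_sym_homog (k : fieldType) (V W : lmodType k)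
    (GV : int -> V -> Prop) (GW : int -> W -> Prop) n e (b : seq V -> nat -> W) :
  in_Hom_sym GV GW n e b ->
  forall (I : eqType) (d : I -> int) (v : I -> V) (s : seq I),
    size s = n -> (0 < n)%N -> {in s, forall i, GV (d i) (v i)} ->
    homog_series GW (\sum_(i <- s) d i + e) (b (map v s)).
Proof.
move=> Hb I d v [|i0 s'] sn; first by rewrite -sn.
move=> _ dv m; set s := i0 :: s' in sn dv *; subst n.
have [_ /(_ (fun i => d (nth i0 s i)) (fun i => v (nth i0 s i)))] := Hb m.
rewrite (big_nth i0) big_mkord.
have -> : codom (fun i : 'I_(size s) => v (nth i0 s i)) = map v s.
  by rewrite -[in RHS](codom_nth i0 s) /codom /image_mem -map_comp.
by apply=> i; apply: dv; apply: mem_nth.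
Qed.

Section GradedAlgebra.
Context (k : fieldType) (C : algType k) (GC : int -> C -> Prop).
Hypothesis hC : graded_comm_algebra GC.
Let hG := gca_grading hC.
Let hs := homog_series GC.

Lemma homog_hmul a b X Y : hs a X -> hs b Y -> hs (a + b) (hmul X Y).
Proof.
move=> hX hY m; apply: (grading_sum hG) => i _.
exact: (gca_mul hC).
Qed.

Lemma homog_hprod (T : eqType) (deg : T -> int) (X : T -> nat -> C) s :
  (forall t, t \in s -> hs (deg t) (X t)) ->
  hs (\sum_(t <- s) deg t) (hprod (map X s)).
Proof.
elim: s => [|t s IH] H.
  by rewrite big_nil; apply: (homog_hconst hG); apply: (gca_one hC).
rewrite big_cons; apply: homog_hmul; first by apply: H; rewrite mem_head.
by apply: IH => u us; apply: H; rewrite inE us orbT.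
Qed.

Lemma hmulC a b X Y : hs a X -> hs b Y -> hmul X Y = degree_sign k a b *: hmul Y X.
Proof.
move=> hX hY; apply/funext => m; rewrite serZ /hmul (reindex_inj rev_ord_inj) /=.
rewrite scaler_sumr; apply: eq_bigr => i _.
by rewrite subSS (subKn (leq_ord i)) (gca_comm hC (hX _) (hY _)).
Qed.

(** An odd entry is moved to the front past entries to which J was applied; the
    signs of J turn its degree [e + 1] into [e], the degree of the block. *)
Lemma hprod_bracket (T : eqType) (deg : T -> int) (x : T -> C)
    (sigma : seq T -> k) L B R (Y : nat -> C) :
  koszul_type deg sigma -> (forall t, GC (deg t) (x t)) ->
  hs (\sum_(t <- B) deg t + 1) Y ->
  sigma (L ++ B ++ R) *:
    hprod ([seq hconst ((-1) ^ deg t *: x t) | t <- L]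
           ++ Y :: [seq hconst (x t) | t <- R])
  = sigma (B ++ L ++ R) *: hmul Y (hprod [seq hconst (x t) | t <- L ++ R]).
Proof.
move=> Hs hx hY; elim: L sigma Hs => [|t L IH] sigma Hs //.
have Hs' : koszul_type deg (fun w => sigma (t :: w)).
  by move=> w1 y z w2; apply: (Hs (t :: w1)).
set P := hprod _; have -> : P = (-1) ^ deg t *: hmul (hconst (x t))
    (hprod ([seq hconst ((-1) ^ deg t *: x t) | t <- L]
           ++ Y :: [seq hconst (x t) | t <- R])).
  by rewrite /P /= hconstZ hmulZl.
rewrite scalerA mulrC -scalerA -hmulZr (IH _ Hs') hmulZr hmulA.
rewrite (hmulC (homog_hconst hG (hx t)) hY) hmulZl -hmulA !scalerA.
have /= := koszul_type_cat Hs [::] [:: t] B (L ++ R); rewrite big_seq1 => ->.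
congr (_ *: _); rewrite degree_signDr degree_sign1r.
set S := degree_sign _ _ _; set u := (-1) ^ _; set z := sigma _.
have -> : u * (S * z * (S * u)) = (u * u) * (S * S) * z by ring.
by rewrite signz_sqr degree_sign_sqr !mul1r.
Qed.

End GradedAlgebra.

(** * The descendant relation for series *)

Lemma mask_compl_perm (T : eqType) (s : seq T) m : size m = size s ->
  perm_eq (mask m s ++ mask (map negb m) s) s.
Proof.
elim: s m => [|x s IH] [|[] m] //= [/IH E]; first by rewrite perm_cons.
by rewrite -cat1s perm_catCA /= perm_cons.
Qed.

Lemma nth_coefs_of (T : Type) (V : zmodType) (X : T -> nat -> V) (t0 : T) s vs i :
  coefs_of (map X s) vs -> (i < size s)%N ->
  exists m, nth 0 vs i = X (nth t0 s i) m.
Proof.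
elim: s vs i => [|t s IH] [|v vs] [|i] //=.
  by move=> [[m ->] _] _; exists m.
by move=> [_ Xvs]; apply: IH.
Qed.

Lemma flatten_set_word n (bs : seq {set 'I_n}) :
  flatten [seq set_word B | B <- bs] = [seq val i | i <- block_word bs].
Proof. by rewrite /block_word map_flatten -map_comp. Qed.

Lemma nth_part_words n (p : {set {set 'I_n}}) i : (i < #|p|)%N ->
  nth [::] (part_words p) i = set_word (block p i).
Proof. by move=> ip; rewrite (nth_map set0) ?size_blocks. Qed.

Lemma size_part_words n (p : {set {set 'I_n}}) : size (part_words p) = #|p|.
Proof. by rewrite size_map size_blocks. Qed.

Lemma eps_koszul_sign (k : fieldType) n (d : 'I_n -> int) (d' : nat -> int) p :
  (forall i, d' (val i) = d i) -> p \in Pn n ->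
  eps k d p = koszul_sign k d' (flatten (part_words p)).
Proof.
move=> dd' /part_words_canonical[Hp _ _ _]; rewrite /part_words flatten_set_word.
apply: koszulE => //; rewrite -(map_inj_uniq val_inj) -flatten_set_word.
by rewrite (perm_uniq Hp) iota_uniq.
Qed.

Section Descendant.
Context (k : fieldType) (C : algType k) (GC : int -> C -> Prop).
Context (K : nat -> {linear C -> C}) (l : seq C -> nat -> C).
Hypothesis hC : graded_comm_algebra GC.
Hypothesis hl : quantum_descendant GC K l.
Let hG := gca_grading hC.

(** The family l, with the value 0 at the empty word, so that sums over all
    subwords may be taken. *)
Definition descendant0 (vs : seq C) : nat -> C :=
  if vs is [::] then 0 else l vs.

Lemma happ_descendant0 xs :
  happ descendant0 xs = if xs is [::] then 0 else happ l xs.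
Proof. by case: xs. Qed.

(** The sum over partitions with one marked block becomes a sum over the subset
    fed into l, by [big_parts_block]; moving l to the front cancels the J signs. *)
Lemma descendant_splits_const n (d : nat -> int) (x : nat -> C) :
  (0 < n)%N -> (forall i, GC (d i) (x i)) ->
  hact K (hconst (\prod_(i <- iota 0 n) x i))
  = \sum_(ab <- splits (iota 0 n)) mhbar (size ab.1).-1
      (koszul_sign k d (ab.1 ++ ab.2)
       *: hmul (descendant0 (map x ab.1)) (hprod [seq hconst (x i) | i <- ab.2])).
Proof.
move=> n0 dx.
have := descendant_eq hl (d := fun i : 'I_n => d i) (x := fun i : 'I_n => x i) n0.
move=> /(_ (fun i => dx i)) E.
rewrite -[X in iota X _]/0%N -(subn0 n) -/(index_iota 0 n) big_mkord {}E.
pose G L B R := mhbar (size B).-1 (koszul_sign k d (flatten L ++ B ++ flatten R) *: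
  hprod ([seq hconst ((-1) ^ d t *: x t) | t <- flatten L]
           ++ descendant0 (map x B) :: [seq hconst (x t) | t <- flatten R])).
pose F q := \sum_(i < size q | size (nth [::] q i) == (n - size q).+1)
   mhbar (n - size q) (koszul_sign k d (flatten q) *:
     hprod ([seq hconst ((-1) ^ d t *: x t) | t <- flatten (take i q)]
           ++ l (map x (nth [::] q i)) :: [seq hconst (x t) | t <- flatten (drop i.+1 q)])).
transitivity (\sum_(p in Pn n) F (part_words p)).
  apply: eq_bigr => p Pp; rewrite /F size_part_words.
  apply: eq_big => [i|i _].
    by rewrite nth_part_words ?ltn_ord // size_map -cardE.
  rewrite nth_part_words ?ltn_ord // -(eps_koszul_sign k (d := fun i : 'I_n => d i)) //.
  rewrite /part_words -map_take -map_drop !flatten_set_word /bracket_word.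
  by rewrite /restr /set_word -!map_comp.
rewrite (big_Pn n F) /F.
transitivity (\sum_(q <- parts (iota 0 n))
    \sum_(i < size q | all (fun B => size B == 1%N) (take i q)
                       && all (fun B => size B == 1%N) (drop i.+1 q))
      G (take i q) (nth [::] q i) (drop i.+1 q)).
  rewrite big_seq [RHS]big_seq; apply: eq_bigr => q qs.
  apply: eq_big => i.
    by have := parts_block_cond qs (ltn_ord i); rewrite size_iota => <-.
  move=> /eqP sB; rewrite /G sB /=.
  have -> : flatten (take i q) ++ nth [::] q i ++ flatten (drop i.+1 q) = flatten q.
    rewrite -[in RHS](cat_take_drop i q) (drop_nth [::] (ltn_ord i)).
    by rewrite flatten_cat.
  by case: (nth [::] q i) sB.
rewrite (big_parts_block (iota 0 n) (G := G) (g := fun a b => mhbar (size a).-1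
  (koszul_sign k d (a ++ b)
   *: hmul (descendant0 (map x a)) (hprod [seq hconst (x i) | i <- b])))).
- by rewrite /index_iota subn0.
- by move=> r; rewrite hmul0l scaler0 linear0.
move=> L B R; rewrite /G.
have fl s : flatten [seq [:: t] | t <- s] = s :> seq nat by exact: flatten_seq1.
rewrite !fl; case: B => [|t B].
  have z s1 s2 : hprod (s1 ++ (0 : nat -> C) :: s2) = 0.
    by elim: s1 => [|y s1 IH] /=; rewrite ?hmul0l // IH hmul0r.
  by rewrite /= z hmul0l !scaler0.
have E := @hprod_bracket k C GC hC nat d x (koszul_sign k d) L (t :: B) R
  (l (map x (t :: B))) (koszul_sign_koszul_type k d) dx.
congr (mhbar _ _); apply: E.
have := in_Hom_sym_homog (descendant_hom hl (ltn0Sn (size B))) (d := d) (v := x)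
  (s := t :: B) erefl isT.
by apply=> i _; apply: dx.
Qed.

(** The relation for elements extends to series by multilinearity. The sign
    function need not be the Koszul sign of a word of indices: only its behaviour
    under exchanges matters, by [koszul_type_unique]. It is used below with blocks
    of indices as letters. *)
Lemma descendant_splits (T : eqType) (q : seq T) (X : T -> nat -> C)
    (deg : T -> int) (sigma : seq T -> k) :
  q != [::] -> {in q, forall t, homog_series GC (deg t) (X t)} ->
  koszul_type deg sigma ->
  sigma q *: hact K (hprod (map X q))
  = \sum_(ab <- splits q) mhbar (size ab.1).-1
      (sigma (ab.1 ++ ab.2)
       *: hmul (happ descendant0 (map X ab.1)) (hprod (map X ab.2))).
Proof.
case: q => // q0 q'; set q := q0 :: q' => _ hX Hs.
pose r := size q; pose d i := deg (nth q0 q i).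
pose c m := koszul_sign k d (mask m (iota 0 r) ++ mask (map negb m) (iota 0 r)).
have const vs : coefs_of (map X q) vs -> hact K (hconst (\prod_(v <- vs) v))
    = \sum_(m <- bits r) mhbar (size (mask m q)).-1
       (c m *: hmul (descendant0 (mask m vs)) (hconst (\prod_(v <- mask (map negb m) vs) v))).
  move=> Xvs; have svs : size vs = r by rewrite (coefs_of_size Xvs) size_map.
  have dvs i : GC (d i) (nth 0 vs i).
    have [ir|ri] := ltnP i r; last by rewrite nth_default ?svs //; apply: grading0.
    have [m ->] := nth_coefs_of q0 Xvs ir.
    exact: hX (mem_nth q0 ir) m.
  have := descendant_splits_const (n := r) isT dvs.
  have vsE : map (nth 0 vs) (iota 0 r) = vs by rewrite -svs; apply: mkseq_nth.
  rewrite -(big_map (nth 0 vs) xpredT id) vsE => ->.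
  rewrite (big_splits_mask (iota 0 r) (fun a b => mhbar (size a).-1
   (koszul_sign k d (a ++ b) *: hmul (descendant0 (map (nth 0 vs) a))
      (hprod [seq hconst (nth 0 vs i) | i <- b])))) size_iota.
  rewrite big_seq [RHS]big_seq; apply: eq_bigr => m /size_bits sm.
  rewrite hprod_const -(big_map (nth 0 vs) xpredT id) !map_mask vsE.
  by rewrite !size_mask ?size_iota.
have -> : hact K (hprod (map X q)) = \sum_(m <- bits r) mhbar (size (mask m q)).-1
    (c m *: hmul (happ descendant0 (mask m (map X q)))
       (hprod (mask (map negb m) (map X q)))).
  rewrite hprod_happ -happ_hact (eq_happ const) happ_sum.
  rewrite big_seq [RHS]big_seq; apply: eq_bigr => m /size_bits sm.
  rewrite happ_mhbar_scale hprod_happ.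
  by rewrite -(happ_hmul _ (fun vs => hconst (\prod_(v <- vs) v))) // size_map.
rewrite (big_splits_mask q (fun a b => mhbar (size a).-1
   (sigma (a ++ b) *: hmul (happ descendant0 (map X a)) (hprod (map X b))))).
rewrite scaler_sumr big_seq [RHS]big_seq; apply: eq_bigr => m /size_bits sm.
rewrite -mhbarZ scalerA -!map_mask; congr (mhbar _ (_ *: _)).
have Ht : koszul_type d (fun w => sigma (map (nth q0 q) w)).
  by move=> w1 x y w2; rewrite !map_cat /= Hs.
have qE : map (nth q0 q) (iota 0 r) = q by exact: (mkseq_nth q0 q).
have := koszul_type_unique (koszul_sign_koszul_type k d) Ht
  (mask_compl_perm (s := iota 0 r) (m := m) _).
rewrite size_iota => /(_ sm); rewrite qE (koszul_sign_sorted k d (iota_ltn_sorted 0 r)) mulr1.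
by rewrite map_cat !map_mask qE mulrC => ->.
Qed.

End Descendant.

(** * Sums over set partitions *)

Lemma size_block (T : eqType) (s : seq T) q B : q \in parts s -> B \in q ->
  (size B <= size s)%N.
Proof.
move=> qs Bq; rewrite -(perm_size (parts_perm qs)) size_flatten.
by rewrite sumnE (big_rem (size B)) ?leq_addr ?map_f.
Qed.

Section PartitionSums.
Context (k : fieldType) (C : algType k) (GC : int -> C -> Prop).
Context (K : nat -> {linear C -> C}) (l : seq C -> nat -> C).
Hypothesis hC : graded_comm_algebra GC.
Hypothesis hl : quantum_descendant GC K l.
Let hG := gca_grading hC.
Context (H : lmodType k) (GH : int -> H -> Prop).

(** A family of graded symmetric multilinear maps of degree 0 into series. The
    value 0 at the empty list makes the rules for exchanging blocks hold for empty
    blocks too. *)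
Record symmetric_family (phi : seq H -> nat -> C) : Prop := SymmetricFamily {
  family_nil : phi [::] = 0;
  family_linear : forall a x y s1 s2,
    phi (s1 ++ (a *: x + y) :: s2) = a *: phi (s1 ++ x :: s2) + phi (s1 ++ y :: s2);
  family_swap : forall i j x y s1 s2, GH i x -> GH j y ->
    phi (s1 ++ x :: y :: s2) = degree_sign k i j *: phi (s1 ++ y :: x :: s2);
  family_homog : forall (d : nat -> int) (v : nat -> H) s,
    (forall i, GH (d i) (v i)) ->
    homog_series GC (\sum_(i <- s) d i) (phi (map v s)) }.

Definition partition_sum (phi : seq H -> nat -> C) (d : nat -> int) (v : nat -> H)
    (s : seq nat) : nat -> C :=
  \sum_(q <- parts s) mhbar (size s - size q)
    (koszul_sign k d (flatten q) *: hprod [seq phi (map v B) | B <- q]).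

Definition morphism_sum (phi : seq H -> nat -> C) (d : nat -> int) (v : nat -> H)
    (s : seq nat) : nat -> C :=
  \sum_(q <- parts s)
    koszul_sign k d (flatten q) *: happ (descendant0 l) [seq phi (map v B) | B <- q].

(** The sign of a word only depends on its beginning through the sign of that
    beginning and its set of letters. *)
Lemma koszul_sign_cat_factor d s w1 w2 : sorted ltn s -> perm_eq w1 s ->
  koszul_sign k d (w1 ++ w2) = koszul_sign k d (s ++ w2) * koszul_sign k d w1.
Proof.
move=> ss E.
have Ht : koszul_type d (fun w => koszul_sign k d (w ++ w2)).
  by move=> u x y w; rewrite -!catA /= (koszul_sign_koszul_type k d).
have := koszul_type_unique Ht (koszul_sign_koszul_type k d) E.
by rewrite (koszul_sign_sorted k d ss) mulr1 => ->; rewrite mulrC.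
Qed.

(** Expanding K of each product by the descendant relation, and collecting the
    terms by the set u of indices fed into l, gives the sum over u of
    (- hbar)^(|u|-1) times the morphism sum of u times the partition sum of the
    complement of u. By assumption only u = s contributes. *)
Lemma hact_partition_sum phi d v s : symmetric_family phi ->
  (forall i, GH (d i) (v i)) -> sorted ltn s -> s != [::] ->
  (forall u, subseq u s -> (size u < size s)%N -> morphism_sum phi d v u = 0) ->
  hact K (partition_sum phi d v s) = mhbar (size s).-1 (morphism_sum phi d v s).
Proof.
move=> hphi dv ss s0 hM; pose X B := phi (map v B).
pose deg (B : seq nat) := \sum_(i <- B) d i.
pose F (a b : seq (seq nat)) := mhbar ((size s).-1 - size b)
  (koszul_sign k d (flatten a ++ flatten b)
   *: hmul (happ (descendant0 l) (map X a)) (hprod (map X b))).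
transitivity (\sum_(q <- parts s) \sum_(ab <- splits q) F ab.1 ab.2).
  rewrite /partition_sum hact_sum big_seq [RHS]big_seq; apply: eq_bigr => q qs.
  have q0 : q != [::] by rewrite -size_eq0 (parts_size0 qs).
  have hX : {in q, forall B, homog_series GC (deg B) (X B)}.
    by move=> B Bq; apply: (family_homog hphi).
  rewrite hact_mhbar hactZ -/(map X q).
  rewrite -[koszul_sign k d _]/((koszul_sign k d \o flatten) q).
  rewrite (descendant_splits hC hl q0 hX (koszul_sign_flatten_koszul_type k d)).
  rewrite mhbar_sum big_seq [RHS]big_seq; apply: eq_bigr => ab abq.
  rewrite /= mhbarD /F flatten_cat.
  case: (ab) abq => -[|B a] b abq; first by rewrite /= !hmul0l !scaler0 !mhbar_0.
  congr (mhbar _ _); have := size_parts qs; have := splits_size abq => /=.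
  by lia.
rewrite big_parts_splits.
(* Only the splitting with an empty second half contributes. *)
rewrite (big_splits_left (F := fun u w => \sum_(q1 <- parts u) \sum_(q2 <- parts w) F q1 q2)).
  rewrite /morphism_sum mhbar_sum; apply: eq_bigr => q _; rewrite parts_nil big_seq1 /F.
  by rewrite /= subn0 cats0 hmuls1.
move=> ab abs w0; have us := splits_subseq1 abs.
have su := subseq_sorted ltn_trans us ss.
have u_lt : (size ab.1 < size s)%N.
  rewrite -(splits_size abs) -[X in (X < _)%N]addn0 ltn_add2l lt0n.
  by rewrite size_eq0.
rewrite exchange_big big1 // => q2 _.
transitivity (mhbar ((size s).-1 - size q2)
   (koszul_sign k d (ab.1 ++ flatten q2) *: hmul (morphism_sum phi d v ab.1) (hprod (map X q2)))).
  rewrite hmul_suml scaler_sumr mhbar_sum big_seq [RHS]big_seq.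
  apply: eq_bigr => q1 q1s; rewrite /F (koszul_sign_cat_factor d _ su (parts_perm q1s)).
  by rewrite hmulZl scalerA.
by rewrite (hM _ us u_lt) hmul0l scaler0 mhbar_0.
Qed.

(** By induction on the size of s, since powers of hbar can be cancelled. *)
Lemma morphism_sum_eq0 phi d v N : symmetric_family phi ->
  (forall i, GH (d i) (v i)) ->
  (forall s, sorted ltn s -> (0 < size s < N)%N ->
     hact K (partition_sum phi d v s) = 0) ->
  forall s, sorted ltn s -> (size s < N)%N -> morphism_sum phi d v s = 0.
Proof.
move=> hphi dv hK; elim/size_ind => s IH ss sN.
have [s0|s0] := eqVneq s [::].
  by rewrite s0 /morphism_sum parts_nil big_seq1 /= scaler0.
apply: (@mhbar_inj _ _ (size s).-1); rewrite mhbar_0 -hact_partition_sum //.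
  by apply: hK => //; rewrite sN andbT lt0n size_eq0.
move=> u us u_lt; have su := subseq_sorted ltn_trans us ss.
by apply: IH => //; apply: ltn_trans u_lt sN.
Qed.

(** Partition sums over a set of indices are partition sums over an initial segment,
    because signs are invariant under increasing renumberings. *)
Lemma partition_sum_relabel phi d v s : sorted ltn s ->
  partition_sum phi d v s
  = partition_sum phi (d \o nth 0%N s) (v \o nth 0%N s) (iota 0 (size s)).
Proof.
move=> ss; rewrite /partition_sum size_iota.
have sE : map (nth 0%N s) (iota 0 (size s)) = s by exact: (mkseq_nth 0%N s).
rewrite -[in parts s]sE parts_map big_map big_seq [RHS]big_seq.
apply: eq_bigr => q qs; rewrite size_map -map_flatten koszul_sign_map.
  rewrite -map_comp; congr (mhbar _ (_ *: hprod _)); apply: eq_map => B /=.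
  by rewrite -map_comp.
move=> i j; rewrite !(perm_mem (parts_perm qs)) !mem_iota !add0n /= => i_s j_s.
have mono a b : (a < size s)%N -> (b < size s)%N -> (a < b)%N ->
    (nth 0 s a < nth 0 s b)%N.
  by move=> a_s b_s; apply: (sorted_ltn_nth ltn_trans).
case: (ltngtP i j) => [ij|ji|->]; last by rewrite ltnn.
  exact: mono.
by apply: negbTE; rewrite -leqNgt; apply/ltnW/mono.
Qed.

Lemma hprod_rcons xs (x : nat -> C) : hprod (rcons xs x) = hmul (hprod xs) x.
Proof. by rewrite -cats1 hprod_cat /= hmuls1. Qed.

Lemma eq_partition_sum phi d d' v v' s :
  {in s &, forall i j, degree_sign k (d i) (d j) = degree_sign k (d' i) (d' j)} ->
  {in s, v =1 v'} -> partition_sum phi d v s = partition_sum phi d' v' s.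
Proof.
move=> dd vv; rewrite /partition_sum big_seq [RHS]big_seq; apply: eq_bigr => q qs.
have qE := perm_mem (parts_perm qs).
rewrite (eq_koszul_sign (d' := d')); last by move=> i j; rewrite !qE; apply: dd.
congr (mhbar _ (_ *: hprod _)); apply/eq_in_map => B Bq; congr phi.
apply/eq_in_map => i iB; apply: vv; rewrite -qE.
by apply/flattenP; exists B.
Qed.

Lemma partition_sum_local phi phi' d v s :
  (forall us, (size us <= size s)%N -> phi us = phi' us) ->
  partition_sum phi d v s = partition_sum phi' d v s.
Proof.
move=> E; rewrite /partition_sum big_seq [RHS]big_seq; apply: eq_bigr => q qs.
congr (mhbar _ (_ *: hprod _)); apply/eq_in_map => B Bq; apply: E.
by rewrite size_map (size_block qs Bq).
Qed.

(** Each index lies in exactly one block of a partition. *)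
Lemma partition_sum_linear phi d a v v1 v2 s i0 : symmetric_family phi ->
  uniq s -> i0 \in s -> v i0 = a *: v1 i0 + v2 i0 ->
  (forall i, i != i0 -> v i = v1 i /\ v i = v2 i) ->
  partition_sum phi d v s = a *: partition_sum phi d v1 s + partition_sum phi d v2 s.
Proof.
move=> hphi us is0 v0 vi; rewrite /partition_sum scaler_sumr -big_split big_seq [RHS]big_seq.
apply: eq_bigr => q qs; have E := parts_perm qs.
rewrite /= -mhbarZ scalerA mulrC -scalerA -[RHS]linearD -scalerDr.
congr (mhbar _ (_ *: _)).
have map1 (B : seq nat) : i0 \notin B -> map v B = map v1 B.
  by move=> iB; apply/eq_in_map => i Bi; apply: (vi i _).1; apply: contraNneq iB => <-.
have map2 (B : seq nat) : i0 \notin B -> map v B = map v2 B.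
  by move=> iB; apply/eq_in_map => i Bi; apply: (vi i _).2; apply: contraNneq iB => <-.
have {E qs} : uniq (flatten q) && (i0 \in flatten q).
  by rewrite (perm_uniq E) us (perm_mem E).
have nq (r : seq (seq nat)) : i0 \notin flatten r -> forall B, B \in r -> i0 \notin B.
  by move=> ir B Br; apply: contra ir => iB; apply/flattenP; exists B.
elim: q => [|B q IH] //=; rewrite cat_uniq mem_cat.
case/andP=> /and3P[uB /hasPn dis uq]; case: (boolP (i0 \in B)) => iB /=.
  move=> _; have {}/nq nq : i0 \notin flatten q by apply/negP => /dis /=; rewrite iB.
  have -> : [seq phi (map v1 B) | B <- q] = [seq phi (map v B) | B <- q].
    by apply/eq_in_map => D Dq; rewrite -map1 // nq.
  have -> : [seq phi (map v2 B) | B <- q] = [seq phi (map v B) | B <- q].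
    by apply/eq_in_map => D Dq; rewrite -map2 // nq.
  rewrite -hmulZl -[RHS](linearD (hmulr _)) /hmulr; congr hmul.
  clear dis IH; case/splitPr: iB uB => b1 b2; rewrite cat_uniq /= negb_or.
  case/and3P=> _ /andP[i1 _] /andP[i2 _].
  by rewrite !map_cat /= v0 (family_linear hphi) (map1 _ i1) (map1 _ i2)
    -(map2 _ i1) -(map2 _ i2) (map1 _ i1) (map1 _ i2).
move=> iq; rewrite IH ?uq // -(map1 _ iB) -(map2 _ iB) -hmulZr.
by rewrite -[RHS](linearD (hmul _)).
Qed.

Lemma partition_sum_zero phi d v s i0 : symmetric_family phi ->
  uniq s -> i0 \in s -> v i0 = 0 -> partition_sum phi d v s = 0.
Proof.
move=> hphi us is0 v0.
rewrite (@partition_sum_linear phi d (-1) v v v s i0) // ?scaleN1r ?addNr //.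
Qed.

Lemma partition_sum_homog phi d v s : symmetric_family phi ->
  (forall i, GH (d i) (v i)) ->
  homog_series GC (\sum_(i <- s) d i) (partition_sum phi d v s).
Proof.
move=> hphi dv m; rewrite /partition_sum ser_sum [X in GC _ X]big_seq.
apply: (grading_sum hG) => q qs; move: m.
apply: (homog_series_mhbar hG); apply: (homog_seriesZ hG).
have <- : \sum_(i <- flatten q) d i = \sum_(i <- s) d i.
  exact: (perm_big _ (parts_perm qs)).
rewrite big_flatten.
have := @homog_hprod k C GC hC _ (fun B : seq nat => \sum_(i <- B) d i)
  (fun B => phi (map v B)) q; apply => B _.
exact: (family_homog hphi).
Qed.

(** Renumbering by the transposition t of two neighbours changes every Koszul sign
    by the same factor, as it only affects the pair of these two letters, and it
    permutes the set partitions. *)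
Lemma partition_sum_swap phi d v i0 n : symmetric_family phi ->
  (forall i, GH (d i) (v i)) -> (i0.+1 < n)%N ->
  let t i := if i == i0 then i0.+1 else if i == i0.+1 then i0 else i in
  partition_sum phi (d \o t) (v \o t) (iota 0 n)
  = degree_sign k (d i0) (d i0.+1) *: partition_sum phi d v (iota 0 n).
Proof.
move=> hphi dv i0n t.
pose s1 := iota 0 i0; pose s2 := iota i0.+2 (n - i0.+2).
have iotaE : iota 0 n = s1 ++ i0 :: i0.+1 :: s2.
  have nE : n = (i0 + (2 + (n - i0.+2)))%N by lia.
  by rewrite [in LHS]nE iotaD add0n.
have t1 : map t s1 = s1.
  rewrite -[RHS]map_id; apply/eq_in_map => i; rewrite mem_iota add0n /t => /andP[_ ii].
  by rewrite !ltn_eqF // ltnS ltnW.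
have t2 : map t s2 = s2.
  rewrite -[RHS]map_id; apply/eq_in_map => i; rewrite mem_iota /t => /andP[ii _].
  by rewrite !gtn_eqF // ltnW.
have tE : map t (iota 0 n) = s1 ++ i0.+1 :: i0 :: s2.
  by rewrite iotaE map_cat /= t1 t2 /t eqxx eqn_leq ltnn eqxx.
pose F q := mhbar (n - size q)
  (koszul_sign k d (flatten q) *: hprod [seq phi (map v B) | B <- q]).
transitivity (\sum_(q <- parts (iota 0 n))
    degree_sign k (d i0) (d i0.+1) *: F (map (map t) q)).
  rewrite /partition_sum big_seq [RHS]big_seq; apply: eq_bigr => q qs.
  rewrite /F size_iota size_map -mhbarZ scalerA; congr (mhbar _ (_ *: hprod _)).
    have Ht : koszul_type (d \o t) (koszul_sign k d \o map t).
      by move=> u x y w; rewrite /= !map_cat /= (koszul_sign_koszul_type k d).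
    have := koszul_type_unique (koszul_sign_koszul_type k (d \o t)) Ht (parts_perm qs).
    rewrite (koszul_sign_sorted _ _ (iota_ltn_sorted 0 n)) mulr1 /= tE.
    rewrite (koszul_sign_koszul_type k d) -iotaE 
      (koszul_sign_sorted _ _ (iota_ltn_sorted 0 n)) mulr1.
    move=> E; rewrite -map_flatten -E mulrC -mulrA [degree_sign k (d i0) _]degree_signC.
    by rewrite degree_sign_sqr mulr1.
  rewrite -map_comp; apply: eq_map => B /=; by rewrite -map_comp.
rewrite -scaler_sumr -(big_map (map (map t)) xpredT F) -parts_map tE; congr (_ *: _).
rewrite (big_parts_swap (F := F)) -?iotaE ?/partition_sum ?size_iota //.
  move=> q1 B D q2; rewrite /F !size_cat /= !flatten_cat /= !map_cat /=.
  rewrite (koszul_type_cat (koszul_sign_koszul_type k d)) !hprod_cat /=.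
  set D' := phi (map v D); set B' := phi (map v B).
  have E : hmul B' (hmul D' (hprod [seq phi (map v w) | w <- q2]))
    = degree_sign k (\sum_(x <- B) d x) (\sum_(y <- D) d y)
      *: hmul D' (hmul B' (hprod [seq phi (map v w) | w <- q2])).
    by rewrite hmulA (hmulC hC (family_homog hphi B dv) (family_homog hphi D dv))
      hmulZl -hmulA.
  by rewrite E hmulZr scalerA mulrAC degree_sign_sqr mul1r.
move=> q1 a x y b q2; rewrite /F !size_cat /= !flatten_cat /= !map_cat /=.
rewrite !map_cat /= (family_swap hphi _ _ (dv x) (dv y)) !hprod_cat /=.
rewrite hmulZl hmulZr scalerA -!catA /= !catA (koszul_sign_koszul_type k d).
by rewrite mulrAC degree_sign_sqr mul1r.
Qed.

End PartitionSums.

(** * Multilinear extension and the recursive construction *)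

(** A deformation retract of (C[[hbar]], K) onto (H[[hbar]], 0), with homotopy S,
    inclusion F and projection Hh. *)
Record quantum_retract (k : fieldType) (C : algType k) (GC : int -> C -> Prop)
    (H : lmodType k) (GH : int -> H -> Prop) (K : nat -> {linear C -> C}) (oneH : H)
    (F : nat -> {linear H -> C}) (Hh : nat -> {linear C -> H})
    (S : nat -> {linear C -> C}) : Prop := QuantumRetract {
  quantum_K_degree : forall m, homog_map GC GC 1 (K m);
  quantum_F_degree : forall m, homog_map GH GC 0 (F m);
  quantum_Hh_degree : forall m, homog_map GC GH 0 (Hh m);
  quantum_S_degree : forall m, homog_map GC GC (-1) (S m);
  quantum_KK : forall x, hact K (hact K x) = 0;
  quantum_KF : forall a, hact K (hact F a) = 0;
  quantum_HF : forall a, hact Hh (hact F a) = a;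
  quantum_HK : forall x, hact Hh (hact K x) = 0;
  quantum_HS : forall x, hact Hh (hact S x) = 0;
  quantum_FH : forall x,
    hact F (hact Hh x) = x - hact K (hact S x) - hact S (hact K x);
  quantum_one_degree : GH 0 oneH;
  quantum_F1 : hact F (hconst oneH) = hconst 1 }.

Section Extension.
Context (k : fieldType) (C : algType k) (GC : int -> C -> Prop).
Hypothesis hC : graded_comm_algebra GC.
Let hG := gca_grading hC.
Context (H : lmodType k) (GH : int -> H -> Prop).
Hypothesis hH : is_grading GH.

Definition homog_list (vs : seq H) : Prop :=
  exists d : nat -> int, forall i, GH (d i) (nth 0 vs i).

Lemma homog_cat us vs : homog_list us -> homog_list vs -> homog_list (us ++ vs).
Proof.
move=> [d du] [e ev]; exists (fun i => if (i < size us)%N then d i else e (i - size us)%N).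
by move=> i; rewrite nth_cat; case: ifP.
Qed.

Lemma homog_nil : homog_list [::].
Proof. by exists (fun=> 0) => i; rewrite nth_nil; apply: grading0. Qed.

Lemma homog_cons j x vs : GH j x -> homog_list vs -> homog_list (x :: vs).
Proof.
by move=> hx [d dv]; exists (fun i => if i is i'.+1 then d i' else j) => -[|i] /=.
Qed.

Lemma linear_eq0_homog (W : lmodType k) (f : H -> W) :
  (forall a x y, f (a *: x + y) = a *: f x + f y) ->
  (forall j x, GH j x -> f x = 0) -> forall x, f x = 0.
Proof.
move=> hf h0 x; have [s [w [_ hw ->]]] := grading_span hH x.
elim: s => [|j s IH]; first by rewrite big_nil; apply: (h0 0); apply: grading0.
by rewrite big_cons -[w j]scale1r hf IH addr0 scale1r (h0 _ _ (hw j)).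
Qed.

(** An identity between multilinear expressions may be checked on homogeneous
    arguments, the arguments being replaced one at a time. *)
Lemma homog_list_ind (Q : seq H -> Prop) :
  (forall us vs, (forall j x, GH j x -> Q (us ++ x :: vs)) ->
     forall x, Q (us ++ x :: vs)) ->
  (forall vs, homog_list vs -> Q vs) -> forall vs, Q vs.
Proof.
move=> hQ h0 vs; suff gen us : homog_list us -> Q (us ++ vs) by exact: gen homog_nil.
elim: vs us => [|x vs IH] us hu; first by rewrite cats0; apply: h0.
apply: hQ => j y hy; rewrite -cat_rcons; apply: IH; rewrite -cats1.
exact: homog_cat hu (homog_cons hy homog_nil).
Qed.

Lemma multilinear_eq0 (W : lmodType k) n (b : seq H -> W) :
  (forall a x y s1 s2, (size s1 + size s2).+1 = n ->
     b (s1 ++ (a *: x + y) :: s2) = a *: b (s1 ++ x :: s2) + b (s1 ++ y :: s2)) ->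
  (forall vs, size vs = n -> homog_list vs -> b vs = 0) ->
  forall vs, size vs = n -> b vs = 0.
Proof.
move=> hb h0; apply: homog_list_ind => [us vs IH x|vs hv sn]; last exact: h0.
rewrite size_cat /= addnS => sn.
apply: (linear_eq0_homog (f := fun x => b (us ++ x :: vs))) => [a y z|j y hy].
  exact: hb.
by apply: IH hy _; rewrite size_cat /= addnS.
Qed.

Context (P : bool -> {linear H -> H}).
Hypothesis hP : forall b j x, GH j x -> P b x = if b == parity j then x else 0.

(** The multilinear extension of the partition sum, whose Koszul signs only make
    sense for homogeneous arguments: each argument is split into its even and its
    odd part. *)
Definition extended_sum (phi : seq H -> nat -> C) (vs : seq H) : nat -> C :=
  \sum_(bs <- bits (size vs))
    partition_sum phi (fun i => nth false bs i : int)
      (fun i => P (nth false bs i) (nth 0 vs i)) (iota 0 (size vs)).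

(** A homogeneous argument has a zero even or odd part, so a single term of the
    extension survives. *)
Lemma extended_sum_partition_sum phi d vs : symmetric_family GC GH phi ->
  (forall i, GH (d i) (nth 0 vs i)) ->
  extended_sum phi vs = partition_sum phi d (nth 0 vs) (iota 0 (size vs)).
Proof.
move=> hphi dv; set n := size vs.
pose bs0 := mkseq (fun i => parity (d i)) n.
have bs0n : bs0 \in bits n.
  by rewrite -[in bits n](size_mkseq (fun i => parity (d i)) n); apply: mem_bits.
rewrite /extended_sum -/n (bigD1_seq bs0 bs0n (bits_uniq n)) /= big_seq_cond big1 ?addr0.
  apply: eq_partition_sum => [i j|i]; rewrite !mem_iota !add0n /= => i_n.
    by move=> j_n; rewrite !nth_mkseq // [RHS]degree_sign_parity.
  by rewrite nth_mkseq // (hP _ (dv i)) eqxx.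
move=> bs /andP[/size_bits sb bb0].
have /allPn[i i_n bi] : ~~ all (fun i => nth false bs i == parity (d i)) (iota 0 n).
  apply: contra bb0 => /allP E; apply/eqP.
  apply: (@eq_from_nth _ false) => [|i]; first by rewrite sb size_mkseq.
  rewrite sb => i_n; rewrite nth_mkseq //; apply/eqP/E.
  by rewrite mem_iota.
apply: (partition_sum_zero _ hphi (iota_uniq 0 n) i_n).
by rewrite (hP _ (dv i)) (negbTE bi).
Qed.

Lemma extended_sum_linear phi a x y s1 s2 : symmetric_family GC GH phi ->
  extended_sum phi (s1 ++ (a *: x + y) :: s2)
  = a *: extended_sum phi (s1 ++ x :: s2) + extended_sum phi (s1 ++ y :: s2).
Proof.
move=> hphi; have sz z : size (s1 ++ z :: s2) = (size s1 + size s2).+1.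
  by rewrite size_cat /= addnS.
rewrite /extended_sum !sz scaler_sumr -big_split; apply: eq_bigr => bs _.
apply: (partition_sum_linear _ hphi (i0 := size s1)).
- exact: iota_uniq.
- by rewrite mem_iota add0n /= ltnS leq_addr.
- by rewrite !nth_cat ltnn subnn /= linearP.
move=> i i1; rewrite !nth_cat; case: ltnP => // s1i.
have : (0 < i - size s1)%N by rewrite subn_gt0 ltn_neqAle eq_sym i1.
by case: (i - size s1)%N.
Qed.

(** The conditions of [symmetric_family] on the n-ary component. *)
Record family_at (n : nat) (phi : seq H -> nat -> C) : Prop := FamilyAt {
  family_at_linear : forall a x y s1 s2, (size s1 + size s2).+1 = n ->
    phi (s1 ++ (a *: x + y) :: s2) = a *: phi (s1 ++ x :: s2) + phi (s1 ++ y :: s2);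
  family_at_swap : forall i j x y s1 s2, (size s1 + size s2).+2 = n ->
    GH i x -> GH j y ->
    phi (s1 ++ x :: y :: s2) = degree_sign k i j *: phi (s1 ++ y :: x :: s2);
  family_at_homog : forall (d : nat -> int) (v : nat -> H) s, size s = n ->
    (forall i, GH (d i) (v i)) ->
    homog_series GC (\sum_(i <- s) d i) (phi (map v s)) }.

Lemma eq_family_at n phi phi' :
  (forall vs, size vs = n -> phi vs = phi' vs) ->
  family_at n phi -> family_at n phi'.
Proof.
move=> E [h1 h2 h3]; split=> [a x y s1 s2 sn|i j x y s1 s2 sn hx hy|d v s sn dv].
- by rewrite -!E ?size_cat /= ?addnS //; apply: h1.
- by rewrite -!E ?size_cat /= ?addnS //; apply: h2.
- by rewrite -E ?size_map //; apply: h3.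
Qed.

Definition trunc (N : nat) (phi : seq H -> nat -> C) (vs : seq H) : nat -> C :=
  if (size vs < N)%N then phi vs else 0.

Lemma trunc_family N phi : phi [::] = 0 ->
  (forall n, (0 < n < N)%N -> family_at n phi) ->
  symmetric_family GC GH (trunc N phi).
Proof.
move=> phi0 hphi; split=> [|a x y s1 s2|i j x y s1 s2 hx hy|d v s dv].
- by rewrite /trunc phi0; case: ifP.
- rewrite /trunc !size_cat /= !addnS; case: ifP => sN; last by rewrite scaler0 addr0.
  by apply: (family_at_linear (hphi (size s1 + size s2).+1 sN)).
- rewrite /trunc !size_cat /= !addnS; case: ifP => sN; last by rewrite scaler0.
  by apply: (family_at_swap (hphi (size s1 + size s2).+2 sN)).
- rewrite /trunc size_map; case: ifP => sN; last by move=> m; apply: (grading0 hG).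
  case: s sN => [|i s] sN; first by rewrite /= phi0 => m; apply: (grading0 hG).
  by apply: (family_at_homog (hphi (size s).+1 sN)).
Qed.

(** Symmetry is checked on homogeneous arguments, where it is the invariance of
    partition sums under transpositions. *)
Lemma extended_sum_family_at phi n : (0 < n)%N -> symmetric_family GC GH phi ->
  family_at n (extended_sum phi).
Proof.
move=> n0 hphi.
have lin a x y s1 s2 := extended_sum_linear a x y s1 s2 hphi; split.
- by move=> a x y s1 s2 _.
- move=> i j x y + + _ hx hy.
  pose f s1 s2 := extended_sum phi (s1 ++ x :: y :: s2)
    - degree_sign k i j *: extended_sum phi (s1 ++ y :: x :: s2).
  have lf1 u v s2 a z t : f (u ++ (a *: z + t) :: v) s2
      = a *: f (u ++ z :: v) s2 + f (u ++ t :: v) s2.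
    rewrite /f -!catA /= !lin !scalerDr opprD scalerN !scalerA.
    by rewrite [a * _]mulrC addrACA.
  have lf2 u v s1 a z t : f s1 (u ++ (a *: z + t) :: v)
      = a *: f s1 (u ++ z :: v) + f s1 (u ++ t :: v).
    have cE (c1 c2 : H) w : s1 ++ c1 :: c2 :: u ++ w = (s1 ++ c1 :: c2 :: u) ++ w.
      by rewrite -catA.
    rewrite /f !cE !lin !scalerDr opprD scalerN !scalerA.
    by rewrite [a * _]mulrC addrACA.
  suff f0 : forall s1 s2, f s1 s2 = 0.
    by move=> s1 s2; apply/eqP; rewrite -subr_eq0; apply/eqP/f0.
  move=> s1; apply: homog_list_ind => [u v IH|s2 h2].
    by apply: linear_eq0_homog => // a z t; apply: lf2.
  move: s1; apply: homog_list_ind => [u v IH|s1 h1].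
    by apply: (linear_eq0_homog (f := fun z => f (u ++ z :: v) s2)) => // a z t; apply: lf1.
  apply/eqP; rewrite subr_eq0; apply/eqP; set n1 := size s1.
  have [d1 hd1] := h1; have [d2 hd2] := h2.
  pose d m := if (m < n1)%N then d1 m else if m == n1 then i
              else if m == n1.+1 then j else d2 (m - n1.+2)%N.
  pose t m := if m == n1 then n1.+1 else if m == n1.+1 then n1 else m.
  set vs := s1 ++ x :: y :: s2; set vs' := s1 ++ y :: x :: s2.
  have dvs m : GH (d m) (nth 0 vs m).
    rewrite /vs nth_cat -/n1 /d; case: ltnP => [//|n1m].
    case: eqP => [->|/eqP mn]; first by rewrite subnn.
    case: eqP => [->|/eqP mn']; first by rewrite subSnn.
    have {n1m mn mn'} n2m : (n1.+2 <= m)%N by lia.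
    by rewrite -(subnKC n2m) addKn -addn2 -addnA addKn.
  have vsE m : nth 0 vs' m = nth 0 vs (t m).
    rewrite /t /vs /vs' !nth_cat -/n1; case: eqP => [->|/eqP mn].
      by rewrite ltnn subnn ltnNge leqnSn subSnn.
    case: eqP => [->|/eqP mn']; first by rewrite ltnn subnn ltnNge leqnSn subSnn.
    case: ltnP => // n1m; have {n1m mn mn'} n2m : (n1.+2 <= m)%N by lia.
    by rewrite -(subnKC n2m) -addn2 -addnA addKn.
  have dvs' m : GH (d (t m)) (nth 0 vs' m) by rewrite vsE.
  rewrite (extended_sum_partition_sum hphi dvs) (extended_sum_partition_sum hphi dvs').
  have -> : size vs' = size vs by rewrite !size_cat.
  have -> : partition_sum phi (d \o t) (nth 0 vs') (iota 0 (size vs))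
    = partition_sum phi (d \o t) (nth 0 vs \o t) (iota 0 (size vs)).
    by apply: eq_partition_sum => // m _; apply: vsE.
  rewrite (partition_sum_swap hC hphi dvs).
    have -> : d n1 = i by rewrite /d ltnn eqxx.
    have -> : d n1.+1 = j by rewrite /d ltnNge leqnSn /= eqn_leq ltnn eqxx.
    by rewrite scalerA degree_sign_sqr scale1r.
  by rewrite size_cat /= -/n1 !addnS !ltnS leq_addr.
- move=> d v s sn dv.
  have dvs : forall m, GH (if (m < n)%N then d (nth 0%N s m) else 0) (nth 0 (map v s) m).
    move=> m; case: ltnP => mn; first by rewrite (nth_map 0%N) ?sn.
    by rewrite nth_default ?size_map ?sn //; apply: grading0.
  rewrite (extended_sum_partition_sum hphi dvs) size_map sn => m.
  have := partition_sum_homog hC (iota 0 n) hphi dvs m.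
  have -> // : \sum_(i <- iota 0 n) (if (i < n)%N then d (nth 0%N s i) else 0)
    = \sum_(i <- s) d i.
  rewrite [RHS](big_nth 0%N) sn /index_iota subn0 big_seq [RHS]big_seq.
  by apply: eq_bigr => i; rewrite mem_iota add0n /= => ->.
Qed.

(** A unital family kills all partitions in which the unit is not a singleton; the
    unit, being the last letter, then carries no sign and multiplies by 1. *)
Lemma extended_sum_rcons_unit phi oneH : symmetric_family GC GH phi -> GH 0 oneH ->
  phi [:: oneH] = hconst 1 ->
  (forall vs, (0 < size vs)%N -> phi (rcons vs oneH) = 0) ->
  forall vs, extended_sum phi (rcons vs oneH) = extended_sum phi vs.
Proof.
move=> hphi h1 phi1 phiu vs; apply/eqP; rewrite -subr_eq0; apply/eqP.
apply: (multilinear_eq0 (n := size vs)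
  (b := fun vs => extended_sum phi (rcons vs oneH) - extended_sum phi vs)) => //.
  move=> a x y s1 s2 _; rewrite !rcons_cat !rcons_cons !extended_sum_linear //.
  by rewrite scalerBr opprD addrACA.
move=> {}vs _ [d dv]; set n := size vs.
pose d' i := if (i < n)%N then d i else 0.
have dv' i : GH (d' i) (nth 0 (rcons vs oneH) i).
  rewrite /d' nth_rcons -/n; case: ltnP => // _; case: eqP => // _.
  exact: grading0.
have dv'' i : GH (d' i) (nth 0 vs i).
  rewrite /d'; case: ltnP => // ni; rewrite nth_default //; exact: grading0.
apply/eqP; rewrite subr_eq0; apply/eqP.
rewrite (extended_sum_partition_sum hphi dv').
rewrite (extended_sum_partition_sum hphi dv'') size_rcons -/n.
have -> : iota 0 n.+1 = rcons (iota 0 n) n by rewrite -cats1 -addn1 iotaD.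
set v := nth 0 (rcons vs oneH).
have <- : partition_sum phi d' v (iota 0 n) = partition_sum phi d' (nth 0 vs) (iota 0 n).
  apply: eq_partition_sum => // i.
  by rewrite mem_iota add0n /v nth_rcons => /= ->.
have vn : v n = oneH by rewrite /v nth_rcons ltnn eqxx.
rewrite /partition_sum big_parts_rcons.
rewrite (big_splits_right (F := fun a r => \sum_(q <- parts r)
  mhbar (size (rcons (iota 0 n) n) - size (rcons q (rcons a n)))
    (koszul_sign k d' (flatten (rcons q (rcons a n)))
     *: hprod [seq phi (map v B) | B <- rcons q (rcons a n)]))).
  rewrite big_seq [RHS]big_seq; apply: eq_bigr => q qs.
  rewrite !size_rcons subSS flatten_rcons cats1 map_rcons /= vn phi1.
  rewrite hprod_rcons hmuls1 koszul_sign_rcons //.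
  apply/allP => i; rewrite (perm_mem (parts_perm qs)) mem_iota add0n.
  by case/andP.
move=> ab abs a0; rewrite big1 // => q _.
rewrite !map_rcons vn phiu ?hprod_rcons ?hmul0r ?scaler0 ?mhbar_0 //.
by rewrite size_map lt0n size_eq0.
Qed.

Lemma parts_block_lt (T : eqType) (s : seq T) q B : q \in parts s ->
  (1 < size q)%N -> B \in q -> (size B < size s)%N.
Proof.
move=> qs q1 Bq; have q0 := parts_nonempty qs.
rewrite -(perm_size (parts_perm qs)); case/splitPr: Bq q1 q0 => r1 r2 q1.
rewrite mem_cat inE !negb_or => /and3P[r10 _ r20].
rewrite flatten_cat /= !size_cat.
have := (size_flatten_leqif r10).1; have := (size_flatten_leqif r20).1.
by move: q1; rewrite size_cat /=; lia.
Qed.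

(** Only the partition with one block involves the component of top arity. *)
Lemma extended_sum_trunc phi n : (0 < n)%N ->
  symmetric_family GC GH (trunc n phi) ->
  symmetric_family GC GH (trunc n.+1 phi) ->
  forall vs, size vs = n ->
  extended_sum (trunc n.+1 phi) vs = extended_sum (trunc n phi) vs + mhbar n.-1 (phi vs).
Proof.
move=> n0 h h1 vs sn; apply/eqP; rewrite -subr_eq0; apply/eqP; move: vs sn.
apply: multilinear_eq0 => [a x y s1 s2 sn|vs sn [d dv]].
  rewrite (extended_sum_linear _ _ _ _ _ h) (extended_sum_linear _ _ _ _ _ h1).
  have := family_linear h1 a x y s1 s2.
  rewrite /trunc !size_cat /= !addnS sn leqnn => ->.
  rewrite mhbar_D mhbarZ.
  by rewrite [X in _ - X]addrACA -scalerDr opprD addrACA -scalerBr.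
apply/eqP; rewrite subr_eq0 addrC -subr_eq; apply/eqP.
rewrite (extended_sum_partition_sum h dv) (extended_sum_partition_sum h1 dv).
rewrite /partition_sum -sumrB sn size_iota.
have s0 : iota 0 n != [::] by rewrite -size_eq0 size_iota -lt0n.
have vsE : map (nth 0 vs) (iota 0 n) = vs by rewrite -sn; exact: (mkseq_nth 0 vs).
rewrite (big_parts_single s0) => [|q qs q1].
  rewrite /= subn1 cats0 (koszul_sign_sorted k d (iota_ltn_sorted 0 n)) !scale1r !hmuls1.
  by rewrite vsE /trunc sn leqnn ltnn linear0 subr0.
apply/eqP; rewrite subr_eq0; apply/eqP; congr (mhbar _ (_ *: hprod _)).
apply/eq_in_map => B Bq; rewrite /trunc size_map.
have := parts_block_lt qs q1 Bq; rewrite size_iota => Bn.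
by rewrite Bn ltnW.
Qed.

Context (K : nat -> {linear C -> C}) (l : seq C -> nat -> C).
Hypothesis hl : quantum_descendant GC K l.
Context (F : nat -> {linear H -> C}) (Hh : nat -> {linear C -> H})
  (S : nat -> {linear C -> C}) (oneH : H).
Hypothesis hQ : quantum_retract GC GH K oneH F Hh S.
Let K_degree := quantum_K_degree hQ.
Let F_degree := quantum_F_degree hQ.
Let Hh_degree := quantum_Hh_degree hQ.
Let S_degree := quantum_S_degree hQ.
Let KK := quantum_KK hQ.
Let KF := quantum_KF hQ.
Let HF := quantum_HF hQ.
Let HK := quantum_HK hQ.
Let HS := quantum_HS hQ.
Let FH := quantum_FH hQ.
Let oneH_degree := quantum_one_degree hQ.
Let F1 := quantum_F1 hQ.

Lemma homog_hact (V W : lmodType k) (GV : int -> V -> Prop) (GW : int -> W -> Prop)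
    e (T : nat -> {linear V -> W}) a x :
  is_grading GW -> (forall m, homog_map GV GW e (T m)) ->
  homog_series GV a x -> homog_series GW (a + e) (hact T x).
Proof.
move=> hW hT hx m; apply: (grading_sum hW) => i _; exact: hT.
Qed.

(** The n-ary component in terms of the partition sum X of the lower ones. The
    first term cancels K X, which is divisible by (- hbar)^(n-1); the second one
    removes the coefficients of order at least n-1 from the class of X. *)
Definition correction (n : nat) (X : nat -> C) : nat -> C :=
  - hact S (hdiv n.-1 (hact K X)) - hact F (hdiv n.-1 (hact Hh X)).

Lemma correction_linear n : linear (correction n).
Proof.
move=> a X Y; rewrite /correction !linearP /=.
by rewrite addrACA -scalerDr.
Qed.
Lemma correction0 n : correction n 0 = 0.
Proof.
have := correction_linear n (-1) 0 0.
by rewrite scaler0 addr0 scaleN1r addNr.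
Qed.

Lemma correctionZ n a X : correction n (a *: X) = a *: correction n X.
Proof.
have := correction_linear n a X 0.
by rewrite correction0 !addr0.
Qed.

Definition phi_step (phi : seq H -> nat -> C) (vs : seq H) : nat -> C :=
  match vs with
  | [::] => 0
  | [:: v] => hact F (hconst v)
  | _ => correction (size vs) (extended_sum (trunc (size vs) phi) vs)
  end.

Lemma eq_phi_step phi phi' vs :
  (forall us, (size us < size vs)%N -> phi us = phi' us) ->
  phi_step phi vs = phi_step phi' vs.
Proof.
case: vs => [|v [|w vs]] E; [by [] | by [] | rewrite /phi_step].
have -> // : trunc (size [:: v, w & vs]) phi = trunc (size [:: v, w & vs]) phi'.
by apply/funext => us; rewrite /trunc; case: ifP => // /E.
Qed.

(** The n-ary component only depends on those of smaller arity, so iterating the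
    step more than n times defines it. *)
Definition phi_upto (N : nat) : seq H -> nat -> C := iter N phi_step (fun=> 0).

Definition phi_family (vs : seq H) : nat -> C := phi_upto (size vs).+1 vs.

Lemma phi_upto_stable N M vs : (size vs < N)%N -> (size vs < M)%N ->
  phi_upto N vs = phi_upto M vs.
Proof.
elim: N M vs => [//|N IH] [//|M] vs vN vM; rewrite /phi_upto !iterS.
by apply: eq_phi_step => us su; apply: IH; apply: leq_trans su _.
Qed.

Lemma phi_familyE vs : phi_family vs = phi_step phi_family vs.
Proof.
rewrite /phi_family {1}/phi_upto iterS; apply: eq_phi_step => us su.
exact: phi_upto_stable.
Qed.

Lemma phi_family1 v : phi_family [:: v] = hact F (hconst v).
Proof. by rewrite phi_familyE. Qed.

Lemma phi_family_correction vs : (1 < size vs)%N ->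
  phi_family vs = correction (size vs) (extended_sum (trunc (size vs) phi_family) vs).
Proof. by case: vs => [//|v [//|w vs]] _; rewrite phi_familyE /phi_step. Qed.

(** Truncating above the arity of the arguments discards no term; it is done
    because the truncated family satisfies [symmetric_family] as soon as the
    components that occur are known to. *)
Definition Pi_series (vs : seq H) : nat -> C :=
  extended_sum (trunc (size vs).+1 phi_family) vs.

(** The induction hypothesis of the construction: what the components of larger
    arity need to know about arity n. *)
Record stage (n : nat) : Prop := Stage {
  stage_family : family_at n phi_family;
  stage_unital : forall vs, size vs = n.-1 -> (0 < n.-1)%N ->
    phi_family (rcons vs oneH) = 0;
  stage_closed : forall vs, size vs = n -> hact K (Pi_series vs) = 0;
  stage_low : forall vs m, size vs = n -> (0 < m)%N -> (n.-1 <= m)%N ->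
    hact Hh (Pi_series vs) m = 0 }.

Lemma trunc_stage n : (forall m, (0 < m < n)%N -> stage m) ->
  symmetric_family GC GH (trunc n phi_family).
Proof. by move=> h; apply: trunc_family => // m /h []. Qed.

Lemma homog_hdiv (V : lmodType k) (GV : int -> V -> Prop) e r x :
  is_grading GV -> homog_series GV e x -> homog_series GV e (hdiv r x).
Proof. by move=> hV hx m; apply: gradingZ. Qed.

Lemma homog_correction n e X :
  homog_series GC e X -> homog_series GC e (correction n X).
Proof.
move=> hX m; have := homog_hact hG S_degree
  (homog_hdiv n.-1 hG (homog_hact hG K_degree hX)) m.
have := homog_hact hG F_degree
  (homog_hdiv n.-1 hH (homog_hact hH Hh_degree hX)) m.
rewrite !addr0 addrK /correction serE !serN -!scaleN1r => hf hs.
by apply: (gradingP hG) => //; apply: gradingZ.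
Qed.

Lemma family_at_correction n : (1 < n)%N ->
  symmetric_family GC GH (trunc n phi_family) -> family_at n phi_family.
Proof.
move=> n1 hphi; have [lin sw hom] := extended_sum_family_at (ltnW n1) hphi.
apply: (@eq_family_at n (fun vs => correction n (extended_sum (trunc n phi_family) vs))).
  by move=> vs sn; rewrite phi_family_correction sn.
split=> [a x y s1 s2 sn|i j x y s1 s2 sn hx hy|d v s sn dv].
- by rewrite lin // correction_linear.
- by rewrite (sw _ _ _ _ _ _ sn hx hy) correctionZ.
- exact/homog_correction/hom.
Qed.

Lemma extended_sum_trunc1 v phi : extended_sum (trunc 1 phi) [:: v] = 0.
Proof.
rewrite /extended_sum big1 // => bs _; rewrite /partition_sum big_seq1 /trunc /= hmul0l scaler0.
exact: mhbar_0.
Qed.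

Lemma Pi_series_correction vs : (0 < size vs)%N ->
  symmetric_family GC GH (trunc (size vs) phi_family) ->
  family_at (size vs) phi_family ->
  Pi_series vs
  = extended_sum (trunc (size vs) phi_family) vs + mhbar (size vs).-1 (phi_family vs).
Proof.
move=> n0 h hn; apply: extended_sum_trunc => //.
have phi0 : phi_family [::] = 0 by rewrite phi_familyE.
move: hn h n0; move: (size vs) => n hn h n0; apply: trunc_family => // m /andP[m0].
rewrite ltnS leq_eqVlt => /predU1P[-> //|mn].
move: h => [_ h1 h2 h3]; split=> [a x y s1 s2 sm|i j x y s1 s2 sm hx hy|d v s sm dv].
- by have := h1 a x y s1 s2; rewrite /trunc !size_cat /= !addnS sm mn.
- by have := h2 i j x y s1 s2 hx hy; rewrite /trunc !size_cat /= !addnS sm mn.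
- by have := h3 d v s dv; rewrite /trunc size_map sm mn.
Qed.

Lemma family_at1 : family_at 1 phi_family.
Proof.
split=> [a x y [|u s1] [|w s2] // _|i j x y s1 s2 //|d v [|i [|j s]] //= _ dv].
- by rewrite /= !phi_family1 linearP hactD hactZ.
- rewrite phi_family1 big_seq1 -[d i]addr0; apply: (homog_hact hG F_degree).
  exact: (homog_hconst hH).
Qed.

Lemma Pi_series1 v : Pi_series [:: v] = hact F (hconst v).
Proof.
rewrite Pi_series_correction //=; first by rewrite extended_sum_trunc1 add0r mhbar0 phi_family1.
  by apply: trunc_stage => -[|m].
exact: family_at1.
Qed.

Lemma stage1 : stage 1.
Proof.
split=> //; first exact: family_at1.
  by move=> [|v [|w vs]] // _; rewrite Pi_series1 KF.
by move=> [|v [|w vs]] // [|m] // _ _ _; rewrite Pi_series1 HF.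
Qed.

Lemma closed_partition_sum N d v : (forall m, (0 < m < N)%N -> stage m) ->
  (forall i, GH (d i) (v i)) -> forall s, sorted ltn s -> (0 < size s < N)%N ->
  hact K (partition_sum (trunc N phi_family) d v s) = 0.
Proof.
move=> hst dv s ss /andP[s0 s_N]; rewrite partition_sum_relabel //.
pose ws := [seq v i | i <- s].
have sw : size ws = size s by rewrite size_map.
pose e i := if (i < size s)%N then d (nth 0%N s i) else 0.
have ew i : GH (e i) (nth 0 ws i).
  rewrite /e; case: ltnP => si; first by rewrite (nth_map 0%N).
  by rewrite nth_default ?sw //; apply: grading0.
have := stage_closed (hst (size s) _) sw; rewrite s0 s_N => /(_ isT).
have hst' m : (0 < m < (size s).+1)%N -> stage m.
  by case/andP=> m0 ms; apply: hst; rewrite m0 (leq_trans ms).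
rewrite /Pi_series sw (extended_sum_partition_sum (trunc_stage hst') ew) sw => <-.
congr (hact K _).
transitivity (partition_sum (trunc N phi_family) e (nth 0 ws) (iota 0 (size s))).
  apply: eq_partition_sum => [i j|i]; rewrite !mem_iota !add0n /e /=.
    by move=> -> ->.
  by move=> i_s; rewrite (nth_map 0%N).
apply: partition_sum_local => us; rewrite size_iota /trunc => u_s.
by rewrite ltnS u_s (leq_ltn_trans u_s).
Qed.

(** The smaller partition sums being closed, their morphism sums vanish, and the
    expansion of K of the partition sum only has its term of order n-1. *)
Lemma obstruction_divisible n : (1 < n)%N ->
  (forall m, (0 < m < n)%N -> stage m) ->
  forall vs, size vs = n ->
  mhbar n.-1 (hdiv n.-1 (hact K (extended_sum (trunc n phi_family) vs)))
  = hact K (extended_sum (trunc n phi_family) vs).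
Proof.
move=> n1 hst vs sn; have hphi := trunc_stage hst.
apply/eqP; rewrite -subr_eq0; apply/eqP; move: vs sn.
apply: multilinear_eq0 => [a x y s1 s2 sn|vs sn [d dv]].
  rewrite (extended_sum_linear _ _ _ _ _ hphi) hactD hactZ.
  rewrite [hdiv _ _]linearP mhbar_D mhbarZ.
  by rewrite opprD addrACA -scalerBr.
apply/eqP; rewrite subr_eq0; apply/eqP.
rewrite (extended_sum_partition_sum hphi dv) sn.
have -> : hact K (partition_sum (trunc n phi_family) d (nth 0 vs) (iota 0 n))
    = mhbar n.-1 (morphism_sum l (trunc n phi_family) d (nth 0 vs) (iota 0 n)).
  rewrite (hact_partition_sum hC hl hphi dv) ?size_iota ?iota_ltn_sorted //.
    by rewrite -size_eq0 size_iota -lt0n ltnW.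
  move=> u us un; apply: (morphism_sum_eq0 hC hl (N := n) hphi dv) => //; last first.
    exact: (subseq_sorted ltn_trans us (iota_ltn_sorted 0 n)).
  by move=> s ss; apply: (closed_partition_sum hst dv).
by rewrite hdivK.
Qed.

(** With L the quotient of K X by (- hbar)^(n-1), the class of L is zero and
    L = K S L. For the unit, X is a closed series whose class has no terms of order
    n-1 or more, and both terms of the correction vanish. *)
Lemma stage_step n : (1 < n)%N -> (forall m, (0 < m < n)%N -> stage m) -> stage n.
Proof.
move=> n1 hst; have hphi := trunc_stage hst.
have n0 := ltnW n1.
have hn := family_at_correction n1 hphi.
pose X vs := extended_sum (trunc n phi_family) vs.
pose L vs := hdiv n.-1 (hact K (X vs)).
have LE vs : size vs = n -> mhbar n.-1 (L vs) = hact K (X vs).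
  exact: obstruction_divisible.
have PiE vs : size vs = n -> Pi_series vs = X vs + mhbar n.-1 (phi_family vs).
  by move=> sn; rewrite Pi_series_correction sn.
have phiE vs : size vs = n ->
    phi_family vs = - hact S (L vs) - hact F (hdiv n.-1 (hact Hh (X vs))).
  by move=> sn; rewrite phi_family_correction sn.
have KL vs : size vs = n -> hact K (L vs) = 0.
  by move=> sn; apply: (@mhbar_inj _ _ n.-1); rewrite -hact_mhbar LE // KK mhbar_0.
have HL vs : size vs = n -> hact Hh (L vs) = 0.
  by move=> sn; apply: (@mhbar_inj _ _ n.-1); rewrite -hact_mhbar LE // HK mhbar_0.
have KSL vs : size vs = n -> hact K (hact S (L vs)) = L vs.
  move=> sn; have := FH (L vs); rewrite HL // KL // !hact0 subr0.
  by move/esym/eqP; rewrite subr_eq0 => /eqP.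
split=> //.
- move=> vs sv v0; have sn : size (rcons vs oneH) = n.
    by rewrite size_rcons sv prednK.
  have st : stage n.-1 by apply: hst; rewrite v0 /= prednK.
  have XE : X (rcons vs oneH) = Pi_series vs.
    rewrite /X (@extended_sum_rcons_unit _ oneH) // ?/Pi_series ?sv ?prednK //.
      by rewrite /trunc n1 phi_family1 F1.
    move=> us u0; rewrite /trunc size_rcons; case: ifP => // un.
    have hu : stage (size us).+1 by apply: hst.
    exact: (stage_unital hu).
  rewrite phiE // /L XE (stage_closed st sv) [hdiv _ 0]linear0 hact0.
  have -> : hdiv n.-1 (hact Hh (Pi_series vs)) = 0.
    apply/funext => m; rewrite /hdiv (stage_low st) ?scaler0 //.
      by rewrite addn_gt0 v0 orbT.
    by rewrite (leq_trans (leq_pred _)) ?leq_addl.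
  by rewrite hact0 subr0 oppr0.
- move=> vs sn; rewrite PiE // hactD hact_mhbar phiE // hactB hactN KSL // KF.
  by rewrite subr0 mhbar_N LE // subrr.
- move=> vs m sn m0 mn; rewrite PiE // hactD hact_mhbar phiE // hactB hactN HS HF.
  rewrite oppr0 sub0r mhbar_N mhbar_hdiv serE serN mn.
  exact: subrr.
Qed.

Lemma stageP n : (0 < n)%N -> stage n.
Proof.
have [N] := ubnP n; elim: N n => // N IH [|[|n]] // nN _; first exact: stage1.
apply: stage_step => // m /andP[m0 mn]; apply: IH => //.
exact: leq_trans mn _.
Qed.

(** Closed partition sums have vanishing morphism sums, as powers of hbar cancel. *)
Lemma morphism_sum_phi_family_eq0 d v n : (0 < n)%N -> (forall i, GH (d i) (v i)) ->
  morphism_sum l phi_family d v (iota 0 n) = 0.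
Proof.
move=> n0 dv; have hst m : (0 < m < n.+1)%N -> stage m.
  by case/andP=> m0 _; apply: stageP.
rewrite -[RHS](@morphism_sum_eq0 _ _ _ K l hC hl _ _ (trunc n.+1 phi_family) d v n.+1 _ dv _
    (iota 0 n)) ?size_iota ?iota_ltn_sorted //.
- rewrite /morphism_sum big_seq [RHS]big_seq; apply: eq_bigr => q qs.
  congr (_ *: happ _ _); apply/eq_in_map => B Bq; rewrite /trunc size_map ltnS.
  by rewrite (leq_trans (size_block qs Bq)) ?size_iota.
- exact: trunc_stage.
- exact: closed_partition_sum.
Qed.

Lemma Pi_series_partition_sum d vs : (forall i, GH (d i) (nth 0 vs i)) ->
  Pi_series vs = partition_sum phi_family d (nth 0 vs) (iota 0 (size vs)).
Proof.
move=> dv; rewrite /Pi_series; set n := size vs.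
have hst m : (0 < m < n.+1)%N -> stage m by case/andP=> m0 _; apply: stageP.
rewrite (extended_sum_partition_sum (trunc_stage hst) dv) -/n.
by apply: partition_sum_local => us; rewrite size_iota /trunc ltnS => ->.
Qed.

Lemma Pi_series_family_at n : (0 < n)%N -> family_at n Pi_series.
Proof.
move=> n0; have hst m : (0 < m < n.+1)%N -> stage m.
  by case/andP=> m0 _; apply: stageP.
apply: (@eq_family_at n (extended_sum (trunc n.+1 phi_family))).
  by move=> vs sn; rewrite /Pi_series sn.
exact: extended_sum_family_at (trunc_stage hst).
Qed.

Lemma phi_family_unital vs : (0 < size vs)%N -> phi_family (rcons vs oneH) = 0.
Proof. by move=> v0; apply: (stage_unital (stageP (ltn0Sn (size vs)))). Qed.

Lemma Pi_series_rcons vs : (0 < size vs)%N ->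
  Pi_series (rcons vs oneH) = Pi_series vs.
Proof.
move=> v0; rewrite /Pi_series size_rcons.
have hst m : (0 < m < (size vs).+2)%N -> stage m.
  by case/andP=> m0 _; apply: stageP.
rewrite (@extended_sum_rcons_unit _ oneH (trunc_stage hst)) //.
- rewrite /extended_sum; apply: eq_bigr => bs _; apply: partition_sum_local => us.
  by rewrite size_iota /trunc ltnS => u_s; rewrite ltnS (leqW u_s) u_s.
by move=> us u0; rewrite /trunc phi_family_unital //; case: ifP.
Qed.

End Extension.

(** * The quantum retract *)

(** Iterating the step m + 1 times fixes the value at m. *)
Lemma strong_recursion (T : Type) (t0 : T) (step : (nat -> T) -> nat -> T) :
  (forall g g' m, (forall i, (i < m)%N -> g i = g' i) -> step g m = step g' m) ->
  exists g, forall m, g m = step g m.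
Proof.
move=> hstep; pose upto N := iter N step (fun=> t0).
have stable N M m : (m < N)%N -> (m < M)%N -> upto N m = upto M m.
  elim: N M m => [//|N IH] [//|M] m mN mM; rewrite /upto !iterS.
  by apply: hstep => i im; apply: IH; apply: leq_trans im _.
exists (fun m => upto m.+1 m) => m; rewrite {1}/upto iterS.
by apply: hstep => i im; apply: stable.
Qed.

Section Operators.
Context (k : fieldType).

Definition mk_linear (V W : lmodType k) (g : V -> W) (hg : linear g) :
    {linear V -> W} :=
  HB.pack g (GRing.isLinear.Build k V W _ g hg).

Fact hcomp_linear (U V W : lmodType k) (F : nat -> {linear V -> W})
    (G : nat -> {linear U -> V}) m :
  linear (fun v => \sum_(i < m.+1) F i (G (m - i)%N v)).
Proof.
move=> a x y; rewrite scaler_sumr -big_split; apply: eq_bigr => i _.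
by rewrite /= !linearP.
Qed.

(** The coefficients of a composite of series of maps. *)
Definition hcomp (U V W : lmodType k) (F : nat -> {linear V -> W})
    (G : nat -> {linear U -> V}) (m : nat) : {linear U -> W} :=
  mk_linear (hcomp_linear F G m).

Lemma hact_hcomp (U V W : lmodType k) (F : nat -> {linear V -> W})
    (G : nat -> {linear U -> V}) x :
  hact (hcomp F G) x = hact F (hact G x).
Proof.
apply/funext => m; rewrite /hact /=.
under [RHS]eq_bigr => i _ do rewrite linear_sum.
rewrite (triangle_sum (fun i j l => F i (G j (x l)))).
by apply: eq_bigr => t _.
Qed.

End Operators.

Section Retract.
Context (k : fieldType) (C : algType k) (GC : int -> C -> Prop).
Context (K : nat -> {linear C -> C}).
Hypothesis hC : graded_comm_algebra GC.
Let hG := gca_grading hC.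
Hypothesis K_degree : forall m, homog_map GC GC 1 (K m).
Hypothesis K1 : forall m, K m 1 = 0.
Hypothesis KK : forall x, hact K (hact K x) = 0.
Let H := cohomology (K 0%N).
Let GH : int -> H -> Prop := coh_grading GC.
Let oneH : H := coh_class (K 0%N) 1.
Context (f : {linear H -> C}) (h : {linear C -> H}) (s : {linear C -> C}).
Hypothesis hr : on_shell_retract GC f h s.

Let pf (a : nat -> H) : nat -> C := fun m => f (a m).
Let ph (x : nat -> C) : nat -> H := fun m => h (x m).
Let ps (x : nat -> C) : nat -> C := fun m => s (x m).
Let pK (x : nat -> C) : nat -> C := fun m => K 0%N (x m).

(** The perturbation of the classical differential. *)
Let delta (m : nat) : {linear C -> C} :=
  if m is 0 then (\0 : {linear C -> C}) else K m.

Let KE x : hact K x = pK x + hact delta x.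
Proof.
apply/funext => m; rewrite serE /hact !big_ord_recl /= add0r subn0.
by [].
Qed.

Let deltaE x m : hact delta x m = \sum_(i < m) K (m - i)%N (x i).
Proof.
rewrite /hact (reindex_inj rev_ord_inj) /= big_ord_recr /= subSS subnn /= addr0.
apply: eq_bigr => i _; rewrite !subSS subKn; last exact: ltnW.
by have := ltn_ord i; rewrite -subn_gt0; case: (m - i)%N.
Qed.

Let inj_order (y : nat -> C) :
  (forall m, (forall i, (i < m)%N -> y i = 0) -> y m = 0) -> y = 0.
Proof.
move=> hy; apply/funext => m; have [n] := ubnP m.
elim: n m => // n IH m mn; apply: hy => i im; apply: IH.
exact: leq_trans im _.
Qed.

(* 1 + s delta and 1 + delta s are injective, as delta raises the order. *)
Let inj_sdelta y : y + ps (hact delta y) = 0 -> y = 0.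
Proof.
move=> y0; apply: inj_order => m ym.
have := congr1 (fun z => z m) y0; rewrite serE /ps deltaE big1 ?linear0 ?addr0 //.
by move=> i _; rewrite ym ?linear0.
Qed.

Let inj_deltas y : y + hact delta (ps y) = 0 -> y = 0.
Proof.
move=> y0; apply: inj_order => m ym.
have := congr1 (fun z => z m) y0; rewrite serE deltaE big1 ?addr0 //.
by move=> i _; rewrite /ps ym ?linear0.
Qed.

(** Inverts [1 + delta s], order by order. *)
Let inverse : exists A : nat -> {linear C -> C},
  (forall m, homog_map GC GC 0 (A m)) /\
  forall x, hact A x + hact delta (ps (hact A x)) = x.
Proof.
have [A AE] : exists A : nat -> C -> C, forall m, A m = fun v =>
    if m == 0%N then v else - \sum_(j < m) K (m - j)%N (s (A j v)).
  apply: (strong_recursion (T := C -> C) id (step := fun A m v =>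
    if m == 0%N then v else - \sum_(j < m) K (m - j)%N (s (A j v)))) => g g' m E.
  apply/funext => v; case: ifP => // _; congr (- _).
  by apply: eq_bigr => j _; rewrite E.
have A_linear m : linear (A m).
  have [n] := ubnP m; elim: n m => // n IH m mn a x y; rewrite !AE.
  case: ifP => // _; rewrite scalerN -opprD scaler_sumr -big_split; congr (- _).
  apply: eq_bigr => j _; rewrite (IH j) ?linearP //.
  exact: leq_trans (ltn_ord j) _.
have A_degree m : homog_map GC GC 0 (A m).
  have [n] := ubnP m; elim: n m => // n IH m mn e x ex; rewrite !AE.
  case: ifP => [_|_]; first by rewrite addr0.
  rewrite -scaleN1r; apply: (gradingZ hG); apply: (grading_sum hG) => j _.
  rewrite -[e]addr0 -[e + 0](addrNK (1 : int)) addr0; apply: K_degree.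
  have := retract_s_degree hr (IH j _ e x ex); rewrite addr0; apply.
  exact: leq_trans (ltn_ord j) _.
exists (fun m => mk_linear (A_linear m)); split=> // x.
set A' := fun m => mk_linear (A_linear m).
have sA_linear m : linear (s \o A m) by move=> a y z; rewrite /= A_linear linearP.
pose B m := mk_linear (sA_linear m).
have -> : ps (hact A' x) = hact B x.
  by apply/funext => m; rewrite /ps /hact linear_sum.
have coef i v : A i v + hcomp delta B i v = if i == 0%N then v else 0.
  rewrite -[hcomp delta B i v]/(hact delta (fun j => s (A j v)) i) deltaE AE.
  by case: i => [|i]; rewrite /= ?big_ord0 ?addr0 ?addNr.
rewrite -hact_hcomp; apply/funext => m; rewrite serE /hact -big_split.
rewrite (eq_bigr (fun i : 'I_m.+1 => if (i : nat) == 0%N then x (m - i)%N else 0)).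
  by rewrite big_ord_recl /= subn0 big1 ?addr0.
by move=> i _; apply: coef.
Qed.

(** The recursion for the coefficients of F, with the anomaly already removed. *)
Context (fs : nat -> H -> C).
Hypothesis fs0 : forall a, fs 0%N a = f a.
Hypothesis fsE : forall n a, (0 < n)%N ->
  fs n a = - s (\sum_(j < n) K (n - j)%N (fs j a)).
Hypothesis anomaly0 : forall n a, (0 < n)%N ->
  h (\sum_(j < n) K (n - j)%N (fs j a)) = 0.

Let fs_linear m : linear (fs m).
Proof.
have [n] := ubnP m; elim: n m => // n IH [|m] mn a x y; rewrite ?fs0 ?linearP //.
rewrite !fsE // scalerN -opprD -linearP scaler_sumr -big_split; congr (- s _).
apply: eq_bigr => j _; rewrite (IH j) ?linearP //.
exact: leq_trans (ltn_ord j) _.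
Qed.

Definition on_shell_map (m : nat) : {linear H -> C} := mk_linear (fs_linear m).
Let F := on_shell_map.

Lemma on_shell_map_degree m : homog_map GH GC 0 (F m).
Proof.
have [n] := ubnP m; elim: n m => // n IH [|m] mn e x ex.
  by rewrite /= fs0; apply: (retract_f_degree hr).
rewrite /= fsE // -scaleN1r; apply: (gradingZ hG).
rewrite addr0 -[e](addrK 1); apply: (retract_s_degree hr).
apply: (grading_sum hG) => j _; apply: K_degree.
have := IH j _ e x ex; rewrite addr0; apply.
exact: leq_trans (ltn_ord j) _.
Qed.

Let delta_F a m : hact delta (hact F a) m
  = \sum_(i < m.+1) \sum_(j < i) K (i - j)%N (fs j (a (m - i)%N)).
Proof.
rewrite -hact_hcomp; apply: eq_bigr => i _.
by rewrite -[LHS]/(hact delta (fun j => fs j (a (m - i)%N)) i) deltaE.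
Qed.

Let F_eq a : hact F a + ps (hact delta (hact F a)) = pf a.
Proof.
have coef i v : fs i v + s (\sum_(j < i) K (i - j)%N (fs j v))
    = if i == 0%N then f v else 0.
  case: i => [|i]; first by rewrite big_ord0 linear0 addr0 fs0.
  by rewrite fsE // addNr.
apply/funext => m; rewrite serE /ps delta_F linear_sum /hact -big_split.
rewrite (eq_bigr (fun i : 'I_m.+1 => if (i : nat) == 0%N then f (a (m - i)%N) else 0)).
  by rewrite big_ord_recl /= subn0 big1 ?addr0.
by move=> i _; apply: coef.
Qed.

Let h_delta_F a : ph (hact delta (hact F a)) = 0.
Proof.
apply/funext => m; rewrite /ph delta_F linear_sum big1 // => i _.
by case: (i : nat) => [|j]; [rewrite big_ord0 linear0 | rewrite anomaly0].
Qed.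

Let psD x y : ps (x + y) = ps x + ps y.
Proof. by apply/funext => m; rewrite /ps !serE linearD. Qed.
Let psN x : ps (- x) = - ps x.
Proof. by apply/funext => m; rewrite /ps !serN linearN. Qed.
Let phD x y : ph (x + y) = ph x + ph y.
Proof. by apply/funext => m; rewrite /ph !serE linearD. Qed.
Let phN x : ph (- x) = - ph x.
Proof. by apply/funext => m; rewrite /ph !serN linearN. Qed.
Let pKD x y : pK (x + y) = pK x + pK y.
Proof. by apply/funext => m; rewrite /pK !serE linearD. Qed.
Let pKN x : pK (- x) = - pK x.
Proof. by apply/funext => m; rewrite /pK !serN linearN. Qed.
Let psps x : ps (ps x) = 0.
Proof. by apply/funext => m; apply: (retract_ss hr). Qed.
Let pspf a : ps (pf a) = 0.
Proof. by apply/funext => m; apply: (retract_sf hr). Qed.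
Let phps x : ph (ps x) = 0.
Proof. by apply/funext => m; apply: (retract_hs hr). Qed.
Let phpf a : ph (pf a) = a.
Proof. by apply/funext => m; apply: (retract_hf hr). Qed.
Let pKpf a : pK (pf a) = 0.
Proof. by apply/funext => m; apply: (retract_Kf hr). Qed.
Let pfph x : pf (ph x) = x - pK (ps x) - ps (pK x).
Proof. by apply/funext => m; apply: (retract_fh hr). Qed.
Let pKpK x : pK (pK x) = 0.
Proof.
apply/funext => m; have := congr1 (fun y => y 0%N) (KK (hconst (x m))).
by rewrite /hact /= !big_ord1 /=.
Qed.
Let pf0 : pf 0 = 0. Proof. by apply/funext => m; apply: linear0. Qed.
Let ps0 : ps 0 = 0. Proof. by apply/funext => m; apply: linear0. Qed.

(** With g = delta F a, the homotopy identity and h g = 0 give K F a = s K0 g, where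
    K0 is the classical differential; then K K = 0 turns this into
    (1 + s delta) K F a = 0. *)
Lemma on_shell_map_closed a : hact K (hact F a) = 0.
Proof.
set g := hact delta (hact F a); set w := hact K _.
have FE : hact F a = pf a - ps g by rewrite -F_eq addrK.
have gE : g = pK (ps g) + ps (pK g).
  have := pfph g; rewrite h_delta_F pf0 => /esym/eqP.
  by rewrite -addrA -opprD subr_eq0 => /eqP.
have wE : w = ps (pK g).
  rewrite /w KE FE pKD pKN pKpf sub0r -FE -/g [X in _ + X]gE.
  by rewrite addKr.
have pKw : pK w = pK g by rewrite /w KE pKD pKpK add0r.
apply: inj_sdelta; rewrite -/w [X in X + _]wE -pKw -psD.
by have := KK (hact F a); rewrite -/w KE => ->.
Qed.

Lemma on_shell_map1 : hact F (hconst oneH) = hconst 1.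
Proof.
apply/eqP; rewrite -subr_eq0; apply/eqP/inj_sdelta.
rewrite hactB psD psN addrACA F_eq -opprD.
have -> : hact delta (hconst 1) = 0.
  by apply/funext => -[|m]; rewrite hact_const //= K1.
rewrite ps0 addr0; apply/funext => -[|m]; rewrite serE serN /pf /=.
  by rewrite (retract_f1 hr) subrr.
by rewrite linear0 subrr.
Qed.

Let h_F a : ph (hact F a) = a.
Proof.
have -> : hact F a = pf a - ps (hact delta (hact F a)) by rewrite -F_eq addrK.
by rewrite phD phN phpf phps subr0.
Qed.

(** The homological perturbation lemma with vanishing transferred differential:
    Hh = h A and S = s A, where A is the inverse of 1 + delta s. The identity for
    F Hh holds after applying the injective map 1 + s delta, by which F becomes f
    and S becomes s. It implies Hh K = 0, as F is injective. *)
Lemma quantum_retract_exists :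
  exists (F : nat -> {linear H -> C}) (Hh : nat -> {linear C -> H})
    (S : nat -> {linear C -> C}), quantum_retract GC GH K oneH F Hh S.
Proof.
have [A [A_degree AE]] := inverse.
have hA_linear m : linear (h \o A m) by move=> a y z; rewrite /= !linearP.
have sA_linear m : linear (s \o A m) by move=> a y z; rewrite /= !linearP.
pose Hh m := mk_linear (hA_linear m); pose S m := mk_linear (sA_linear m).
have HE x : hact Hh x = ph (hact A x).
  by apply/funext => m; rewrite /ph /hact linear_sum.
have SE x : hact S x = ps (hact A x).
  by apply/funext => m; rewrite /ps /hact linear_sum.
(* A is the identity where s vanishes. *)
have A_fixed y : ps y = 0 -> hact A y = y.
  move=> y0; apply/eqP; rewrite -subr_eq0; apply/eqP/inj_deltas.
  rewrite psD psN y0 subr0; have {2}-> := esym (AE y).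
  by rewrite opprD addrA subrK subrr.
have US x : hact S x + ps (hact delta (hact S x)) = ps x.
  by rewrite SE -psD AE.
have FHE x : hact F (hact Hh x) = x - hact K (hact S x) - hact S (hact K x).
  set y := hact A x; set z := ps y.
  have xE : x = y + hact delta z by rewrite AE.
  have dK : hact delta (hact K z) + hact K (hact delta z) = hact delta (hact delta z).
    rewrite [hact K (hact delta z)]KE addrA -[RHS]add0r; congr (_ + _).
    by have := KK z; rewrite KE [in pK _]KE pKD pKpK add0r addrC.
  have SK : hact S (hact K x) + ps (hact delta (hact S (hact K x)))
      = ps (pK y) + ps (hact delta y) + ps (hact K (hact delta z)).
    by rewrite US {1}xE hactD KE !psD.
  have xU : x + ps (hact delta x) = y + hact delta z
      + (ps (hact delta y) + (ps (hact delta (hact K z)) + ps (hact K (hact delta z)))).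
    by rewrite {1}xE {1}xE hactD psD -[ps _ + ps (hact K _)]psD dK.
  have KU : hact K (hact S x) + ps (hact delta (hact K (hact S x)))
      = pK z + hact delta z + ps (hact delta (hact K z)).
    by rewrite SE -/y -/z {1}KE.
  have FU : hact F (hact Hh x) + ps (hact delta (hact F (hact Hh x)))
      = y - pK z - ps (pK y).
    by rewrite F_eq HE -/y pfph.
  apply/eqP; rewrite -addrA -opprD -subr_eq0 opprB; apply/eqP/inj_sdelta.
  set u := hact F _ in FU *; set v := hact K _ in KU *.
  set w := hact S (hact K _) in SK *.
  have -> : u + (v + w - x) + ps (hact delta (u + (v + w - x)))
     = (u + ps (hact delta u)) + (v + ps (hact delta v)) + (w + ps (hact delta w))
       - (x + ps (hact delta x)).
    rewrite !hactD hactN !psD psN opprD.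
    by rewrite (AC ((1*((1*1)*1))*(1*((1*1)*1))) ((1*5)*(2*6)*(3*7)*(4*8))).
  rewrite FU KU SK xU; apply/eqP; rewrite subr_eq0; apply/eqP.
  rewrite -[y - pK z - _]addrA -opprD.
  (* What remains is the cancellation of pK z + ps (pK y) against its opposite. *)
  rewrite (AC ((1*1)*(3)*(3)) ((1*4*(7*(5*8)))*(2*(3*6)))) /=.
  by rewrite addNr addr0.
exists F, Hh, S; split=> //.
- exact: on_shell_map_degree.
- by move=> m e x ex; have := retract_h_degree hr (A_degree m e x ex); rewrite addr0.
- by move=> m e x ex; have := retract_s_degree hr (A_degree m e x ex); rewrite addr0.
- exact: on_shell_map_closed.
- move=> a; rewrite HE A_fixed ?h_F //.
  have -> : hact F a = pf a - ps (hact delta (hact F a)) by rewrite -F_eq addrK.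
  by rewrite psD psN pspf psps subr0.
- move=> x; rewrite -[LHS]h_F FHE KK [hact S 0]linear0 subr0.
  have -> : hact K x - hact K (hact S (hact K x))
      = hact K (hact F (hact Hh x) + hact K (hact S x)).
    by rewrite FHE addrAC subrK hactB.
  rewrite hactD on_shell_map_closed KK addr0.
  by apply/funext => m; apply: linear0.
- by move=> x; rewrite HE SE A_fixed ?psps // phps.
- by exists 1; split=> //; apply: gca_one hC.
- exact: on_shell_map1.
Qed.

End Retract.

(** * Gradings and homogeneous components *)

Section ParityProjection.
Context (k : fieldType) (V : lmodType k) (GV : int -> V -> Prop).
Hypothesis hV : is_grading GV.

Let on_support (s : seq int) (w : int -> V) (j : int) : V :=
  if j \in s then w j else 0.

Let on_support_homog s w : (forall j, GV j (w j)) ->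
  forall j, GV j (on_support s w j).
Proof. by move=> hw j; rewrite /on_support; case: ifP => // _; apply: grading0. Qed.

Let sum_on_support s r w (Q : pred int) : uniq s -> uniq r -> {subset s <= r} ->
  \sum_(j <- r | Q j) on_support s w j = \sum_(j <- s | Q j) w j.
Proof.
move=> us ur sr; rewrite /on_support -big_mkcondr -big_filter -[RHS]big_filter.
apply: perm_big; apply: uniq_perm; rewrite ?filter_uniq // => j.
rewrite !mem_filter -andbA; congr (_ && _); apply: andb_idr; exact: sr.
Qed.

Let decomposition_unique s w t u j : uniq s -> uniq t ->
  (forall i, GV i (w i)) -> (forall i, GV i (u i)) ->
  \sum_(i <- s) w i = \sum_(i <- t) u i -> on_support s w j = on_support t u j.
Proof.
move=> us ut hw hu E; set r := undup (j :: s ++ t).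
have rs : {subset s <= r} by move=> i is_; rewrite mem_undup inE mem_cat is_ orbT.
have rt : {subset t <= r} by move=> i it; rewrite mem_undup inE mem_cat it !orbT.
have ur : uniq r by apply: undup_uniq.
apply/eqP; rewrite -subr_eq0; apply/eqP.
apply: (grading_free hV (s := r) (w := fun i => on_support s w i - on_support t u i)) => //.
- move=> i; rewrite -scaleN1r addrC; apply: (gradingP hV); exact: on_support_homog.
- by rewrite sumrB !(sum_on_support _ xpredT) // E subrr.
by rewrite mem_undup mem_head.
Qed.

(** The homogeneous components of a vector are unique, hence linear in it; the even
    and the odd part are sums of components. *)
Lemma parity_projection : exists P : bool -> {linear V -> V},
  forall b j x, GV j x -> P b x = if b == parity j then x else 0.
Proof.
have /choice[sw swP] v : exists sw : seq int * (int -> V),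
    [/\ uniq sw.1, forall j, GV j (sw.2 j) & v = \sum_(j <- sw.1) sw.2 j].
  by have [s [w [us hw vE]]] := grading_span hV v; exists (s, w).
pose comp j v := on_support (sw v).1 (sw v).2 j.
have comp_sum v r : uniq r -> {subset (sw v).1 <= r} -> forall Q : pred int,
    \sum_(j <- r | Q j) comp j v = \sum_(j <- (sw v).1 | Q j) comp j v.
  move=> ur sr Q; have [us _ _] := swP v; rewrite sum_on_support //.
  by rewrite -(@sum_on_support (sw v).1 (sw v).1).
have comp_unique v t u j : uniq t -> (forall i, GV i (u i)) ->
    v = \sum_(i <- t) u i -> comp j v = on_support t u j.
  move=> ut hu vE; have [us hw vE'] := swP v.
  by apply: decomposition_unique => //; rewrite -vE' -vE.
have comp_homog v j : GV j (comp j v).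
  by have [_ hw _] := swP v; apply: on_support_homog.
have comp_linear j : linear (comp j).
  move=> a x y; pose r := undup ((sw x).1 ++ (sw y).1).
  have rx : {subset (sw x).1 <= r} by move=> i ix; rewrite mem_undup mem_cat ix.
  have ry : {subset (sw y).1 <= r} by move=> i iy; rewrite mem_undup mem_cat iy orbT.
  have ur : uniq r by apply: undup_uniq.
  have [ux _ xE] := swP x; have [uy _ yE] := swP y.
  rewrite (comp_unique _ r (fun i => a *: comp i x + comp i y)) //; last 2 first.
  - by move=> i; apply: (gradingP hV).
  - rewrite big_split -scaler_sumr.
    by rewrite !(sum_on_support _ xpredT) // -xE -yE.
  rewrite /on_support; case: ifPn => // jr.
  rewrite /comp /on_support (negbTE (contra (rx j) jr)) (negbTE (contra (ry j) jr)).
  by rewrite scaler0 addr0.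
pose P b v := \sum_(j <- (sw v).1 | b == parity j) comp j v.
have P_linear b : linear (P b).
  move=> a x y; pose r := undup ((sw x).1 ++ (sw y).1 ++ (sw (a *: x + y)).1).
  have ur : uniq r by apply: undup_uniq.
  have rx : {subset (sw x).1 <= r} by move=> i ix; rewrite mem_undup !mem_cat ix.
  have ry : {subset (sw y).1 <= r} by move=> i ix; rewrite mem_undup !mem_cat ix orbT.
  have rz : {subset (sw (a *: x + y)).1 <= r}.
    by move=> i ix; rewrite mem_undup !mem_cat ix !orbT.
  rewrite /P -(comp_sum x r) // -(comp_sum y r) // -(comp_sum (a *: x + y) r) //.
  rewrite scaler_sumr -big_split; apply: eq_bigr => j _; exact: comp_linear.
exists (fun b => mk_linear (P_linear b)) => b j x jx.
have compE i : comp i x = if i == j then x else 0.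
  rewrite (comp_unique _ [:: j] (fun i => if i == j then x else 0)) //.
  - by rewrite /on_support inE; case: eqP.
  - by move=> i'; case: eqP => [->|_] //; apply: grading0.
  - by rewrite big_seq1 eqxx.
rewrite /= /P -(comp_sum x (undup (j :: (sw x).1))) ?undup_uniq //; last first.
  by move=> i ix; rewrite mem_undup inE ix orbT.
rewrite (eq_bigr (fun i => if i == j then x else 0)) // -big_mkcondr.
have [bj|bj] := eqVneq b (parity j).
  rewrite -big_filter (_ : [seq _ <- _ | _] = [:: j]) ?big_seq1 //.
  rewrite (eq_filter (a2 := pred1 j)).
    by rewrite filter_pred1_uniq ?undup_uniq // mem_undup mem_head.
  by move=> i /=; apply: andb_idl => /eqP ->; rewrite bj.
by rewrite big1 // => i /andP[bi /eqP ij]; rewrite -ij bi in bj.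
Qed.

End ParityProjection.

Lemma hconst_in_hseries (k : fieldType) (V : lmodType k) (GV : int -> V -> Prop) v :
  is_grading GV -> in_hseries GV (hconst v).
Proof.
move=> hV; have [s [w [_ hw vE]]] := grading_span hV v; exists s => -[|m].
  by exists w.
by exists (fun=> 0); split=> [j|]; [apply: grading0 | rewrite big1].
Qed.

Lemma in_hseries_hact (k : fieldType) (V W : lmodType k)
    (GV : int -> V -> Prop) (GW : int -> W -> Prop) e (T : nat -> {linear V -> W}) x :
  is_grading GW -> (forall m, homog_map GV GW e (T m)) ->
  in_hseries GV x -> in_hseries GW (hact T x).
Proof.
move=> hW hT [s hx]; exists [seq j + e | j <- s] => m.
have /choice[w hw] := hx.
exists (fun j => \sum_(i < m.+1) T i (w (m - i)%N (j - e))); split=> [j|].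
  apply: (grading_sum hW) => i _; rewrite -[X in GW X _](subrK e).
  by apply: hT; have [] := hw (m - i)%N.
rewrite big_map exchange_big; apply: eq_bigr => i _; have [_ ->] := hw (m - i)%N.
by rewrite linear_sum; apply: eq_bigr => j _; rewrite addrK.
Qed.

Lemma hact_eq0 (k : fieldType) (V W : lmodType k) (T : nat -> {linear V -> W}) :
  (forall v, hact T (hconst v) = 0) -> forall x, hact T x = 0.
Proof.
by move=> h x; apply/funext => m; rewrite hact_coef big1 // => i _; rewrite h.
Qed.

(** The retract identifies H with a graded direct summand of C. *)
Lemma coh_grading_is_grading (k : fieldType) (C : algType k) (GC : int -> C -> Prop)
    (K : {linear C -> C}) f h s :
  is_grading GC -> @on_shell_retract k C GC K f h s -> is_grading (coh_grading GC (K := K)).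
Proof.
move=> hG hr.
have hf j a : coh_grading GC j a -> GC j (f a).
  by move=> ja; rewrite -[j]addr0; apply: (retract_f_degree hr).
have hh j x : GC j x -> coh_grading GC j (h x).
  by move=> jx; rewrite -[j]addr0; apply: (retract_h_degree hr).
split.
- by move=> j; rewrite -(linear0 h); apply: hh; apply: (grading0 hG).
- move=> j a x y hx hy; rewrite -(retract_hf hr x) -(retract_hf hr y) -linearP.
  by apply: hh; apply: (gradingP hG); apply: hf.
- move=> a; have [t [w [ut hw aE]]] := grading_span hG (f a).
  exists t, (fun j => h (w j)); split=> // [j|]; first exact: hh.
  by rewrite -linear_sum -aE (retract_hf hr).
- move=> t w ut hw w0 j jt; rewrite -(retract_hf hr (w j)).
  rewrite (grading_free hG (w := fun i => f (w i)) ut _ _ jt) ?linear0 //.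
    by move=> i; apply: hf.
  by rewrite -linear_sum w0 linear0.
Qed.

Lemma nth_codom_ord (n : nat) (T : Type) (x0 : T) (v : 'I_n -> T) (i : 'I_n) :
  nth x0 (codom v) i = v i.
Proof. by rewrite codomE (nth_map i) ?size_enum_ord // nth_ord_enum. Qed.

Lemma size_codom_ord (n : nat) (T : Type) (v : 'I_n -> T) : size (codom v) = n.
Proof. by rewrite codomE size_map size_enum_ord. Qed.

Lemma map_nth_codom (n : nat) (T : Type) (x0 : T) (v : 'I_n -> T) :
  map (nth x0 (codom v)) (iota 0 n) = codom v.
Proof. by rewrite -[n in iota 0 n](size_codom_ord v); exact: (mkseq_nth x0). Qed.

Lemma homog_codom (k : fieldType) (V : lmodType k) (GV : int -> V -> Prop) n
    (d : 'I_n -> int) v : is_grading GV -> homog_family GV d v ->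
  forall i, GV (nth 0 (codom d) i) (nth 0 (codom v) i).
Proof.
move=> hV dv i; have [i_n|ni] := ltnP i n; last first.
  by rewrite !nth_default ?size_codom_ord //; apply: grading0.
by rewrite -[i]/(val (Ordinal i_n)) !nth_codom_ord; apply: dv.
Qed.

(** * The theorem *)

Section Assembly.
Context (k : fieldType) (C : algType k) (GC : int -> C -> Prop).
Context (K : nat -> {linear C -> C}) (l : seq C -> nat -> C).
Hypothesis hC : graded_comm_algebra GC.
Hypothesis l_desc : quantum_descendant GC K l.
Let hG := gca_grading hC.

Lemma Pi_corr_partition_sum (H : lmodType k) (phi : seq H -> nat -> C) n
    (d : 'I_n -> int) (v : 'I_n -> H) :
  Pi_corr phi d v = partition_sum phi (nth 0 (codom d)) (nth 0 (codom v)) (iota 0 n).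
Proof.
rewrite /partition_sum -big_Pn; apply: eq_bigr => p Pp; rewrite size_iota size_part_words.
rewrite (eps_koszul_sign k (d' := nth 0 (codom d)) _ Pp); last exact: nth_codom_ord.
congr (mhbar _ (_ *: hprod _)); rewrite /part_words -map_comp; apply: eq_map => B.
rewrite /= /restr /set_word -map_comp; congr phi; apply: eq_map => i.
by rewrite /= nth_codom_ord.
Qed.

Lemma morphism_lhsE (H : lmodType k) (phi : seq H -> nat -> C) n
    (d : 'I_n -> int) (v : 'I_n -> H) : (0 < n)%N ->
  \sum_(p in Pn n) eps k d p *: happ l [seq phi (restr v B) | B <- blocks p]
  = morphism_sum l phi (nth 0 (codom d)) (nth 0 (codom v)) (iota 0 n).
Proof.
move=> n0; rewrite /morphism_sum -big_Pn; apply: eq_bigr => p Pp.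
rewrite (eps_koszul_sign k (d' := nth 0 (codom d)) _ Pp); last exact: nth_codom_ord.
rewrite happ_descendant0; congr (_ *: _).
have E : [seq phi [seq (codom v)`_i | i <- B] | B <- part_words p]
    = [seq phi (restr v B) | B <- blocks p].
  rewrite /part_words -map_comp; apply: eq_map => B.
  rewrite /= /restr /set_word -map_comp; congr phi; apply: eq_map => i.
  by rewrite /= nth_codom_ord.
have [Hp _ _ _] := part_words_canonical Pp.
have b0 : blocks p != [::].
  apply: contraTneq n0 => pe; rewrite /part_words pe in Hp.
  by rewrite -[n](size_iota 0) -(perm_size Hp).
by rewrite E; case: (blocks p) b0.
Qed.

(** The descendant relation for one argument; it extends to inhomogeneous x by
    linearity. *)
Lemma descendant1 x : l [:: x] = hact K (hconst x).
Proof.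
apply/eqP; rewrite -subr_eq0; apply/eqP.
apply: (linear_eq0_homog hG (f := fun x => l [:: x] - hact K (hconst x))) => [a y z|j y hy].
  have lin m := (descendant_hom l_desc (ltn0Sn 0) m).1.1 a y z [::] [::] erefl.
  have -> : l [:: a *: y + z] = a *: l [:: y] + l [:: z].
    by apply/funext => m; rewrite serE serZ; apply: lin.
  have -> : hconst (a *: y + z) = a *: hconst y + hconst z by exact: linearP.
  by rewrite hactD hactZ opprD addrACA -scalerBr.
have := @descendant_splits_const k C GC K l hC l_desc 1 (fun=> j) (fun=> y) isT (fun=> hy).
rewrite big_seq1 => ->; rewrite big_cons big_seq1 /= hmul0l scaler0 mhbar_0 addr0.
by rewrite mhbar0 koszul_sign_sorted // scale1r hmuls1 subrr.
Qed.

Lemma happ_descendant1 x : happ l [:: x] = hact K x.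
Proof.
by apply/funext => m; rewrite hact_coef; apply: eq_bigr => i _; rewrite /= descendant1.
Qed.

End Assembly.

Theorem theorem1p1 (k : fieldType) (char0 : [pchar k] =i pred0)
    (C : algType k) (GC : int -> C -> Prop) (K : nat -> {linear C -> C})
    (l : seq C -> nat -> C)
    (C_qft : binary_QFT_algebra GC K) (l_desc : quantum_descendant GC K l)
    (C_free : anomaly_free GC K) :
  let H := cohomology (K 0%N) in
  let GH : int -> H -> Prop := coh_grading GC in
  let oneH : H := coh_class (K 0%N) 1 in
  exists (phi : seq H -> nat -> C) (ppi : seq H -> nat -> H),
  unital_sLinf_quasi_iso GH oneH (fun _ => 0) GC 1 l phi /\
  (forall n m, (0 < n)%N -> sym_multilinear GH n (fun vs => ppi vs m)) /\
  [/\ forall c : nat -> {linear C -> k^o}, quantum_expectation GC K c ->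
        exists iota : nat -> {linear H -> k^o},
        forall n (d : 'I_n -> int) (v : 'I_n -> H),
          (0 < n)%N -> homog_family GH d v ->
          hact c (Pi_corr phi d v) = hact iota (ppi (codom v)),
      forall v, ppi [:: v] = hconst v,
      forall n, (1 < n)%N ->
        exists p : nat -> seq H -> H,
          (forall j, (j <= n - 2)%N -> sym_multilinear GH n (p j)) /\
          (forall vs, size vs = n ->
             ppi vs = \sum_(0 <= j < (n - 2).+1) mhbar j (hconst (p j vs)))
    & forall n (vs : seq H), (1 < n)%N -> size vs = n.-1 ->
        ppi (rcons vs oneH) = ppi vs].
Proof.
move=> H GH oneH.
have hC := qft_algebra C_qft; have hG := gca_grading hC.
have K_degree := qft_degree C_qft; have K1 := qft_one C_qft.
have KK x : hact K (hact K x) = 0.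
  rewrite -hact_hcomp; apply: hact_eq0 => v; rewrite hact_hcomp.
  exact/(qft_square C_qft)/hconst_in_hseries.
(* The coefficients of F satisfy the recursion without the kappa terms, since
   kappa = 0 and fs n is zero at 0. *)
have [f [h [s [fs [kappa [hr fs0 kappaE fsE kappa0]]]]]] := C_free.
have fs_0 n : fs n 0 = 0.
  have [N] := ubnP n; elim: N n => // N IH [|n] nN; first by rewrite fs0 linear0.
  rewrite fsE // /obstruction big_nat big1 ?big_nat ?big1 ?subrr ?linear0 ?oppr0 //.
    move=> j /andP[j0 jn]; rewrite kappa0 // IH //.
    lia.
  by move=> j /andP[_ jn]; rewrite IH ?linear0 //; apply: leq_trans jn _.
have obE n a : obstruction K fs kappa n a = \sum_(j < n) K (n - j)%N (fs j a).
  rewrite /obstruction big_mkord big_nat [X in _ - X]big1 ?subr0 // => j /andP[j0 jn].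
  by rewrite kappa0.
have fsE' n a : (0 < n)%N -> fs n a = - s (\sum_(j < n) K (n - j)%N (fs j a)).
  by move=> n0; rewrite -obE fsE.
have anomaly n a : (0 < n)%N -> h (\sum_(j < n) K (n - j)%N (fs j a)) = 0.
  by move=> n0; rewrite -obE -kappaE // kappa0.
have hH : is_grading GH := coh_grading_is_grading hG hr.
have [F [Hh [S hQ]]] := quantum_retract_exists hC K_degree K1 KK hr fs0 fsE' anomaly.
have [P hP] := parity_projection hH.
pose phi := phi_family P K F Hh S; pose PI := Pi_series P K F Hh S.
pose ppi vs := hact Hh (PI vs).
have stages n : (0 < n)%N -> stage GC GH P K F Hh S oneH n.
  by move=> n0; exact: (stageP hC hH hP l_desc hQ n0).
have PI_family n : (0 < n)%N -> family_at GC GH n PI.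
  by move=> n0; exact: (Pi_series_family_at hC hH hP l_desc hQ n0).
have ppi_linear n : (0 < n)%N -> forall a x y s1 s2, (size s1 + size s2).+1 = n ->
    ppi (s1 ++ (a *: x + y) :: s2) = a *: ppi (s1 ++ x :: s2) + ppi (s1 ++ y :: s2).
  move=> n0 a x y s1 s2 sn.
  by rewrite /ppi (family_at_linear (PI_family n n0)) // hactD hactZ.
have ppi_sym n m : (0 < n)%N -> sym_multilinear GH n (fun vs => ppi vs m).
  move=> n0; split=> [a x y s1 s2 sn|i j x y s1 s2 sn hx hy].
    by rewrite (ppi_linear n).
  by rewrite /ppi (family_at_swap (PI_family n n0) sn hx hy) hactZ.
have ppi_low n vs m : (1 < n)%N -> size vs = n -> (n - 2 < m)%N -> ppi vs m = 0.
  move=> n1 sn nm; apply: (stage_low (stages n (ltnW n1)) sn); last by lia.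
  exact: leq_ltn_trans nm.
exists phi, ppi; split; first split.
- split.
  + move=> n n0 m; have [h1 h2 h3] := stage_family (stages n n0); split=> [|d v dv].
      split=> [a x y s1 s2 sn|i j x y s1 s2 sn hx hy]; first by rewrite /phi h1.
      by rewrite /phi (h2 _ _ _ _ _ _ sn hx hy).
    have := h3 _ _ _ (size_iota 0 n) (homog_codom hH dv) m; rewrite map_nth_codom addr0.
    rewrite -[n in iota 0 n]subn0 -/(index_iota 0 n) big_mkord.
    by under eq_bigr => i _ do rewrite nth_codom_ord.
  + by rewrite /phi phi_family1 (quantum_F1 hQ).
  + exact: (phi_family_unital hC hH hP l_desc hQ).
  + move=> n d v n0 dv; rewrite morphism_lhsE //.
    rewrite (morphism_sum_phi_family_eq0 hC hH hP l_desc hQ n0 (homog_codom hH dv)).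
    apply/esym; rewrite big1 // => p _; rewrite big1 // => i _.
    rewrite /bracket_word happ_zero ?scaler0 // => s1 s2 _ _.
    have [h1 _ _] := stage_family (stages _ (ltn0Sn (size s1 + size s2))).
(* The words on the right side contain the zero series, at which phi vanishes. *)
    have := h1 (-1) 0 0 s1 s2 erefl.
    by rewrite scaler0 addr0 scaleN1r addNr.
- have happ_phi1 x : happ phi [:: x] = hact F x.
    apply/funext => m; rewrite hact_coef; apply: eq_bigr => i _.
    by rewrite /= /phi phi_family1.
  have happ0 x : happ (fun=> 0 : nat -> H) [:: x] = 0 :> (nat -> H).
    by apply/funext => m; rewrite /= big1.
  split=> [x hx _ [y _]|y hy].
    rewrite happ_phi1 (happ_descendant1 hC l_desc) => E.
    exists 0.
      exists [::] => m; exists (fun=> 0).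
      by split=> [j|]; rewrite ?big_nil //; apply: grading0.
    by rewrite happ0 -(quantum_HF hQ x) E (quantum_HK hQ).
  rewrite (happ_descendant1 hC l_desc) => Ky.
  exists (hact Hh y), (hact S y); split=> //.
  + exact: in_hseries_hact hH (quantum_Hh_degree hQ) hy.
  + exact: in_hseries_hact hG (quantum_S_degree hQ) hy.
  + rewrite happ_phi1 (happ_descendant1 hC l_desc) (quantum_FH hQ) Ky.
    by rewrite hact0 subr0 subrK.
split; first exact: ppi_sym.
split.
(* The functional is c F: c kills the image of K, and Pi = F ppi + K S Pi. *)
- move=> c hc; exists (hcomp c F) => n d v n0 dv.
  have cK x : hact c (hact K x) = 0.
    rewrite -hact_hcomp; apply: hact_eq0 => {}x; rewrite hact_hcomp.
    exact/(expectation_cochain hc)/hconst_in_hseries.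
  have dv' := homog_codom hH dv.
  rewrite hact_hcomp /ppi (quantum_FH hQ) !hactB cK subr0.
  rewrite (stage_closed (stages n n0)) ?size_codom_ord // !hact0 subr0.
  rewrite /PI (Pi_series_partition_sum hC hH hP l_desc hQ dv') size_codom_ord.
  by rewrite Pi_corr_partition_sum.
- by move=> v; rewrite /ppi /PI (Pi_series1 hC hH hP hQ) (quantum_HF hQ).
(* The coefficients of ppi, up to the sign in (- hbar)^j. *)
- move=> n n1; exists (fun j vs => (-1) ^+ j *: ppi vs j); split=> [j _|vs sn].
    have [h1 h2] := ppi_sym n j (ltnW n1); 
      split=> [a x y s1 s2 s_n|i i' x y s1 s2 s_n hx hy].
      by rewrite h1 // scalerDr !scalerA mulrC.
    by rewrite (h2 _ _ _ _ _ _ s_n hx hy) !scalerA mulrC.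
  apply/funext => m; rewrite ser_sum.
  have E j : mhbar j (hconst ((-1) ^+ j *: ppi vs j)) m = if j == m then ppi vs m else 0.
    rewrite /mhbar /hconst; case: ltngtP => // [jm|<-].
      by case E : (m - j)%N => [|i]; rewrite ?scaler0 //; move: jm; rewrite -subn_gt0 E.
    by rewrite subnn scalerA -exprD addnn -signr_odd odd_double scale1r.
  under eq_bigr => j _ do rewrite E.
  rewrite -big_mkcond big_nat1_eq ltnS /=; case: leqP => // nm.
  by rewrite (ppi_low n).
- move=> n vs n1 sn; rewrite /ppi /PI (Pi_series_rcons hC hH hP l_desc hQ) //.
  by rewrite sn -ltnS prednK // ltnW.
Qed.
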